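(* Let $T>0$ and let the structural assumptions (i)–(iii) (for some $\sigma\in[0,1]$) and the lifting assumptions (L1)–(L4) of the context hold. Then there exists $\tilde r>0$ such that for all $f\in Y$, $g\in\tilde W$, $h\in X_{\mathfrak{T}}$ with $\tilde h(0)-g\in W$ and $$\|f\|_{Y}+\|g\|_{\tilde W}+\|h\|_{X_{\mathfrak{T}}}<\tilde r,$$ there exists a unique solution $u\in\tilde X$ of $$\partial_tu+\tilde{\mathfrak{A}}u+\tilde{\mathfrak{B}}[u,u]=f,\qquad u(0)=g,\qquad \mathfrak{T}(u)=h.$$
   Context: Structural assumptions. (i) $H$ is a real infinite-dimensional separable Hilbert space with scalar product $\langle\cdot,\cdot\rangle$. (ii) $\mathfrak{A}:D(\mathfrak{A})\subset H\to H$ is linear, densely defined, and $\mathfrak{A}=\mathcal{A}+\mathscr{A}$, where $\mathcal{A}:D(\mathfrak{A})\subset H\to H$ (so $D(\mathcal{A})=D(\mathfrak{A})$) is self-adjoint with pure point spectrum: it has real eigenvalues $0<\lambda_1\le\lambda_2\le\dots$, $\lambda_k\to\infty$, and the eigenvectors $\{\phi_k\}_{k\ge1}$ form an orthonormal Hilbert basis of $H$. The operator $\mathscr{A}:D(\mathfrak{A})\subset H\to H$ is linear and skew symmetric (in particular $\langle\mathscr{A}u,u\rangle=0$ for $u\in D(\mathfrak{A})$), and $\mathscr{A}:D(\mathcal{A}^{1/2})\to H$ is bounded. (iii) $\mathfrak{B}:D(\mathfrak{A})\times D(\mathfrak{A})\to H$ is bilinear and there is $C_{\mathfrak{B}}>0$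 with $$|\langle\mathfrak{B}[u,w],v\rangle|\le C_{\mathfrak{B}}\|\mathcal{A}^{\frac{\sigma+1}{2}}u\|_H\,\|\mathcal{A}^{\frac{\sigma}{2}}w\|_H\,\|\mathcal{A}^{\frac{1-\sigma}{2}}v\|_H$$ for all $u\in D(\mathcal{A}^{\frac{\sigma+1}{2}})$, $w\in D(\mathcal{A}^{\frac{\sigma}{2}})$, $v\in D(\mathcal{A}^{\frac{1-\sigma}{2}})$ (with $\mathfrak{B}$ understood as extended accordingly by continuity). Fractional powers: $\mathcal{A}^su=\sum_k\lambda_k^s\langle u,\phi_k\rangle\phi_k$, and for $s\ge0$, $D(\mathcal{A}^s)=\{u\in H:\sum_k\lambda_k^{2s}\langle u,\phi_k\rangle^2<\infty\}$ with norm $\|\mathcal{A}^su\|_H$; $D(\mathcal{A}^{-s}):=D(\mathcal{A}^s)^*$ (duality with pivot space $H$). Spaces: $U:=D(\mathcal{A}^{\frac{1+\sigma}{2}})$, $V:=D(\mathcal{A}^{\frac{1-\sigma}{2}})$, $W:=D(\mathcal{A}^{\frac{\sigma}{2}})$, $X:=L^2(0,T;U)\cap H^1(0,T;V^* )$, $Y:=L^2(0,T;V^* )$. All operators act pointwise in time on time-dependent functions. Lifting assumptions. (L1) There are Banach spaces $\tilde U,\tilde V,\tilde W$ with continuous embeddings $U\hookrightarrow\tilde U$, $V\hookrightarrow\tilde V$, $W\hookrightarrow\tilde W$, where $U,V,W$ are closed subspaces of $\tilde U,\tilde V,\tilde W$, respectively. Define $\tilde X:=L^2(0,T;\tilde U)\cap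 H^1(0,T;V^* )$ and $\tilde Y:=L^2(0,T;V^* )$ (so $\tilde Y=Y$). The embedding $\tilde X\hookrightarrow C([0,T];\tilde W)$ holds. (L2) The boundary operator $\mathfrak{T}:\tilde X\to\mathfrak{T}(\tilde X)$ is linear; $\mathfrak{T}(u)=0$ for $u\in X$, and conversely $u\in\tilde X$ with $\mathfrak{T}(u)=0$ implies $u\in X$. (L3) $\tilde{\mathfrak{A}}=\tilde{\mathcal{A}}+\tilde{\mathscr{A}}:\tilde X\to\tilde Y$ is linear and well defined, where $\tilde{\mathcal{A}}:D(\tilde{\mathcal{A}})\subset H\to H$ with $D(\mathcal{A})\hookrightarrow D(\tilde{\mathcal{A}})$ and $\tilde{\mathscr{A}}:D(\tilde{\mathcal{A}})\subset H\to H$. Moreover $\tilde{\mathcal{A}}|_X=\mathcal{A}$, $\tilde{\mathscr{A}}|_X=\mathscr{A}$, and $\tilde{\mathscr{A}}:\tilde X\to\tilde Y$ is bounded. $\tilde{\mathfrak{B}}:\tilde X\times\tilde X\to\tilde Y$ is bilinear, well defined and bounded, and $\tilde{\mathfrak{B}}|_{X\times X}=\mathfrak{B}$. (L4) There are a Banach space $X_{\mathfrak{T}}\subseteq\mathfrak{T}(\tilde X)$ and a constant $c_h>0$ such that for each $h\in X_{\mathfrak{T}}$ there exists a unique $\tilde h\in\tilde X$ with $\tilde{\mathcal{A}}\tilde h=0$ and $\mathfrak{T}(\tilde h)=h$, and $\|\tilde h\|_{\tilde X}\le c_h\|h\|_{X_{\mathfrak{T}}}$. The evolution equation is understood as an equality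 in $\tilde Y$, the initial condition in $\tilde W$. *)

(* Defs.v *)
From HB Require Import structures.
From mathcomp Require Import all_boot all_order all_algebra.
From mathcomp Require Import all_classical all_reals all_analysis.
From mathcomp Require Import ring lra.

Set Implicit Arguments.
Unset Strict Implicit.
Unset Printing Implicit Defensive.
Import Order.TTheory GRing.Theory Num.Theory.
Import numFieldNormedType.Exports.
Local Open Scope classical_set_scope.
Local Open Scope ring_scope.

HB.mixin Record NormedModule_isPreHilbert (R : realType) H
    of NormedModule R H := {
  ip : H -> H -> R ;
  ip_linearl : forall (a : R) (x y z : H),
    ip (a *: x + y) z = a * ip x z + ip y z ;
  ip_sym : forall x y : H, ip x y = ip y x ;
  ip_norm : forall x : H, ip x x = `|x| ^+ 2
}.

#[short(type="hilbertType")]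
HB.structure Definition Hilbert (R : realType) :=
  {H of CompleteNormedModule R H & NormedModule_isPreHilbert R H}.

(* The eigenpairs (lambda_k, phi_k), numbered from 0. An orthonormal Hilbert
   basis indexed by nat makes H separable and infinite-dimensional. *)
Record eigensystem (R : realType) (H : hilbertType R) := Eigensystem {
  eigval : nat -> R ;
  eigvec : nat -> H ;
  eigval_gt0 : forall k, 0 < eigval k ;
  eigval_nd : nondecreasing_seq eigval ;
  eigval_cvg : eigval @ \oo --> +oo ;
  eigvec_orthonormal : forall j k, ip (eigvec j) (eigvec k) = (j == k)%:R ;
  eigvec_basis : forall u : H,
    series (fun k => ip u (eigvec k) *: eigvec k) @ \oo --> u
}.

Arguments eigvec_basis {R H} e u.

Section InnerProduct.
Context {R : realType} {H : hilbertType R}.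
Implicit Types x y z : H.

Lemma ip0l y : ip (0 : H) y = 0.
Proof. by have := ip_linearl (-1) 0 0 y; rewrite scaler0 addr0 mulN1r addNr. Qed.

Lemma ipDl x y z : ip (x + y) z = ip x z + ip y z.
Proof. by have := ip_linearl 1 x y z; rewrite scale1r mul1r. Qed.

Lemma ipZl a x z : ip (a *: x) z = a * ip x z.
Proof. by have := ip_linearl a x 0 z; rewrite addr0 ip0l addr0. Qed.

Lemma ipDr x y z : ip z (x + y) = ip z x + ip z y.
Proof. by rewrite ip_sym ipDl !(ip_sym _ z). Qed.

Lemma ipZr a x z : ip z (a *: x) = a * ip z x.
Proof. by rewrite ip_sym ipZl (ip_sym _ z). Qed.

Lemma ipBl x y z : ip (x - y) z = ip x z - ip y z.
Proof. by rewrite -scaleN1r ipDl ipZl mulN1r. Qed.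

Lemma ip_suml (I : Type) (s : seq I) (P : pred I) (f : I -> H) z :
  ip (\sum_(i <- s | P i) f i) z = \sum_(i <- s | P i) ip (f i) z.
Proof.
elim/big_ind2 : _ => [|a b c d <- <-|//]; first exact: ip0l.
exact: ipDl.
Qed.

Lemma ip_sumr (I : Type) (s : seq I) (P : pred I) (f : I -> H) z :
  ip z (\sum_(i <- s | P i) f i) = \sum_(i <- s | P i) ip z (f i).
Proof. by rewrite ip_sym ip_suml; apply: eq_bigr => i _; exact: ip_sym. Qed.

Lemma ip_CauchySchwarz x y : `|ip x y| <= `|x| * `|y|.
Proof.
have [->|y0] := eqVneq y 0; first by rewrite ip_sym ip0l normr0 mulr_ge0.
have ny : 0 < `|y| ^+ 2 by rewrite exprn_gt0// normr_gt0.
have : 0 <= `|y| ^+ 2 * (`|x| ^+ 2 * `|y| ^+ 2 - ip x y ^+ 2).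
  rewrite (_ : _ * _ = `| `|y| ^+ 2 *: x + (- ip x y) *: y| ^+ 2) ?sqr_ge0//.
  rewrite -[RHS]ip_norm !(ipDl, ipZl, ipDr, ipZr) !ip_norm (ip_sym y x).
  by ring.
rewrite pmulr_rge0// subr_ge0 -exprMn => h.
by rewrite -(@ler_pXn2r _ 2)// ?nnegrE ?mulr_ge0// -normrX ger0_norm ?sqr_ge0.
Qed.

Lemma ip_continuousl y : continuous (fun x : H => ip x y).
Proof.
move=> x; apply/cvgrPdist_le => e e0; near=> z.
rewrite -ipBl (le_trans (ip_CauchySchwarz _ _))//.
have y1 : 0 < `|y| + 1 by rewrite ltr_wpDl.
rewrite (@le_trans _ _ (`|x - z| * (`|y| + 1)))// ?ler_wpM2l ?lerDl//.
rewrite -ler_pdivlMr//; near: z.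
by apply: cvgr_dist_le; [exact: cvg_id|rewrite divr_gt0].
Unshelve. all: by end_near. Qed.

End InnerProduct.

Section FractionalPowers.
Context {R : realType} {H : hilbertType R} (A : eigensystem H).
Implicit Types (s : R) (u v : H).

Definition Apow s u : H :=
  limn (series (fun k => (eigval A k `^ s * ip u (eigvec A k)) *: eigvec A k)).

(* D(A^s), for s >= 0: sum_k lambda_k^(2s) <u, phi_k>^2 < oo. *)
Definition in_dom s : {pred H} := fun u =>
  `[< cvgn (series (fun k => eigval A k `^ (2 * s) * ip u (eigvec A k) ^+ 2)) >].


Lemma in_domP s u : reflect
  (cvgn (series (fun k => eigval A k `^ (2 * s) * ip u (eigvec A k) ^+ 2)))
  (u \in in_dom s).
Proof. exact: asboolP. Qed.

Lemma in_domE s u k :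
  eigval A k `^ (2 * s) * ip u (eigvec A k) ^+ 2 =
  (eigval A k `^ s * ip u (eigvec A k)) ^+ 2.
Proof.
by rewrite exprMn; congr (_ * _); rewrite -powR_mulrn ?powR_ge0// -powRrM mulrC.
Qed.

Lemma norm_sum_eigvec (c : nat -> R) m n :
  `|\sum_(m <= k < n) c k *: eigvec A k| ^+ 2 = \sum_(m <= k < n) c k ^+ 2.
Proof.
rewrite -ip_norm ip_suml; apply: eq_big_nat => j jmn.
rewrite ipZl ip_sumr (bigD1_seq j)/= ?mem_index_iota ?iota_uniq//.
rewrite ipZr eigvec_orthonormal eqxx mulr1 big1 ?addr0 -?expr2// => i ij.
by rewrite ipZr eigvec_orthonormal eq_sym (negbTE ij) mulr0.
Qed.

Lemma cvg_series_eigvec (c : nat -> R) :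
  cvgn (series (fun k => c k ^+ 2)) ->
  cvgn (series (fun k => c k *: eigvec A k)).
Proof.
move=> /cauchy_cvgP/cauchy_seriesP h.
apply/cauchy_cvgP/cauchy_seriesP => e e0.
have e2 : 0 < e ^+ 2 by rewrite exprn_gt0.
apply: filterS (h _ e2) => -[m n]/=.
rewrite -norm_sum_eigvec ger0_norm ?sqr_ge0//.
by rewrite ltr_pXn2r ?nnegrE ?(ltW e0).
Qed.

Lemma in_dom_cvg s u : u \in in_dom s ->
  series (fun k => (eigval A k `^ s * ip u (eigvec A k)) *: eigvec A k) @ \oo
    --> Apow s u.
Proof.
move=> /in_domP h; apply: cvg_series_eigvec.
suff <- : (fun k => eigval A k `^ (2 * s) * ip u (eigvec A k) ^+ 2) =
  (fun k => (eigval A k `^ s * ip u (eigvec A k)) ^+ 2) by [].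
by apply/funext => k; exact: in_domE.
Qed.

Lemma in_dom_submod s : submod_closed (in_dom s).
Proof.
split.
  apply/in_domP; rewrite (_ : series _ = fun=> 0); first exact: is_cvg_cst.
  by apply/funext => n; rewrite /series/= big1// => k _; rewrite ip0l expr0n mulr0.
move=> a u v /in_domP hu /in_domP hv; apply/in_domP.
apply: (@series_le_cvg _ _ (fun k =>
  (2 * a ^+ 2) * (eigval A k `^ (2 * s) * ip u (eigvec A k) ^+ 2) +
  2 * (eigval A k `^ (2 * s) * ip v (eigvec A k) ^+ 2))).
- by move=> k; apply: mulr_ge0; [exact: powR_ge0|exact: sqr_ge0].
- by move=> k; apply: addr_ge0; do ![exact: sqr_ge0 | exact: powR_ge0 | apply: mulr_ge0 => //].
- move=> k; rewrite ipDl ipZl.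
  set p := _ `^ _; set x := ip u _; set y := ip v _.
  have p0 : 0 <= p by exact: powR_ge0.
  rewrite -subr_ge0 (_ : _ - _ = p * (a * x - y) ^+ 2); last by ring.
  by apply: mulr_ge0 => //; exact: sqr_ge0.
- by apply: is_cvg_seriesD; apply: is_cvg_seriesZ.
Qed.

Lemma Apow_linear s a u v : u \in in_dom s -> v \in in_dom s ->
  Apow s (a *: u + v) = a *: Apow s u + Apow s v.
Proof.
move=> us vs.
have uvs : a *: u + v \in in_dom s by exact: (in_dom_submod s).2.
apply: (cvg_unique _ (in_dom_cvg uvs)); first exact: norm_hausdorff.
pose S w := series (fun k => (eigval A k `^ s * ip w (eigvec A k)) *: eigvec A k).
rewrite /= -[series _]/(S (a *: u + v)).
rewrite (_ : S _ = (a \*: S u) + S v)/=.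
  by apply: cvgD; [apply: cvgZl_tmp|]; exact: in_dom_cvg.
apply/funext => n; rewrite /S /series/= fctE/= scaler_sumr -big_split/=.
apply: eq_bigr => k _.
by rewrite ipDl ipZl scalerA -scalerDl; congr (_ *: _); ring.
Qed.

Lemma ApowZ s a u : u \in in_dom s -> Apow s (a *: u) = a *: Apow s u.
Proof.
move=> us; have d0 := (in_dom_submod s).1.
have A0 : Apow s 0 = 0.
  by have := Apow_linear (-1) d0 d0; rewrite scaler0 addr0 scaleN1r addNr.
by rewrite -[a *: u]addr0 Apow_linear// A0 addr0.
Qed.

Lemma ip_Apow s u k : u \in in_dom s ->
  ip (Apow s u) (eigvec A k) = eigval A k `^ s * ip u (eigvec A k).
Proof.
move=> us.
have h := continuous_cvg _ (@ip_continuousl R H (eigvec A k) _) (in_dom_cvg us).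
apply: (@cvg_unique R _ _ _ _ _ (h _)); first exact: norm_hausdorff.
rewrite /=; apply: cvg_near_cst; near=> n.
rewrite /= /series/= ip_suml (bigD1_seq k)/= ?iota_uniq//; last first.
  by rewrite mem_index_iota/=; near: n; exact: nbhs_infty_gt.
rewrite ipZl eigvec_orthonormal eqxx mulr1 big1 ?addr0// => i ik.
by rewrite ipZl eigvec_orthonormal (negbTE ik) mulr0.
Unshelve. all: by end_near. Qed.

Lemma Apow_eq0 s u : u \in in_dom s -> Apow s u = 0 -> u = 0.
Proof.
move=> us E; have h := eigvec_basis A u.
apply: (cvg_unique _ h); first exact: norm_hausdorff.
rewrite /=; apply: cvg_near_cst; apply: nearW => n; rewrite /series/= big1// => k _.
have := ip_Apow k us; rewrite E ip0l => /esym/eqP; rewrite mulf_eq0 => /orP[|].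
  by rewrite gt_eqF// powR_gt0// eigval_gt0.
by move=> /eqP ->; rewrite scale0r.
Qed.

Lemma le_norm_Apow s : 0 <= s ->
  exists2 C, 0 <= C & forall u, u \in in_dom s -> `|u| <= C * `|Apow s u|.
Proof.
move=> s0; exists (eigval A 0 `^ s)^-1; first by rewrite invr_ge0 powR_ge0.
move=> u us; have l0 := @powR_gt0 R (eigval A 0) s (eigval_gt0 A 0).
rewrite mulrC ler_pdivlMr// mulrC.
have hu := cvg_norm (eigvec_basis A u); have hA := cvg_norm (in_dom_cvg us).
have hu' : eigval A 0 `^ s * `|series (fun k => ip u (eigvec A k) *: eigvec A k) n|
   @[n --> \oo] --> eigval A 0 `^ s * `|u| by apply: cvgM; [exact: cvg_cst|exact: hu].
apply: (ler_cvg_to hu' (hA _)); apply: nearW => n.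
rewrite -(@ler_pXn2r _ 2)// ?nnegrE ?mulr_ge0 ?powR_ge0// exprMn.
rewrite !norm_sum_eigvec big_distrr/=; apply: ler_sum => k _.
rewrite exprMn ler_wpM2r ?sqr_ge0// ler_pXn2r ?nnegrE ?powR_ge0//.
rewrite ge0_ler_powR ?nnegrE//; try exact/ltW/eigval_gt0.
by apply: eigval_nd.
Qed.

End FractionalPowers.

(* D(A^s) as a normed space, with the norm |A^s u|. *)
Record dom (R : realType) (H : hilbertType R) (A : eigensystem H) (s : R) :=
  Dom { dom_val : H ; dom_valP : dom_val \in in_dom A s }.

Section DomInstances.
Context {R : realType} {H : hilbertType R} (A : eigensystem H) (s : R).
Notation D := (dom A s).

HB.instance Definition _ := [isSub for @dom_val R H A s].
HB.instance Definition _ := [Choice of D by <:].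
HB.instance Definition _ :=
  GRing.isSubmodClosed.Build R H (in_dom A s) (in_dom_submod A s).
HB.instance Definition _ := [SubChoice_isSubLmodule of D by <:].

Definition dom_norm (u : D) : R := `|Apow A s (val u)|.

Lemma dom_normD u v : dom_norm (u + v) <= dom_norm u + dom_norm v.
Proof.
rewrite /dom_norm -[u]scale1r linearP/= Apow_linear ?dom_valP// !scale1r.
exact: ler_normD.
Qed.

Lemma dom_normZ a u : dom_norm (a *: u) = `|a| * dom_norm u.
Proof.
by rewrite /dom_norm linearZ/= ApowZ ?dom_valP// normrZ.
Qed.

Lemma dom_norm_eq0 u : dom_norm u = 0 -> u = 0.
Proof.
move=> /normr0_eq0 /(Apow_eq0 (dom_valP u)) u0; exact: val_inj.
Qed.

HB.instance Definition _ :=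
  Lmodule_isNormed.Build R D dom_normD dom_normZ dom_norm_eq0.

Lemma dom_normE (u : D) : `|u| = `|Apow A s (val u)|.
Proof. by []. Qed.

End DomInstances.

Section Dual.
Context {R : realType} (V : normedModType R).

(* The topological dual, normed by the operator norm. *)
Definition in_dual : {pred V -> R^o} :=
  fun f => `[< linear f /\ continuous f >].

Record dual := Dual { dual_fun :> V -> R^o ; dual_funP : dual_fun \in in_dual }.

HB.instance Definition _ := [isSub for dual_fun].
HB.instance Definition _ := [Choice of dual by <:].

Lemma bounded_in_dual (f : V -> R^o) (C : R) :
  linear f -> (forall v, `|f v| <= C * `|v|) -> f \in in_dual.
Proof.
move=> lf h; apply/asboolP; split => // x.
have fB y z : f (y - z) = f y - f z.
  by rewrite -scaleN1r addrC lf scaleN1r addrC.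
apply/cvgrPdist_le => e e0; near=> z.
have C1 : 0 < `|C| + 1 by rewrite ltr_wpDl.
rewrite -fB (le_trans (h _))//.
rewrite (@le_trans _ _ ((`|C| + 1) * `|x - z|))//.
  by rewrite ler_wpM2r// (le_trans (ler_norm C))// lerDl.
rewrite mulrC -ler_pdivlMr//; near: z.
by apply: cvgr_dist_le; [exact: cvg_id|rewrite divr_gt0].
Unshelve. all: by end_near. Qed.

Lemma in_dual_submod : submod_closed in_dual.
Proof.
split.
  apply/asboolP; split => [a u v|]; [|exact: cst_continuous].
  by change (0 = a *: 0 + 0 :> R^o); rewrite scaler0 addr0.
move=> a f g /asboolP[lf cf] /asboolP[lg cg]; apply/asboolP; split.
  move=> b u v; change (a *: f (b *: u + v) + g (b *: u + v) = b *: (a *: f u + g u) + (a *: f v + g v)).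
  rewrite lf lg !scalerDr !scalerA.
  by rewrite -!addrA; congr (_ + _); rewrite ?(mulrC a b)// addrCA.
move=> v; apply: cvgD; last exact: cg.
by apply: cvgZl_tmp; exact: cf.
Qed.

HB.instance Definition _ :=
  GRing.isSubmodClosed.Build R (V -> R^o) in_dual in_dual_submod.
HB.instance Definition _ := [SubChoice_isSubLmodule of dual by <:].

Definition dual_norm (f : dual) : R :=
  sup [set `|f v| | v in [set v : V | `|v| <= 1]].

Lemma dual_linear (f : dual) : linear f.
Proof. by have /asboolP[] := dual_funP f. Qed.

Lemma dual_continuous (f : dual) : continuous f.
Proof. by have /asboolP[] := dual_funP f. Qed.

Lemma dualZ (f : dual) a v : f (a *: v) = a * f v.
Proof.
have l := dual_linear f; have f0 : f 0 = 0.
  by have := l (-1) 0 0; rewrite scaler0 addr0 scaleN1r addNr.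
by have := l a v 0; rewrite f0 !addr0.
Qed.

Lemma dual_bounded (f : dual) : exists C : R, forall v, `|f v| <= C * `|v|.
Proof.
pose m := GRing.isLinear.Build R V R^o _ f (dual_linear f).
pose g : {linear V -> R^o} := HB.pack (dual_fun f) m.
have /linear_bounded_continuous/linear_boundedP : continuous g.
  exact: dual_continuous.
by move=> /filter_ex[C h]; exists C => v; exact: h.
Qed.

Lemma dual_norm_has_sup (f : dual) :
  has_sup [set `|f v| | v in [set v : V | `|v| <= 1]].
Proof.
split; first by exists `|f 0|, 0 => //=; rewrite normr0.
have [C h] := dual_bounded f; exists `|C| => _ [v /= v1 <-].
rewrite (le_trans (h v))// (le_trans (ler_norm _))// normrM normr_id.
by rewrite ler_piMr.
Qed.

Lemma dual_norm_ge (f : dual) v : `|f v| <= dual_norm f * `|v|.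
Proof.
have [->|v0] := eqVneq v 0; first by have := dualZ f 0 0; rewrite scale0r mul0r => ->; rewrite !normr0 mulr0.
have nv : 0 < `|v| by rewrite normr_gt0.
rewrite -ler_pdivrMr//; apply: ub_le_sup; first by case: (dual_norm_has_sup f).
exists (`|v|^-1 *: v) => /=.
  by rewrite normrZ ger0_norm ?invr_ge0// mulVf ?gt_eqF.
by rewrite dualZ normrM ger0_norm ?invr_ge0// mulrC.
Qed.

Lemma dual_norm_le (f : dual) C :
  0 <= C -> (forall v, `|f v| <= C * `|v|) -> dual_norm f <= C.
Proof.
move=> C0 h; apply: ge_sup; first by case: (dual_norm_has_sup f).
by move=> _ [v /= v1 <-]; rewrite (le_trans (h v))// ler_piMr.
Qed.

Lemma dual_norm_ge0 (f : dual) : 0 <= dual_norm f.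
Proof.
apply: (@le_trans _ _ `|f 0|) => //; apply: ub_le_sup.
  by case: (dual_norm_has_sup f).
by exists 0 => //=; rewrite normr0.
Qed.

Lemma dual_normD f g : dual_norm (f + g) <= dual_norm f + dual_norm g.
Proof.
apply: dual_norm_le; first by rewrite addr_ge0 ?dual_norm_ge0.
move=> v; rewrite (le_trans (ler_normD _ _))// mulrDl.
by apply: lerD; exact: dual_norm_ge.
Qed.

Lemma dual_normZ a f : dual_norm (a *: f) = `|a| * dual_norm f.
Proof.
have H b g : dual_norm (b *: g) <= `|b| * dual_norm g.
  apply: dual_norm_le; first by rewrite mulr_ge0 ?dual_norm_ge0.
  by move=> v; rewrite normrM -mulrA ler_wpM2l// dual_norm_ge.
apply/eqP; rewrite eq_le H/=.
have [->|a0] := eqVneq a 0; first by rewrite normr0 mul0r dual_norm_ge0.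
rewrite -ler_pdivlMl ?normr_gt0// -normfV.
by rewrite -{1}[f](scalerK a0) H.
Qed.

Lemma dual_norm_eq0 f : dual_norm f = 0 -> f = 0.
Proof.
move=> f0; apply: val_inj; apply/funext => v /=.
by apply/eqP; rewrite -normr_le0 (le_trans (dual_norm_ge _ _))// f0 mul0r.
Qed.

HB.instance Definition _ :=
  Lmodule_isNormed.Build R dual dual_normD dual_normZ dual_norm_eq0.

End Dual.

Section Pivot.
Context {R : realType} {H : hilbertType R} (A : eigensystem H) (s : R).

(* The embedding of the pivot space H into D(A^s)^*, h |-> <h, .>. The default
   value 0 of insubd is irrelevant for s >= 0, see pivotE. *)
Definition pivot (h : H) : dual (dom A s) :=
  insubd 0 (fun v : dom A s => ip h (val v) : R^o).

Lemma pivotE h v : 0 <= s -> pivot h v = ip h (val v).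
Proof.
move=> s0; rewrite /pivot -[LHS]/(val (insubd _ _) v) insubdK//.
have [C C0 hC] := le_norm_Apow A s0.
apply: (@bounded_in_dual _ _ _ (`|h| * C)) => [a x y|x].
  by rewrite linearP/= ipDr ipZr.
rewrite (le_trans (ip_CauchySchwarz _ _))// -mulrA ler_wpM2l//.
exact: hC (dom_valP x).
Qed.

End Pivot.

(* Time-dependent functions are functions on R considered on [0, T], up to
   equality almost everywhere. *)
Section TimeDependentFunctions.
Context {R : realType} (T : R).
Local Notation mu := (@lebesgue_measure R).

Definition aeT (P : R -> Prop) : Prop :=
  {ae mu, forall t, `[0, T]%classic t -> P t}.

Record step_fun (Z : normedModType R) := StepFun {
  sf_card : nat ;
  sf_set : 'I_sf_card -> set R ;
  sf_vec : 'I_sf_card -> Z ;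
  sf_setP : forall i, measurable (sf_set i)
}.

Arguments sf_set {Z} s i.
Arguments sf_vec {Z} s i.

Definition sf_fun (Z : normedModType R) (s : step_fun Z) (t : R) : Z :=
  \sum_i \1_(sf_set s i) t *: sf_vec s i.

Definition sf_int (Z : normedModType R) (s : step_fun Z) : Z :=
  \sum_i fine (mu (sf_set s i `&` `[0, T]%classic)) *: sf_vec s i.

Definition strongly_measurable (Z : normedModType R) (a : R -> Z) : Prop :=
  exists s : nat -> step_fun Z, aeT (fun t => sf_fun (s n) t @[n --> \oo] --> a t).

(* a is Bochner integrable over [0, T], with integral I. *)
Definition bochner (Z : normedModType R) (a : R -> Z) (I : Z) : Prop :=
  strongly_measurable a /\
  exists s : nat -> step_fun Z,
    (\int[mu]_(t in `[0%R, T]) `|a t - sf_fun (s n) t|%:E)%E @[n --> \oo] --> 0%E /\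
    sf_int (s n) @[n --> \oo] --> I.

Definition L2 (Z : normedModType R) (a : R -> Z) : Prop :=
  strongly_measurable a /\ (\int[mu]_(t in `[0%R, T]) (`|a t| ^+ 2)%:E < +oo)%E.

Definition L2norm (Z : normedModType R) (a : R -> Z) : R :=
  Num.sqrt (fine (\int[mu]_(t in `[0%R, T]) (`|a t| ^+ 2)%:E)%E).

(* C^1 functions with compact support in (0, T); these define the same weak
   derivative as the smooth ones. *)
Definition test_fun (eta : R -> R) : Prop :=
  [/\ forall t, derivable eta t 1, continuous (derive1 eta)
    & exists a b, [/\ 0 < a, b < T & forall t, t \notin `[a, b] -> eta t = 0]].

Definition weak_derivative (Z : normedModType R) (b db : R -> Z) : Prop :=
  forall eta, test_fun eta -> exists I,
    bochner (fun t => derive1 eta t *: b t) I /\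
    bochner (fun t => eta t *: db t) (- I).

(* b is in H^1(0, T; Z), with weak derivative db. *)
Definition H1 (Z : normedModType R) (b db : R -> Z) : Prop :=
  [/\ L2 b, L2 db & weak_derivative b db].

Definition H1norm (Z : normedModType R) (b db : R -> Z) : R :=
  Num.sqrt (L2norm b ^+ 2 + L2norm db ^+ 2).

(* u is in L^2(0, T; Z1) and, under the identifications e1, e2 of Z1, Z2 with
   subspaces of E, it is the function b in H^1(0, T; Z2), where db = d_t u. *)
Definition L2H1 (Z1 Z2 : normedModType R) (E : lmodType R) (e1 : Z1 -> E)
    (e2 : Z2 -> E) (u : R -> Z1) (b db : R -> Z2) : Prop :=
  [/\ L2 u, H1 b db & aeT (fun t => e1 (u t) = e2 (b t))].

Definition L2H1norm (Z1 Z2 : normedModType R) (u : R -> Z1) (b db : R -> Z2) : R :=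
  L2norm u + H1norm b db.

(* c is the representative of u in C([0, T]; Z2). *)
Definition cont_rep (Z1 Z2 : normedModType R) (E : lmodType R) (e1 : Z1 -> E)
    (e2 : Z2 -> E) (u : R -> Z1) (c : R -> Z2) : Prop :=
  {within `[0, T], continuous c} /\ aeT (fun t => e1 (u t) = e2 (c t)).

Definition initial_value (Z1 Z2 : normedModType R) (E : lmodType R)
    (e1 : Z1 -> E) (e2 : Z2 -> E) (u : R -> Z1) (g : Z2) : Prop :=
  exists2 c, cont_rep e1 e2 u c & c 0 = g.

End TimeDependentFunctions.

Notation spU A sigma := (dom A ((1 + sigma) / 2)).
Notation spV A sigma := (dom A ((1 - sigma) / 2)).
Notation spW A sigma := (dom A (sigma / 2)).
Notation spV' A sigma := (dual (spV A sigma)).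
Notation pivotV A sigma := (pivot A ((1 - sigma) / 2)).

Definition linear_on (R : realType) (H F : lmodType R) (D : set H)
    (f : H -> F) : Prop :=
  [/\ D 0, forall (a : R) u v, D u -> D v -> D (a *: u + v)
    & forall (a : R) u v, D u -> D v -> f (a *: u + v) = a *: f u + f v].

(* f is symmetric on D and D contains the domain of the adjoint of f. *)
Definition self_adjoint (R : realType) (H : hilbertType R) (D : set H)
    (f : H -> H) : Prop :=
  (forall u v, D u -> D v -> ip (f u) v = ip u (f v)) /\
  (forall v w, (forall u, D u -> ip (f u) v = ip u w) -> D v /\ f v = w).

(* D is the common domain, cA the self-adjoint and cS the skew-symmetric part.
   cS already denotes the bounded extension to D(A^(1/2)), and B the extension by
   continuity to U x W -> V^* of a bilinear map from D x D to H. *)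
Record structural (R : realType) (H : hilbertType R) (A : eigensystem H)
    (sigma : R) (D : set H) (cA cS : H -> H)
    (B : {bilinear spU A sigma -> spW A sigma -> spV' A sigma}) : Prop := {
  st_dense : closure D = setT ;
  st_A_linear : linear_on D cA ;
  st_A_self_adjoint : self_adjoint D cA ;
  st_A_eigvec : forall k,
    D (eigvec A k) /\ cA (eigvec A k) = eigval A k *: eigvec A k ;
  st_S_linear : linear_on [set u | u \in in_dom A (1 / 2)] cS ;
  st_S_skew : forall u v, D u -> D v -> ip (cS u) v = - ip u (cS v) ;
  st_S_bounded : exists C : R, forall u : dom A (1 / 2), `|cS (val u)| <= C * `|u| ;
  st_B_pivot : forall u w, D (val u) -> D (val w) ->
    exists z, B u w = pivotV A sigma z ;
  st_B_bound : exists2 C : R, 0 < C & forall u w (v : spV A sigma),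
    `|B u w v| <= C * `|u| * `|w| * `|v|
}.

(* i embeds Z0 as a closed subspace of Z, compatibly with the identifications
   e0, e of Z0, Z with subspaces of E. *)
Definition closed_extension (R : realType) (Z0 Z : normedModType R)
    (E : lmodType R) (e0 : Z0 -> E) (i : Z0 -> Z) (e : Z -> E) : Prop :=
  [/\ continuous i, injective i, closed (range i), injective e
    & forall z, e (i z) = e0 z].

(* All spaces are identified with subspaces of one vector space E, through the
   injections eV' of V^* (hence eH of H and eD of D(A^s)), eU, eV, eW; this
   gives their intersections and inclusions a meaning. *)
Section Lifting.
Context {R : realType} {H : hilbertType R} {A : eigensystem H} {sigma : R}
  (T : R) {E : lmodType R} (eV' : {linear spV' A sigma -> E})
  {Ut Vt Wt : completeNormedModType R}
  (eU : {linear Ut -> E}) (eV : {linear Vt -> E}) (eW : {linear Wt -> E})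
  (iU : {linear spU A sigma -> Ut}) (iV : {linear spV A sigma -> Vt})
  (iW : {linear spW A sigma -> Wt}).

Definition eH (h : H) : E := eV' (pivotV A sigma h).

Definition eD s (u : dom A s) : E := eH (val u).

Definition inX (w : R -> spU A sigma) : Prop :=
  exists b db, L2H1 T (@eD _) eV' w b db.

Definition inXt (u : R -> Ut) : Prop := exists b db, L2H1 T eU eV' u b db.

Record lifting_spaces : Prop := {
  ls_ambient : injective eV' ;
  ls_U : closed_extension (@eD _) iU eU ;
  ls_V : closed_extension (@eD _) iV eV ;
  ls_W : closed_extension (@eD _) iW eW ;
  ls_cont : exists C : R, forall u b db, L2H1 T eU eV' u b db ->
    exists2 c, cont_rep T eU eW u c &
      forall t, t \in `[0, T] -> `|c t| <= C * L2H1norm T u b db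
}.

(* Z is any vector space containing the range of the boundary operator TT. *)
Record boundary_operator (Z : lmodType R) (TT : (R -> Ut) -> Z) : Prop := {
  bo_ae : forall u v, inXt u -> inXt v -> aeT T (fun t => u t = v t) -> TT u = TT v ;
  bo_linear : forall (a : R) u v, inXt u -> inXt v ->
    TT (fun t => a *: u t + v t) = a *: TT u + TT v ;
  bo_ker : forall u, inXt u ->
    TT u = 0 <-> exists2 w, inX w & aeT T (fun t => u t = iU (w t))
}.

(* The lifted operators act pointwise in time through At, St, Bt on the space Ut;
   cAt, cSt are the operators in H with domain Dt, where Dt, as D, carries the
   graph norm. lo_At_X says that At restricts to u |-> sum_k lambda_k <u, phi_k>
   phi_k, with convergence in V^*, which is the extension of cA to U. *)
Record lifted_operators (D : set H) (cA cS : H -> H)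
    (B : {bilinear spU A sigma -> spW A sigma -> spV' A sigma})
    (Dt : set H) (cAt cSt : H -> H) (At St : {linear Ut -> spV' A sigma})
    (Bt : {bilinear Ut -> Ut -> spV' A sigma}) : Prop := {
  lo_At_linear : linear_on Dt cAt ;
  lo_St_linear : linear_on Dt cSt ;
  lo_dom : D `<=` Dt /\
    exists C : R, forall u, D u -> `|u| + `|cAt u| <= C * `|cA u| ;
  lo_compat : forall x h, Dt h -> eU x = eH h ->
    At x = pivotV A sigma (cAt h) /\ St x = pivotV A sigma (cSt h) ;
  lo_well_defined : forall u, inXt u -> L2 T (fun t => At (u t) + St (u t)) ;
  lo_At_X : forall u : spU A sigma,
    series (fun k => (eigval A k * ip (val u) (eigvec A k)) *:
                     pivotV A sigma (eigvec A k)) @ \oo --> At (iU u) ;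
  lo_St_X : forall u : spU A sigma, St (iU u) = pivotV A sigma (cS (val u)) ;
  lo_St_bounded : exists C : R, forall u b db, L2H1 T eU eV' u b db ->
    L2 T (fun t => St (u t)) /\
    L2norm T (fun t => St (u t)) <= C * L2H1norm T u b db ;
  lo_Bt_bounded : exists C : R, forall u b db v c dc,
    L2H1 T eU eV' u b db -> L2H1 T eU eV' v c dc ->
    L2 T (fun t => Bt (u t) (v t)) /\
    L2norm T (fun t => Bt (u t) (v t)) <=
      C * L2H1norm T u b db * L2H1norm T v c dc ;
  lo_Bt_X : forall (u v : spU A sigma) (w : spW A sigma),
    val v = val w :> H -> Bt (iU u) (iU v) = B u w
}.

(* eX identifies the Banach space XT of boundary data with a subspace of Z. *)
Definition is_lifting (Z : lmodType R) (TT : (R -> Ut) -> Z)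
    (XT : normedModType R) (eX : XT -> Z)
    (At : Ut -> spV' A sigma) (h : XT) (ht : R -> Ut) : Prop :=
  [/\ inXt ht, aeT T (fun t => At (ht t) = 0) & TT ht = eX h].

Record lifting_property (Z : lmodType R) (TT : (R -> Ut) -> Z)
    (XT : normedModType R) (eX : XT -> Z) (At : Ut -> spV' A sigma) : Prop := {
  lp_inj : injective eX ;
  lp_range : forall h, exists2 u, inXt u & TT u = eX h ;
  lp_exists : forall h, exists ht, is_lifting TT eX At h ht ;
  lp_unique : forall h ht ht', is_lifting TT eX At h ht ->
    is_lifting TT eX At h ht' -> aeT T (fun t => ht t = ht' t) ;
  lp_bound : exists2 c_h : R, 0 < c_h & forall h ht b db,
    is_lifting TT eX At h ht -> L2H1 T eU eV' ht b db ->
    L2H1norm T ht b db <= c_h * `|h|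
}.

Definition is_solution (Z : lmodType R) (TT : (R -> Ut) -> Z)
    (XT : normedModType R) (eX : XT -> Z) (At St : Ut -> spV' A sigma)
    (Bt : Ut -> Ut -> spV' A sigma) (f : R -> spV' A sigma) (g : Wt) (h : XT)
    (u : R -> Ut) : Prop :=
  exists b db, [/\ L2H1 T eU eV' u b db,
    aeT T (fun t => db t + (At (u t) + St (u t)) + Bt (u t) (u t) = f t),
    initial_value T eU eW u g & TT u = eX h].

End Lifting.

(* Main.v *)
(** The unknown is the right-hand side F, in L^2(0, T; V^* ), of the linear equation
    governed by the self-adjoint part: if z denotes its mild solution, with coefficients
    e^(-lambda_k t) w0_k + int_0^t e^(-lambda_k (t - s)) F_k(s) ds and iW w0 = g - g0,
    then u = ht + iU z solves the problem if and only if
    F = f - d_t ht - St u - Bt(u, u).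
    In the norm of e^(-kappa t) F with kappa large, St (iU z) is a contraction, because
    the skew part is of lower order, and the quadratic term is one on a small ball; this
    gives existence.  For uniqueness among all solutions, not only the small ones, the
    difference of two solutions lies in the kernel of TT, so it is iU w with w the mild
    solution for some G, and the weighted norm a(t) of G on [0, t] is continuous,
    vanishes at 0 and satisfies a <= a / 2 + M a^2; hence it vanishes identically. *)

(* A right-hand side is a good unknown because the mild solution of any F in L^2 with values in V^*
   automatically has the regularity of X, with a norm controlled by F; the whole problem then lives
   in one L^2 space. Along the eigenvectors the linear equation splits into scalar Volterra
   formulas, so every linear estimate becomes an inequality between powers of lambda_k. Two
   obstacles shape the rest. The skew part is bounded but not small: lambda_k / (lambda_k + kap)^2
   <= 1 / (4 kap) makes the W norm of z small, and [skew_estimate] passes this on to [St]. The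
   bilinear map is bounded only in unweighted norms over all of [0, T]: this costs e^(kap T),
   absorbed by small data, and it forbids restricting a solution to [0, t]. For uniqueness G is
   therefore cut off after t, and causality identifies the new mild solution with w up to t. Initial
   data are measured in [Wt], so recovering w0 from [iW w0] takes a bounded inverse of [iW],
   obtained from its closed range by a category argument. *)
Require Import Defs.
From HB Require Import structures.
From mathcomp Require Import all_boot all_order all_algebra.
From mathcomp Require Import all_classical all_reals all_analysis.
From mathcomp Require Import measurable_realfun ring lra.

Set Implicit Arguments.
Unset Strict Implicit.
Unset Printing Implicit Defensive.
Import Order.TTheory GRing.Theory Num.Theory.
Import numFieldNormedType.Exports.
Local Open Scope classical_set_scope.
Local Open Scope ring_scope.

(** * Integration on the line *)

Section LowerIntegral.
Context d (X : measurableType d) (R : realType).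
Variable mu : {measure set X -> \bar R}.
Local Open Scope ereal_scope.
Import HBNNSimple.

(* No measurability: for arbitrary nonnegative functions the library's integral
   is a supremum over simple functions below, which is still monotone a.e. *)
Lemma ge0_ae_le_integral (D : set X) (f g : X -> \bar R) :
  (forall x, D x -> 0 <= f x) -> (forall x, D x -> 0 <= g x) ->
  {ae mu, forall x, D x -> f x <= g x} ->
  \int[mu]_(x in D) f x <= \int[mu]_(x in D) g x.
Proof.
move=> f0 g0 [N [mN N0 fgN]].
rewrite [leLHS]ge0_integralE// [leRHS]ge0_integralE//.
apply: ge_ereal_sup => _ [h /= hf <-].
have mNc := measurableC mN.
pose h' := proj_nnsfun h mNc.
have h'E : (h' : X -> R) = (h \_ (~` N))%R by rewrite /h' mrestrict.
have -> : sintegral mu h = sintegral mu h'.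
  rewrite h'E -(integral_nnsfun mu mNc).
  have -> : sintegral mu h = \int[mu]_(x in setT) (h x)%:E.
    by rewrite integral_nnsfun// patch_setT.
  rewrite (ge0_negligible_integral mN)//= ?setTD//; first exact/measurable_EFinP.
  by move=> x _; rewrite lee_fin.
apply: ereal_sup_ubound; exists h' => //= x.
rewrite -[(_ * _)%R]/(h' x) h'E /patch; case: ifPn => [|_]; last first.
  by case: ifPn => //; rewrite inE => /g0.
rewrite inE => nNx; have := hf x; rewrite /patch.
case: ifPn => //; rewrite inE => Dx hfx; apply: le_trans hfx _.
by apply: contrapT => fg; apply: nNx; apply: fgN => /(_ Dx).
Qed.

Lemma ae_eq_integral_nomeas (D : set X) (f g : X -> \bar R) :
  {ae mu, forall x, D x -> f x = g x} ->
  \int[mu]_(x in D) f x = \int[mu]_(x in D) g x.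
Proof.
move=> fg; rewrite integralE [RHS]integralE.
have H (u v : X -> \bar R) : {ae mu, forall x, D x -> u x = v x} ->
    (forall x, 0 <= u x) -> (forall x, 0 <= v x) ->
    \int[mu]_(x in D) u x = \int[mu]_(x in D) v x.
  move=> uv u0 v0; apply/eqP; rewrite eq_le; apply/andP; split;
  apply: ge0_ae_le_integral => //; apply: filterS uv => x /[apply] ->//.
by congr (_ - _); apply: H => //; apply: filterS fg => x /[apply];
  rewrite ?funeposE ?funenegE => ->.
Qed.

End LowerIntegral.

Section TriangleFubini.
Context {R : realType}.
Local Notation mu := (@lebesgue_measure R).

Lemma itv_integrable_cst (a b c : R) : mu.-integrable `[a, b] (EFin \o cst c).
Proof.
apply/integrableP; split; first exact/measurable_EFinP/measurable_cst.
rewrite /= integral_cst//= lte_mul_pinfty//.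
by rewrite lebesgue_measure_itv/=; case: ifP; rewrite ?ltry.
Qed.

(** Both sides are the integral of psi(t) g(s) over the triangle s <= t. Since [psi] and [g] are
    controlled on [0, T] only, they are extended by zero, which makes the product integrable on the
    plane. *)
Lemma Fubini_triangle (T M : R) (psi g : R -> R) :
  measurable_fun setT psi -> (forall t, 0 <= t <= T -> `|psi t| <= M) ->
  mu.-integrable `[0, T] (EFin \o g) ->
  \int[mu]_(t in `[0, T]) (psi t * \int[mu]_(s in `[0, t]) g s) =
  \int[mu]_(s in `[0, T]) (g s * \int[mu]_(t in `[s, T]) psi t).
Proof.
move=> mpsi psiM ig; set I := `[0, T]%classic.
have mI : measurable I by exact: measurable_itv.
pose p := psi \_ I; pose q := g \_ I.
have mp : measurable_fun setT p.
  by apply/(measurable_restrictT _ mI); exact: measurable_funTS.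
have iq : mu.-integrable setT (EFin \o q).
  have := (integrable_restrict mu mI measurableT (EFin \o g)).1.
  by rewrite setTI restrict_EFin; exact.
have mq : measurable_fun setT q by apply/measurable_EFinP; exact: measurable_int iq.
pose F (z : R * R) : \bar R := (if z.2 <= z.1 then p z.1 * q z.2 else 0)%:E.
have mF : measurable_fun setT F.
  apply/measurable_EFinP; apply: measurable_fun_ifT => //.
    by apply: measurable_fun_ler; [exact: measurable_snd|exact: measurable_fst].
  apply: measurable_funM; first exact: measurableT_comp mp measurable_fst.
  exact: measurableT_comp mq measurable_snd.
have ip : mu.-integrable setT (EFin \o p).
  have := (integrable_restrict mu mI measurableT (EFin \o psi)).1.
  rewrite setTI restrict_EFin; apply.
  apply: (@le_integrable _ _ _ mu I _ _ (EFin \o cst `|M|)) => //.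
  - by apply/measurable_EFinP; exact: measurable_funTS.
  - move=> x; rewrite /I/= in_itv/= => xI; rewrite lee_fin.
    by rewrite normr_id (le_trans (psiM _ xI))// ler_norm.
  - exact: itv_integrable_cst.
have iF : (mu \x mu)%E.-integrable setT F.
  apply/integrable12ltyP => //.
  apply: (@le_lt_trans _ _ (\int[mu]_x \int[mu]_y (`|(p x)%:E| * `|(q y)%:E|))%E).
    apply: ge0_ae_le_integral.
    - by move=> x _; apply: integral_ge0.
    - by move=> x _; apply: integral_ge0.
    - apply: aeW => x _; apply: ge0_ae_le_integral => //.
      apply: aeW => y _; rewrite /F/= lee_fin -normrM.
      by case: ifP => // _; rewrite normr0.
  under eq_integral => x _.
    rewrite ge0_integralZl//; last first.
      by apply: measurableT_comp => //; exact/measurable_EFinP.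
    over.
  have [_ lq] := integrableP _ _ _ iq; have [_ lp] := integrableP _ _ _ ip.
  rewrite ge0_integralZr//.
  - by rewrite lte_mul_pinfty// ?integral_ge0// ge0_fin_numE ?integral_ge0.
  - by apply: measurableT_comp => //; exact/measurable_EFinP.
  - exact: integral_ge0.
have FE x y : F (x, y) = (if y <= x then p x * q y else 0)%:E by [].
have E1 x : (\int[mu]_y F (x, y))%E = ((fun t => psi t * \int[mu]_(s in `[0%R, t]) g s) \_ I x)%:E.
  rewrite /patch; case: ifPn => xI; last first.
    rewrite integral0_eq// => y _; rewrite FE /p /patch (negbTE xI) mul0r.
    by case: ifP.
  have xI' : 0 <= x <= T by move: xI; rewrite inE /I/= in_itv.
  have mx : measurable `[0, x]%classic by exact: measurable_itv.
  have sx : `[0, x] `<=` I.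
    by apply: subset_itvl; rewrite bnd_simp; case/andP: xI'.
  transitivity (\int[mu]_y ((psi x)%:E * ((EFin \o g) \_ `[0%R, x]) y))%E.
    apply: eq_integral => y _; rewrite FE restrict_EFin/= -EFinM; congr EFin.
    rewrite /p {1}/patch xI /q /patch; case: ifPn => yx.
      congr (_ * _); rewrite !mem_setE !in_itv/= yx andbT.
      by rewrite (le_trans yx) ?andbT//; case/andP: xI'.
    by rewrite mem_setE in_itv/= (negbTE yx) andbF mulr0.
  rewrite integralZl//; last first.
    by apply/(integrable_restrict mu mx measurableT); rewrite setTI; exact: integrableS ig.
  rewrite -integral_mkcond EFinM fineK//.
  by apply: integrable_fin_num => //; apply: integrableS ig.
have E2 y : (\int[mu]_x F (x, y))%E = ((fun s => g s * \int[mu]_(t in `[s, T]) psi t) \_ I y)%:E.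
  rewrite /patch; case: ifPn => xI; last first.
    rewrite integral0_eq// => x _; rewrite FE /q /patch (negbTE xI) mulr0.
    by case: ifP.
  have xI' : 0 <= y <= T by move: xI; rewrite inE /I/= in_itv.
  have mx : measurable `[y, T]%classic by exact: measurable_itv.
  have sx : `[y, T] `<=` I.
    by apply: subset_itvr; rewrite bnd_simp; case/andP: xI'.
  have ipsi : mu.-integrable `[y, T] (EFin \o psi).
    have := (integrable_restrict mu mI measurableT (EFin \o psi)).2.
    by rewrite setTI restrict_EFin => /(_ ip); apply: integrableS.
  transitivity (\int[mu]_x ((g y)%:E * ((EFin \o psi) \_ `[y, T]) x))%E.
    apply: eq_integral => x _; rewrite FE restrict_EFin/= -EFinM; congr EFin.
    rewrite /q {1}/patch xI /p /patch; case: ifPn => yx.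
      rewrite mulrC; congr (_ * _); rewrite !mem_setE !in_itv/= yx/=.
      by rewrite (le_trans _ yx)//; case/andP: xI'.
    by rewrite mem_setE in_itv/= (negbTE yx) mulr0.
  rewrite integralZl//; last first.
    by apply/(integrable_restrict mu mx measurableT); rewrite setTI.
  by rewrite -integral_mkcond EFinM fineK// integrable_fin_num.
rewrite Rintegral_mkcond [RHS]Rintegral_mkcond; congr fine.
transitivity (\int[mu]_x \int[mu]_y F (x, y))%E.
  by apply: eq_integral => x _; rewrite E1.
by rewrite (Fubini iF); apply: eq_integral => y _; rewrite -E2.
Qed.

End TriangleFubini.

Section CauchySchwarz.
Context d (X : measurableType d) (R : realType).
Variables (mu : {measure set X -> \bar R}) (D : set X).
Hypothesis mD : measurable D.
Implicit Types f g : X -> R.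

Lemma integrable_boundedM f g (M : R) : measurable_fun D g ->
  (forall x, D x -> `|g x| <= M) -> mu.-integrable D (EFin \o f) ->
  mu.-integrable D (EFin \o (fun x => g x * f x)).
Proof.
move=> mg gM intf; have mf : measurable_fun D f.
  by apply/measurable_EFinP; exact: measurable_int intf.
apply: (@le_integrable _ _ _ _ _ mD _ (fun x => M%:E * (EFin \o f) x)%E).
- by apply/measurable_EFinP; exact: measurable_funM.
- move=> x Dx /=; rewrite lee_fin !normrM ler_wpM2r//.
  by rewrite (le_trans (gM _ Dx))// ler_norm.
- exact: integrableZl.
Qed.

Section Pair.
Variables f g : X -> R.
Hypotheses (mf : measurable_fun D f) (mg : measurable_fun D g).
Hypotheses (f2 : mu.-integrable D (EFin \o (fun x => f x ^+ 2)))
           (g2 : mu.-integrable D (EFin \o (fun x => g x ^+ 2))).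

Lemma integrable_prod_sqr : mu.-integrable D (EFin \o (fun x => f x * g x)).
Proof.
apply: (@le_integrable _ _ _ _ _ mD _
  ((EFin \o (fun x => f x ^+ 2)%R) \+ (EFin \o (fun x => g x ^+ 2)%R))%E).
- by apply/measurable_EFinP; exact: measurable_funM.
- move=> x Dx /=; rewrite lee_fin normrM [leRHS]ger0_norm ?addr_ge0 ?sqr_ge0//.
  rewrite -(real_normK (num_real (f x))) -(real_normK (num_real (g x))).
  have := sqr_ge0 (`|f x| - `|g x|); have := mulr_ge0 (normr_ge0 (f x)) (normr_ge0 (g x)).
  by move: `|_| `|_| => a b; lra.
- exact: integrableD.
Qed.

Lemma integrable_sqrD : mu.-integrable D (EFin \o (fun x => (f x + g x) ^+ 2)).
Proof.
apply: (@le_integrable _ _ _ _ _ mD _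
  ((EFin \o (fun x => 2 * f x ^+ 2)%R) \+ (EFin \o (fun x => 2 * g x ^+ 2)%R))%E).
- by apply/measurable_EFinP; apply: measurable_funX; exact: measurable_funD.
- move=> x Dx /=; rewrite lee_fin ger0_norm ?sqr_ge0// ger0_norm; last first.
    by apply: addr_ge0; apply: mulr_ge0 => //; exact: sqr_ge0.
  by rewrite -subr_ge0 (_ : _ - _ = (f x - g x) ^+ 2) ?sqr_ge0//; ring.
- by apply: integrableD => //; apply: (@integrable_boundedM _ (cst 2) 2) => //= x _; rewrite ger0_norm.
Qed.

Lemma Rintegral_sqrD : \int[mu]_(x in D) (f x + g x) ^+ 2 =
  \int[mu]_(x in D) (f x ^+ 2) + 2 * \int[mu]_(x in D) (f x * g x)
  + \int[mu]_(x in D) (g x ^+ 2).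
Proof.
have ifg := integrable_prod_sqr.
have ifg2 : mu.-integrable D (EFin \o (fun x => 2 * (f x * g x))).
  by apply: (@integrable_boundedM _ (cst 2) 2) => //= x _; rewrite ger0_norm.
rewrite -(RintegralZl 2 mD ifg) -(RintegralD mD f2 ifg2).
have := RintegralD mD (integrableD mD f2 ifg2) g2 => /= <-.
by apply: eq_Rintegral => x _; ring.
Qed.

End Pair.

(** Discriminant argument for the nonnegative quadratic t |-> integral of (f + t g)^2. *)
Lemma Rintegral_CauchySchwarz f g :
  measurable_fun D f -> measurable_fun D g ->
  mu.-integrable D (EFin \o (fun x => f x ^+ 2)) ->
  mu.-integrable D (EFin \o (fun x => g x ^+ 2)) ->
  (\int[mu]_(x in D) (f x * g x)) ^+ 2 <=
  \int[mu]_(x in D) (f x ^+ 2) * \int[mu]_(x in D) (g x ^+ 2).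
Proof.
move=> mf mg f2 g2.
set a := \int[mu]_(x in D) (f x ^+ 2); set c := \int[mu]_(x in D) (g x ^+ 2).
set b := \int[mu]_(x in D) _.
have c0 : 0 <= c by apply: Rintegral_ge0 => x _; exact: sqr_ge0.
have H (t : R) : 0 <= a + 2 * (t * b) + t ^+ 2 * c.
  have gt2 : mu.-integrable D (EFin \o (fun x => (t * g x) ^+ 2)).
    rewrite (_ : (fun x => _) = (fun x => cst (t ^+ 2) x * g x ^+ 2)).
      by apply: (@integrable_boundedM _ _ (t ^+ 2)) => //= x _; rewrite ger0_norm ?sqr_ge0.
    by apply/funext => x; rewrite exprMn.
  have mt : measurable_fun D (fun x => t * g x) by exact: measurable_funM.
  have ifg := integrable_prod_sqr mf mg f2 g2.
  have := Rintegral_sqrD mf mt f2 gt2.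
  rewrite (@eq_Rintegral _ _ _ mu D (fun x => t * (f x * g x)) (fun x => f x * (t * g x)))//; last first.
    by move=> x _; ring.
  rewrite (@eq_Rintegral _ _ _ mu D (fun x => t ^+ 2 * g x ^+ 2) (fun x => (t * g x) ^+ 2))//; last first.
    by move=> x _; ring.
  rewrite !RintegralZl// => <-; apply: Rintegral_ge0 => x _; exact: sqr_ge0.
have [c00|cn0] := eqVneq c 0.
  have [->|bn0] := eqVneq b 0; first by rewrite expr0n/= c00 mulr0.
  (* For c = 0 the quadratic is affine; at this t its value is - a - 2, whereas a >= 0 by [H 0]. *)
  have := H (- (a + 1) / b).
  by rewrite c00 mulr0 addr0 divfK//; have := H 0; rewrite !mul0r mulr0 !addr0 expr0n mul0r addr0; lra.
have cp : 0 < c by rewrite lt_def cn0.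
have := H (- b / c); rewrite (_ : _ + _ = (a * c - b ^+ 2) / c); last by field.
by rewrite pmulr_lge0 ?invr_gt0// subr_ge0.
Qed.

End CauchySchwarz.

(** * Scalar convolution with a decaying exponential *)

Section Volterra.
Context {R : realType}.
Local Notation mu := (@lebesgue_measure R).

Lemma integrable_subitv (i j : interval R) (f : R -> \bar R) :
  [set` i] `<=` [set` j] -> mu.-integrable [set` j] f -> mu.-integrable [set` i] f.
Proof. by move=> ij; apply: integrableS. Qed.

Lemma itv_integrableZ (i : interval R) (c : R) (f : R -> R) :
  mu.-integrable [set` i] (EFin \o f) ->
  mu.-integrable [set` i] (EFin \o (fun x => c * f x)).
Proof.
by move=> h; apply: (@integrable_boundedM _ _ _ _ _ _ _ (cst c) `|c|) => //; exact: measurable_cst.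
Qed.

Lemma itv_integrableD (i : interval R) (f g : R -> R) :
  mu.-integrable [set` i] (EFin \o f) -> mu.-integrable [set` i] (EFin \o g) ->
  mu.-integrable [set` i] (EFin \o (fun x => f x + g x)).
Proof. by move=> hf hg; apply: (integrableD _ hf hg); exact: measurable_itv. Qed.

Lemma Rintegral_derive (F f : R -> R) (a b : R) :
  (forall x : R, is_derive x 1 F (f x)) -> continuous f -> a <= b ->
  \int[mu]_(t in `[a, b]) f t = F b - F a.
Proof.
move=> dF cf; rewrite le_eqVlt => /predU1P[->|ab].
  by rewrite set_itv1 Rintegral_set1 subrr.
have cF : continuous F.
  by move=> x; apply: differentiable_continuous; apply/derivable1_diffP; case: (dF x).
rewrite /Rintegral (@continuous_FTC2 _ f F)//.
- exact: continuous_subspaceT.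
- split; first by move=> x _; case: (dF x).
  + exact/cvg_at_right_filter/cF.
  + exact/cvg_at_left_filter/cF.
- by move=> x _; rewrite derive1E; case: (dF x) => ? ->.
Qed.

Lemma is_derive_expR_scale (c x : R) :
  is_derive x 1 (fun t => expR (c * t)) (c * expR (c * x)).
Proof.
have h : is_derive x 1 (fun t => c * t) c.
  by rewrite -[X in is_derive _ _ _ X]mulr1; exact: is_deriveZ.
rewrite mulrC; exact: (is_derive1_comp (is_derive_expR (c * x)) h).
Qed.

Lemma continuous_expR_scale (c : R) : continuous (fun t => expR (c * t)).
Proof.
by move=> x; apply: differentiable_continuous; apply/derivable1_diffP;
  case: (is_derive_expR_scale c x).
Qed.

Lemma Rintegral_expR (c a b : R) : c != 0 -> a <= b ->
  \int[mu]_(t in `[a, b]) expR (c * t) = (expR (c * b) - expR (c * a)) / c.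
Proof.
move=> c0 ab.
have dF (x : R) : is_derive x 1 (fun t => c^-1 * expR (c * t)) (expR (c * x)).
  have h := is_deriveZ c^-1 (is_derive_expR_scale c x).
  by rewrite [X in is_derive _ _ _ X](_ : _ = c^-1 *: (c * expR (c * x)))// /GRing.scale/= mulKf.
by rewrite (Rintegral_derive dF (@continuous_expR_scale c) ab) -mulrBr mulrC.
Qed.

(* The convolution of g with s |-> e^(-l s), with the factor depending on t pulled
   out of the integral. *)
Definition volt (l : R) (g : R -> R) (t : R) : R :=
  expR (- l * t) * \int[mu]_(s in `[0, t]) (expR (l * s) * g s).

Lemma measurable_expR_scale (c : R) (D : set R) : measurable_fun D (fun t => expR (c * t)).
Proof.
apply: measurable_funTS; apply: continuous_measurable_fun.
exact: continuous_expR_scale.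
Qed.

Lemma expR_scale_le (c T t : R) : 0 <= t <= T -> `|expR (c * t)| <= expR (`|c| * T).
Proof.
move=> /andP[t0 tT]; rewrite ger0_norm ?expR_ge0// ler_expR.
by rewrite (le_trans (ler_norm _))// normrM (ger0_norm t0) ler_wpM2l.
Qed.

Section FixedT.
Variable T : R.
Let I := `[0%R, T]%classic.
Implicit Types (g h : R -> R) (l : R).

(** Measurability is asked on the whole line, so that it restricts to every [0, t]. *)
Definition sqi g := measurable_fun setT g /\ mu.-integrable I (EFin \o (fun t => g t ^+ 2)).

Lemma sqi_integrable g : sqi g -> mu.-integrable I (EFin \o g).
Proof.
move=> [mg g2].
have := @integrable_prod_sqr _ _ R mu I (measurable_itv _) (cst 1) g (measurable_cst _) (measurable_funTS mg) _ g2.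
rewrite (_ : (fun x => cst 1 x * g x) = g); last by apply/funext => x; rewrite mul1r.
apply; rewrite (_ : (fun x => cst 1 x ^+ 2) = cst 1); first exact: itv_integrable_cst.
by apply/funext => x; rewrite /= expr1n.
Qed.

Lemma sub_itv t : t <= T -> `[0, t] `<=` I.
Proof. by move=> tT; apply: subset_itvl; rewrite bnd_simp. Qed.

Lemma integrable_expM l g : mu.-integrable I (EFin \o g) ->
  mu.-integrable I (EFin \o (fun s => expR (l * s) * g s)).
Proof.
move=> ig; apply: (@integrable_boundedM _ _ _ _ _ _ _ _ (expR (`|l| * T))) => //.
- exact: measurable_itv.
- exact: measurable_expR_scale.
- by move=> x; rewrite /I/= in_itv/=; exact: expR_scale_le.
Qed.

Lemma sqi_expM l g : sqi g -> sqi (fun s => expR (l * s) * g s).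
Proof.
move=> [mg g2]; split.
  by apply: measurable_funM => //; exact: measurable_expR_scale.
rewrite (_ : (fun t => _) = (fun t => expR ((l * 2) * t) * g t ^+ 2)).
  exact: integrable_expM.
apply/funext => t; rewrite exprMn; congr (_ * _).
by rewrite expr2 -expRD; congr expR; ring.
Qed.

Lemma volt_continuous l g : 0 <= T -> mu.-integrable I (EFin \o g) ->
  {within `[0, T], continuous (volt l g)}.
Proof.
move=> T0 ig x; rewrite /volt; apply: (@continuousM R (subspace I) (fun t => expR (- l * t))
  (fun t => \int[mu]_(s in `[0, t]) (expR (l * s) * g s))).
  by apply: continuous_subspaceT; exact: continuous_expR_scale.
by apply: parameterized_integral_continuous => //; exact: integrable_expM.
Qed.

(** Damping by e^(- k t) shifts the rate l to l + k; the gain of the weighted estimates comes from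
    here. *)
Lemma volt_exp k l g t : expR (- k * t) * volt l g t =
  volt (l + k) (fun s => expR (- k * s) * g s) t.
Proof.
rewrite /volt mulrA -expRD; congr (expR _ * _); first by ring.
apply: eq_Rintegral => s _; rewrite mulrA -expRD; congr (expR _ * _); ring.
Qed.

(** Cauchy-Schwarz against e^(l s), whose square integrates to at most e^(2 l t) / (2 l) on [0, t].
    The gain 1 / (2 l) makes mild solutions bounded in W uniformly in time. *)
Lemma volt_sup l g t : 0 < l -> sqi g -> 0 <= t <= T ->
  volt l g t ^+ 2 <= (2 * l)^-1 * \int[mu]_(s in `[0, t]) (g s ^+ 2).
Proof.
move=> l0 [mg g2] /andP[t0 tT].
have mJ : measurable `[0, t]%classic by exact: measurable_itv.
have JI := sub_itv tT.
have E : (fun s => expR (l * s) ^+ 2) = (fun s => expR ((2 * l) * s)).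
  by apply/funext => s; rewrite expr2 -expRD; congr expR; ring.
have := @Rintegral_CauchySchwarz _ _ R mu `[0, t] mJ (fun s => expR (l * s)) g.
rewrite E; set J := `[0, t]%classic => CS.
have {CS} := CS _ _ _ _; rewrite Rintegral_expR//; last by rewrite mulf_neq0// gt_eqF.
move=> CS; rewrite /volt exprMn.
have {CS} := CS (@measurable_expR_scale _ _) (measurable_funTS mg) _ (integrable_subitv JI g2).
have ie : mu.-integrable `[0, t] (EFin \o (fun s => expR (2 * l * s))).
  apply: continuous_compact_integrable; first exact: segment_compact.
  exact/continuous_subspaceT/continuous_expR_scale.
move=> /(_ ie)/(ler_wpM2l (sqr_ge0 (expR (- l * t)))) H.
apply: (le_trans H).
rewrite mulr0 expR0 mulrA ler_wpM2r//; first by apply: Rintegral_ge0 => s _; exact: sqr_ge0.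
rewrite mulrA -{2}[(2 * l)^-1]mul1r ler_wpM2r ?invr_ge0 ?mulr_ge0 ?(ltW l0)//.
rewrite expr2 -expRD mulrBr -expRD mulr1 (_ : _ + _ + _ = 0); last by ring.
by rewrite expR0 gerBl expR_ge0.
Qed.

(** Cauchy-Schwarz after splitting e^(l s) into two factors e^(l s / 2); the kernel has mass at most
    1 / l. This reduces the L^2 bound for g to an L^1 bound for g^2. *)
Lemma volt_sqr_le l g t : 0 < l -> sqi g -> 0 <= t <= T ->
  volt l g t ^+ 2 <= l^-1 * volt l (fun s => g s ^+ 2) t.
Proof.
move=> l0 sg /andP[t0 tT].
have mJ : measurable `[0, t]%classic by exact: measurable_itv.
have JI := sub_itv tT.
have E : (fun s => expR (l / 2 * s) ^+ 2) = (fun s => expR (l * s)).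
  by apply/funext => s; rewrite expr2 -expRD; congr expR; field.
have [mh h2] := sqi_expM (l / 2) sg.
have := @Rintegral_CauchySchwarz _ _ R mu `[0, t] mJ (fun s => expR (l / 2 * s))
  (fun s => expR (l / 2 * s) * g s).
rewrite E; set J := `[0, t]%classic => CS.
have {CS} := CS (@measurable_expR_scale _ _) (measurable_funTS mh) _ (integrable_subitv JI h2).
have ie : mu.-integrable `[0, t] (EFin \o (fun s => expR (l * s))).
  apply: continuous_compact_integrable; first exact: segment_compact.
  exact/continuous_subspaceT/continuous_expR_scale.
move=> /(_ ie); rewrite Rintegral_expR//; last by rewrite gt_eqF.
have -> : \int[mu]_(x in J) (expR (l / 2 * x) * (expR (l / 2 * x) * g x)) =
    \int[mu]_(x in J) (expR (l * x) * g x).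
  by apply: eq_Rintegral => s _; rewrite mulrA -expRD; congr (expR _ * _); field.
have -> : \int[mu]_(x in J) ((expR (l / 2 * x) * g x) ^+ 2) =
    \int[mu]_(x in J) (expR (l * x) * g x ^+ 2).
  by apply: eq_Rintegral => s _; rewrite exprMn expr2 -expRD; congr (expR _ * _); field.
move=> /(ler_wpM2l (sqr_ge0 (expR (- l * t)))) H.
rewrite /volt exprMn; apply: (le_trans H); rewrite !mulrA ler_wpM2r//.
  by apply: Rintegral_ge0 => s _; rewrite mulr_ge0 ?expR_ge0 ?sqr_ge0.
have : expR (- l * t) * expR (l * t) = 1.
  by rewrite -expRD (_ : _ + _ = 0) ?expR0//; ring.
rewrite mulr0 expR0; move: (expR (- l * t)) (expR (l * t)) => e x ex.
rewrite (_ : _ / l = l^-1 * (e * (e * x) - e ^+ 2)); last by ring.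
by rewrite ex mulr1 ler_wpM2l ?invr_ge0 ?(ltW l0)// gerBl sqr_ge0.
Qed.

(** Exchanging the integrals leaves g(s) times the mass of the kernel on [s, T], which is (1 - e^(-
    l (T - s))) / l <= 1 / l. *)
Lemma volt_L1 l g : 0 <= T -> 0 < l -> (forall t, 0 <= g t) ->
  mu.-integrable I (EFin \o g) ->
  \int[mu]_(t in I) volt l g t <= l^-1 * \int[mu]_(s in I) g s.
Proof.
move=> T0 l0 g0 ig.
have := @Fubini_triangle _ T (expR (`|- l| * T)) (fun t => expR (- l * t)) (fun s => expR (l * s) * g s)
  (@measurable_expR_scale _ _) (fun t => @expR_scale_le _ _ t) (integrable_expM _ ig).
rewrite -/I => ->; rewrite -RintegralZl//; last exact: measurable_itv.
have n0 : - l != 0 by rewrite oppr_eq0 gt_eqF.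
pose c s := l^-1 * (1 - expR (- l * T) * expR (l * s)).
have E s : I s -> expR (l * s) * g s * (\int[mu]_(t in `[s, T]) expR (- l * t)) = c s * g s.
  rewrite /I/= in_itv/= => /andP[s0 sT]; rewrite Rintegral_expR// /c.
  have {1}<- : expR (l * s) * expR (- l * s) = 1.
    by rewrite -expRD (_ : _ + _ = 0) ?expR0//; ring.
  by rewrite invrN; ring.
have c1 s : I s -> 0 <= c s <= l^-1.
  rewrite /I/= in_itv/= => /andP[s0 sT]; have li : 0 <= l^-1 by rewrite invr_ge0 ltW.
  have x1 : expR (- l * T) * expR (l * s) <= 1.
    rewrite -expRD -[leRHS]expR0 ler_expR (_ : _ + _ = l * (s - T)); last by ring.
    by rewrite mulr_ge0_le0 ?(ltW l0)// subr_le0.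
  apply/andP; split; first by rewrite /c mulr_ge0// subr_ge0.
  by rewrite /c -[leRHS]mulr1 ler_wpM2l// gerBl mulr_ge0 ?expR_ge0.
apply: le_Rintegral.
- exact: measurable_itv.
- apply: (@eq_integrable _ _ _ mu I _ (EFin \o (fun s => c s * g s))).
  + exact: measurable_itv.
  + by move=> s; rewrite inE => Is /=; rewrite E.
  apply: (@integrable_boundedM _ _ _ _ _ _ _ _ l^-1) => //; first exact: measurable_itv.
    apply: measurable_funM => //; apply: measurable_funB => //.
    by apply: measurable_funM => //; exact: measurable_expR_scale.
  by move=> s /c1 /andP[c0 cl]; rewrite ger0_norm.
- exact: itv_integrableZ.
- move=> s Is; rewrite E// ler_wpM2r//; by case/andP: (c1 _ Is).
Qed.

(** Young's convolution inequality: the mass l^-1 of the kernel enters once through [volt_sqr_le]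
    and once through [volt_L1]. *)
Lemma volt_L2 l g : 0 <= T -> 0 < l -> sqi g ->
  \int[mu]_(t in I) (volt l g t ^+ 2) <= l ^- 2 * \int[mu]_(s in I) (g s ^+ 2).
Proof.
move=> T0 l0 sg.
have cv := @volt_continuous l _ T0 (sqi_integrable sg).
have cv2 := @volt_continuous l _ T0 sg.2.
have iv2 : mu.-integrable I (EFin \o volt l (fun s => g s ^+ 2)).
  by apply: continuous_compact_integrable; first exact: segment_compact.
have iv : mu.-integrable I (EFin \o (fun t => volt l g t ^+ 2)).
  apply: continuous_compact_integrable; first exact: segment_compact.
  by move=> x; apply: (@continuousM R (subspace I)); exact: cv.
rewrite expr2 invfM -mulrA (le_trans _ (ler_wpM2l _ (volt_L1 T0 l0 (fun t => sqr_ge0 (g t)) sg.2)))//; last first.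
  by rewrite invr_ge0 ltW.
rewrite -RintegralZl//; last exact: measurable_itv.
apply: le_Rintegral => //; first exact: measurable_itv.
  exact: itv_integrableZ.
by move=> t; rewrite /I/= in_itv/= => tI; exact: volt_sqr_le.
Qed.

End FixedT.

End Volterra.

(** * Properties holding almost everywhere on [0, T] *)

Section AlmostEverywhere.
Context {R : realType} (T : R).
Local Notation mu := (@lebesgue_measure R).
Implicit Types P Q : R -> Prop.

Let ae_filter : Filter (almost_everywhere mu).
Proof. exact: ae_filter_ringOfSetsType. Qed.

Lemma aeTS P Q : (forall t, 0 <= t <= T -> P t -> Q t) -> aeT T P -> aeT T Q.
Proof.
move=> PQ; apply: (@filterS _ _ ae_filter) => t Pt tI; apply: PQ (Pt tI).
by move: tI; rewrite /= in_itv.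
Qed.

Lemma aeTI P Q : aeT T P -> aeT T Q -> aeT T (fun t => P t /\ Q t).
Proof.
by move=> hP hQ; apply: (@filterS2 _ _ ae_filter _ _ _ _ hP hQ) => t h k tI; split; auto.
Qed.

Lemma aeT2 P1 P2 Q : (forall t, 0 <= t <= T -> P1 t -> P2 t -> Q t) ->
  aeT T P1 -> aeT T P2 -> aeT T Q.
Proof. by move=> h h1 h2; apply: aeTS (aeTI h1 h2) => t tI []; exact: h. Qed.

Lemma aeT_all P : (forall t, 0 <= t <= T -> P t) -> aeT T P.
Proof.
by move=> h; apply: aeW => t; rewrite /= in_itv/=; exact: h.
Qed.

Lemma aeT_countable (P : nat -> R -> Prop) :
  (forall n, aeT T (P n)) -> aeT T (fun t => forall n, P n t).
Proof.
move=> h; apply: (@negligibleS _ _ _ mu _ _ _ (negligible_bigcup h)) => t /= nP.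
apply: contrapT => nU; apply: nP => tI n; apply: contrapT => nPn.
by apply: nU; exists n => //= ; move=> /(_ tI).
Qed.

Lemma ae_aeT P : {ae mu, forall t, P t} -> aeT T P.
Proof. by move=> hP; apply: (@filterS _ _ ae_filter _ _ _ hP) => t h _. Qed.

Lemma ae_neq (x : R) : {ae mu, forall t, t != x}.
Proof.
exists [set x]; split; [exact: measurable_set1|exact: lebesgue_measure_set1|].
by move=> t /= /negP; rewrite negbK => /eqP ->.
Qed.

(** Otherwise the exceptional null set would contain a nondegenerate interval around t, clipped to
    [0, T]. *)
Lemma aeT_exists P e t : 0 < e -> aeT T P -> 0 <= t <= T -> 0 < T ->
  exists s, [/\ 0 <= s <= T, `|s - t| < e & P s].
Proof.
move=> e0 [A [mA A0 HA]] /andP[t0 tT] T0; apply: contrapT => N.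
pose a := Num.max 0 (t - e / 2); pose b := Num.min T (t + e / 2).
have ab : a < b by rewrite /a /b gt_max !lt_min; lra.
have : (mu `[a, b] <= mu A)%E.
  apply: le_measure; rewrite ?inE//.
  move=> x /=; rewrite in_itv/= /a /b ge_max le_min => /andP[/andP[x0 x1] /andP[x2 x3]].
  apply: HA => /= HP; apply: N; exists x; split.
  - by rewrite x0 x2.
  - by rewrite ltr_norml; lra.
  - by apply: HP; rewrite in_itv/= x0 x2.
by rewrite A0 lebesgue_measure_itv/= lte_fin ab -EFinB lee_fin subr_le0 leNgt ab.
Qed.

End AlmostEverywhere.

(** * Weak derivatives *)

Section DuBoisReymond.
Context {R : realType}.
Local Notation mu := (@lebesgue_measure R).

(** [q] is a C^1 primitive of the positive part [pp], so second differences of [q] are cut-offs with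
    an explicit piecewise linear derivative. They qualify as test functions because these are C^1
    only. *)
Let pp (x : R) := Num.max 0 x.
Let q (x : R) := 2^-1 * pp x ^+ 2.

Let is_derive_q (x : R) : is_derive x 1 q (pp x).
Proof.
have H (h : R) : `|q (h + x) - q x - h * pp x| <= h ^+ 2.
  rewrite /q /pp; case: (leP 0 (h + x)) => h1; case: (leP 0 x) => h2;
  rewrite ler_norml; apply/andP; split; nra.
have C : (h^-1 *: ((q \o shift x) (h *: 1) - q x)) @[h --> 0^'] --> pp x.
  apply/cvgrPdist_le => e e0; near=> h.
  have h0 : h != 0 by near: h; exact: nbhs_dnbhs_neq.
  rewrite distrC -(ler_pM2l (_ : 0 < `|h|)) ?normr_gt0// -normrM mulrBr /GRing.scale/= mulVKf//.
  rewrite mulr1 (le_trans (H _))//.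
  rewrite -real_normK ?num_real// expr2 ler_wpM2l//.
  by near: h; apply: dnbhs0_le.
by apply: DeriveDef; [apply/cvg_ex; exists (pp x)|exact: cvg_lim].
Unshelve. all: by end_near. Qed.

Let continuous_pp : continuous pp.
Proof. by move=> x; apply: continuous_max => //; exact: cvg_cst. Qed.

(* [bump a h] is C^1, rises from 0 to 1 on [a - h, a + h], and its derivative is
   the tent function [tent a h]. *)
Let bump (a h x : R) := h ^- 2 * (q (x - (a - h)) - 2 * q (x - a) + q (x - (a + h))).
Let tent (a h x : R) := h ^- 2 * (pp (x - (a - h)) - 2 * pp (x - a) + pp (x - (a + h))).

Let is_derive_bump a h (x : R) : is_derive x 1 (bump a h) (tent a h x).
Proof.
have S (c : R) : is_derive x 1 (fun y => q (y - c)) (pp (x - c)).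
  have h1 : is_derive x 1 (fun y : R => y - c) 1.
    by rewrite -[X in is_derive _ _ _ X]subr0; exact: is_deriveB.
  have := @is_derive1_comp _ q (fun y => y - c) x _ _ (is_derive_q (x - c)) h1.
  by rewrite mulr1.
exact: is_deriveZ (is_deriveD (is_deriveB (S _) (is_deriveZ 2 (S a))) (S _)).
Qed.

Let continuous_tent a h : continuous (tent a h).
Proof.
have S (c : R) : continuous (fun y => pp (y - c)).
  move=> x; apply: (@continuous_comp _ _ _ (fun y => y - c) pp); last exact: continuous_pp.
  by apply: cvgB; [exact: cvg_id|exact: cvg_cst].
move=> x; apply: cvgM; first exact: cvg_cst.
apply: cvgD; last exact: S.
apply: cvgB; first exact: S.
by apply: cvgM; [exact: cvg_cst|exact: S].
Qed.

Let tent_ge0 a h x : 0 < h -> 0 <= tent a h x.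
Proof.
move=> h0; rewrite /tent mulr_ge0 ?invr_ge0 ?sqr_ge0// /pp.
case: (leP 0 (x - (a - h))); case: (leP 0 (x - a)); case: (leP 0 (x - (a + h))); lra.
Qed.

Let tent_le a h x : 0 < h -> tent a h x <= h^-1.
Proof.
move=> h0; rewrite /tent expr2 invfM -mulrA -[leRHS]mulr1 ler_wpM2l ?invr_ge0 ?(ltW h0)//.
rewrite mulrC ler_pdivrMr// mul1r /pp.
case: (leP 0 (x - (a - h))); case: (leP 0 (x - a)); case: (leP 0 (x - (a + h))); lra.
Qed.

Let tent_out a h x : 0 < h -> h <= `|x - a| -> tent a h x = 0.
Proof.
move=> h0; rewrite ler_normr => hx; rewrite /tent (_ : _ + _ = 0) ?mulr0// /pp.
case: (leP 0 (x - (a - h))); case: (leP 0 (x - a)); case: (leP 0 (x - (a + h)));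
  case/orP: hx; lra.
Qed.

Let bump_left a h x : 0 < h -> x <= a - h -> bump a h x = 0.
Proof.
move=> h0 hx; rewrite /bump /q (_ : _ + _ = 0) ?mulr0// /pp.
case: (leP 0 (x - (a - h))); case: (leP 0 (x - a)); case: (leP 0 (x - (a + h))); nra.
Qed.

Let bump_right a h x : 0 < h -> a + h <= x -> bump a h x = 1.
Proof.
move=> h0 hx; rewrite /bump /q (_ : _ + _ = h ^+ 2) ?mulVf ?expf_neq0 ?gt_eqF// /pp.
case: (leP 0 (x - (a - h))); case: (leP 0 (x - a)); case: (leP 0 (x - (a + h))); nra.
Qed.

Lemma test_fun_continuous (T : R) eta : test_fun T eta -> continuous eta.
Proof.
move=> [d _ _] x; apply: differentiable_continuous; exact/derivable1_diffP.
Qed.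

Lemma test_fun_is_derive (T : R) eta (x : R) : test_fun T eta -> is_derive x 1 eta (derive1 eta x).
Proof. by move=> [d _ _]; rewrite derive1E; exact: derivableP. Qed.

Lemma test_fun_endpoints (T : R) eta : test_fun T eta -> eta 0 = 0 /\ eta T = 0.
Proof.
move=> [_ _ [a [b [a0 bT E]]]]; split; apply: E; rewrite in_itv/= negb_and -!ltNge.
  by rewrite a0.
by rewrite bT orbT.
Qed.

Lemma continuous_itv_bounded (T : R) (f : R -> R) : 0 <= T -> continuous f ->
  exists M, forall t, 0 <= t <= T -> `|f t| <= M.
Proof.
move=> T0 cf.
have [c _ H] := EVT_max T0 (continuous_subspaceT (fun x => cvg_norm (cf x)) : {within `[0, T], continuous (fun t => `|f t|)}).
by exists `|f c| => t tI; apply: H; rewrite in_itv.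
Qed.

(** A single [bump] stays equal to 1 on the right; the difference of two has compact support in (0,
    T). *)
Let bump_test (T a b h : R) : 0 < h -> h < a -> h < b -> a + h < T -> b + h < T ->
  test_fun T (fun t => bump a h t - bump b h t) /\
  derive1 (fun t => bump a h t - bump b h t) = (fun t => tent a h t - tent b h t).
Proof.
move=> h0 ha hb haT hbT.
have D (t : R) : is_derive t 1 (fun t => bump a h t - bump b h t) (tent a h t - tent b h t).
  by apply: is_deriveB; exact: is_derive_bump.
have E : derive1 (fun t => bump a h t - bump b h t) = (fun t => tent a h t - tent b h t).
  by apply/funext => t; rewrite derive1E; case: (D t).
split=> //; split.
- by move=> t; case: (D t).
- rewrite E => t; apply: cvgB; exact: continuous_tent.
- exists (Num.min a b - h), (Num.max a b + h); split.
  + by rewrite subr_gt0 lt_min ha.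
  + by rewrite -ltrBrDr gt_max !ltrBrDr haT.
  + move=> t; rewrite in_itv/= negb_and -!ltNge => /orP[].
      rewrite ltrBrDr lt_min => /andP[? ?].
      by rewrite !bump_left ?subrr// lerBrDr ltW.
    rewrite -ltrBrDr gt_max => /andP[? ?].
    by rewrite !bump_right ?subrr// -lerBrDr ltW.
Qed.

Lemma itv_integrable_boundedM (i : interval R) (f g : R -> R) (M : R) :
  measurable_fun setT g -> (forall x, x \in i -> `|g x| <= M) ->
  mu.-integrable [set` i] (EFin \o f) ->
  mu.-integrable [set` i] (EFin \o (fun x => g x * f x)).
Proof.
move=> mg gM intf; apply: (@integrable_boundedM _ _ _ _ _ _ _ _ M) => //.
exact: measurable_funTS.
Qed.

Lemma itv_RintegralZ (i : interval R) (c : R) (f : R -> R) :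
  mu.-integrable [set` i] (EFin \o f) ->
  \int[mu]_(t in [set` i]) (c * f t) = c * \int[mu]_(t in [set` i]) f t.
Proof. by move=> h; rewrite RintegralZl. Qed.

Lemma itv_RintegralB (i : interval R) (f g : R -> R) :
  mu.-integrable [set` i] (EFin \o f) -> mu.-integrable [set` i] (EFin \o g) ->
  \int[mu]_(t in [set` i]) (f t - g t) =
  \int[mu]_(t in [set` i]) f t - \int[mu]_(t in [set` i]) g t.
Proof. by move=> h k; rewrite RintegralB. Qed.

Lemma itv_RintegralD (i : interval R) (f g : R -> R) :
  mu.-integrable [set` i] (EFin \o f) -> mu.-integrable [set` i] (EFin \o g) ->
  \int[mu]_(t in [set` i]) (f t + g t) =
  \int[mu]_(t in [set` i]) f t + \int[mu]_(t in [set` i]) g t.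
Proof. by move=> h k; rewrite RintegralD. Qed.

(** The tent has integral 1, is at most 1 / h and lives on a ball of length 2 h; the ratio of 1 / h
    to 1 / (2 h) is the factor 2. *)
Let tent_average (T a h : R) (f : R -> R) : 0 < h -> h < a -> a + h < T ->
  measurable_fun setT f -> mu.-integrable setT (EFin \o f) ->
  (`|\int[mu]_(t in `[0%R, T]) (tent a h t * f t) - f a|%:E <= 2%:E * davg f a h)%E.
Proof.
move=> h0 ha haT mf intf; have T0 : 0 <= T by lra.
have iT : mu.-integrable `[0, T] (EFin \o f) by apply: integrableS intf.
have it : mu.-integrable `[0, T] (EFin \o tent a h).
  by apply: continuous_compact_integrable; [exact: segment_compact|exact/continuous_subspaceT/continuous_tent].
have mt : measurable_fun setT (tent a h) by apply: continuous_measurable_fun; exact: continuous_tent.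
have itf : mu.-integrable `[0, T] (EFin \o (fun t => tent a h t * f t)).
  apply: (@itv_integrable_boundedM _ _ _ h^-1) => // x _.
  by rewrite ger0_norm ?tent_ge0// tent_le.
have E1 : \int[mu]_(t in `[0%R, T]) tent a h t = 1.
  rewrite (Rintegral_derive (fun x => is_derive_bump a h x) (@continuous_tent a h) T0).
  by rewrite bump_right ?bump_left ?subr0//; lra.
have -> : \int[mu]_(t in `[0%R, T]) (tent a h t * f t) - f a =
    \int[mu]_(t in `[0%R, T]) (tent a h t * (f t - f a)).
  rewrite [X in _ - X](_ : f a = \int[mu]_(t in `[0%R, T]) (f a * tent a h t)); last first.
    by rewrite itv_RintegralZ// E1 mulr1.
  rewrite -itv_RintegralB//; last exact: itv_integrableZ.
  by apply: eq_Rintegral => t _; ring.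
have mfa : measurable_fun setT (fun t => f t - f a) by exact: measurable_funB.
have ib : mu.-integrable `[0, T] (EFin \o (fun t => tent a h t * (f t - f a))).
  have := itv_integrableD itf (itv_integrableZ (- f a) it).
  by rewrite (_ : (fun x => _) = (fun t => tent a h t * (f t - f a)))//; apply/funext => t; ring.
rewrite (le_trans (_ : _ <= (\int[mu]_(t in `[0%R, T]) `|tent a h t * (f t - f a)|)%:E)%E)//.
  by rewrite lee_fin; apply: le_normr_Rintegral => //; exact: measurable_itv.
rewrite /Rintegral fineK; last first.
  by apply: integrable_fin_num; [exact: measurable_itv|exact: integrable_abse ib].
rewrite /davg /iavg.
have mb : measurable (ball a h : set R) by exact: measurable_ball.
rewrite (@le_trans _ _ (\int[mu]_(t in ball a h) (h^-1%:E * `|(f t - f a)%:E|))%E)//.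
  rewrite integral_mkcond [leRHS]integral_mkcond; apply: ge0_ae_le_integral.
  - by move=> x _; rewrite /patch; case: ifP => //; rewrite lee_fin.
  - by move=> x _; rewrite /patch; case: ifP => // _; rewrite mule_ge0// lee_fin invr_ge0 ltW.
  - apply: aeW => t _; rewrite /patch.
    case: (boolP (t \in (ball a h : set R))) => tb; last first.
      case: ifP => // _; rewrite tent_out ?mul0r ?normr0//.
      by rewrite leNgt; apply: contra tb => th; rewrite inE/= /ball/= distrC.
    case: ifP => _.
      by rewrite -EFinM lee_fin normrM ler_wpM2r// ger0_norm ?tent_ge0// tent_le.
    by rewrite mule_ge0// lee_fin invr_ge0 ltW.
rewrite ge0_integralZl//; last 2 first.
- by apply: measurable_funTS; apply/measurable_EFinP; exact: measurableT_comp.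
- by rewrite lee_fin invr_ge0 ltW.
rewrite muleA lebesgue_measure_ball ?(ltW h0)//.
rewrite inver (gt_eqF (_ : 0 < h *+ 2)) ?mulrn_wgt0//.
rewrite -EFinM (_ : 2 * (h *+ 2)^-1 = h^-1)//.
by rewrite -(mulr_natl h) invfM mulrA mulfV ?mul1r.
Qed.

(** Testing with a difference of two bumps shows that the tent averages of f around a and b
    coincide. As h tends to 0 they tend to f(a) and f(b) at Lebesgue points, which are almost all
    points. *)
Lemma du_Bois_Reymond (T : R) (f : R -> R) : 0 < T -> measurable_fun setT f ->
  mu.-integrable `[0, T] (EFin \o f) ->
  (forall eta, test_fun T eta -> \int[mu]_(t in `[0, T]) (derive1 eta t * f t) = 0) ->
  exists c, aeT T (fun t => f t = c).
Proof.
move=> T0 mf intf H; pose I := `[0, T]%classic; pose g := f \_ I.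
have mI : measurable I by exact: measurable_itv.
have mg : measurable_fun setT g.
  by apply/(measurable_restrictT _ mI); exact: measurable_funTS.
have ig : mu.-integrable setT (EFin \o g).
  have := (integrable_restrict mu mI measurableT (EFin \o f)).1.
  by rewrite setTI restrict_EFin; exact.
have gH eta : test_fun T eta -> \int[mu]_(t in `[0, T]) (derive1 eta t * g t) = 0.
  move=> /H E; rewrite -[RHS]E; apply: eq_Rintegral => t tI.
  by rewrite /g /patch ifT.
have L := lebesgue_differentiation (open_integrable_locally openT ig).
have itt a h : 0 < h -> mu.-integrable `[0, T] (EFin \o (fun t => tent a h t * g t)).
  move=> h0; apply: (@itv_integrable_boundedM _ _ _ h^-1).
  - apply: continuous_measurable_fun; exact: continuous_tent.
  - by move=> x _; rewrite ger0_norm ?tent_ge0// tent_le.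
  - by apply: integrableS ig.
have K a b : 0 < a < T -> 0 < b < T -> lebesgue_pt g a -> lebesgue_pt g b -> g a = g b.
  move=> /andP[a0 aT] /andP[b0 bT] La Lb; apply/eqP; rewrite -subr_eq0 -normr_le0.
  rewrite -lee_fin.
  have C : (2%:E * davg g a h + 2%:E * davg g b h)%E @[h --> 0^'+] --> (2%:E * 0 + 2%:E * 0)%E.
    by apply: cvgeD; rewrite ?mule0 ?adde_def//; rewrite -(mule0 2%:E); apply: cvgeZl.
  rewrite -[leRHS](_ : (2%:E * 0 + 2%:E * 0)%E = _); last by rewrite mule0 adde0.
  apply: cvge_ge C.
  near=> h.
  have h0 : 0 < h by near: h; exact: nbhs_right_gt.
  have h1 : h < a by near: h; apply: nbhs_right_lt.
  have h2 : h < b by near: h; apply: nbhs_right_lt.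
  have h3 : h < T - a by near: h; apply: nbhs_right_lt; rewrite subr_gt0.
  have h4 : h < T - b by near: h; apply: nbhs_right_lt; rewrite subr_gt0.
  have h3' : a + h < T by lra.
  have h4' : b + h < T by lra.
  have [tf dE] := @bump_test T a b h h0 h1 h2 h3' h4'.
  have := gH _ tf; rewrite dE.
  rewrite (@eq_Rintegral _ _ _ mu _ (fun t => tent a h t * g t - tent b h t * g t)); last first.
    by move=> t _; rewrite mulrBl.
  rewrite itv_RintegralB; [|exact: itt|exact: itt].
  move=> /eqP; rewrite subr_eq0 => /eqP E.
  apply: le_trans (leeD (tent_average h0 h1 h3' mg ig) (tent_average h0 h2 h4' mg ig)).
  rewrite -EFinD lee_fin E.
  set x := \int[mu]_(_ in _) _.
  rewrite (_ : g a - g b = (x - g b) - (x - g a)); last by ring.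
  by rewrite (le_trans (ler_normB _ _))// addrC.
(* The open interval is not negligible, so it contains a Lebesgue point; the value there is the
   constant. *)
have [a [aT La]] : exists a, 0 < a < T /\ lebesgue_pt g a.
  apply: contrapT => N; case: L => A [mA A0 LA].
  have : (mu `]0%R, T[ <= mu A)%E.
    apply: le_measure; rewrite ?inE//.
    move=> x /=; rewrite in_itv/= => xT; apply: LA => /= Lx; apply: N.
    by exists x.
  by rewrite A0 lebesgue_measure_itv/= lte_fin T0 sube0 lee_fin leNgt T0.
exists (g a).
have L' : aeT T (lebesgue_pt g) by exact: ae_aeT.
have ne x : aeT T (fun t => t != x) by exact/ae_aeT/ae_neq.
apply: aeT2 (aeTI (ne 0) (ne T)) L' => t /andP[h0 hT] [t0 tT] Lt.
rewrite (K a t)//.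
  by rewrite /g /patch ifT// inE /I/= in_itv/= h0 hT.
by rewrite lt_def t0 h0/= lt_def eq_sym tT hT.
Unshelve. all: by end_near. Qed.

Section WeakODE.
Variable T : R.
Hypothesis T0 : 0 < T.
Let I := `[0%R, T]%classic.
Implicit Types f g b F : R -> R.

Lemma integrable_continuousM (phi f : R -> R) : continuous phi ->
  mu.-integrable I (EFin \o f) -> mu.-integrable I (EFin \o (fun t => phi t * f t)).
Proof.
move=> cphi intf; have [M HM] := continuous_itv_bounded (ltW T0) cphi.
apply: (@itv_integrable_boundedM _ _ _ M) => //.
exact: continuous_measurable_fun.
Qed.

(** Multiplying the test function by e^(k t) plays the part of the integrating factor in the weak
    formulation. *)
Lemma test_fun_expM (k : R) eta : test_fun T eta ->
  test_fun T (fun t => eta t * expR (k * t)) /\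
  derive1 (fun t => eta t * expR (k * t)) =
    (fun t => derive1 eta t * expR (k * t) + k * (eta t * expR (k * t))).
Proof.
move=> te; have [d ce [a [b [a0 bT E]]]] := te.
have D (t : R) : is_derive t 1 (fun t => eta t * expR (k * t))
    (derive1 eta t * expR (k * t) + k * (eta t * expR (k * t))).
  rewrite (_ : _ + _ = eta t *: (k * expR (k * t)) + expR (k * t) *: derive1 eta t).
    exact: is_deriveM (test_fun_is_derive t te) (is_derive_expR_scale k t).
  by rewrite /GRing.scale/=; ring.
have E' : derive1 (fun t => eta t * expR (k * t)) =
    (fun t => derive1 eta t * expR (k * t) + k * (eta t * expR (k * t))).
  by apply/funext => t; rewrite derive1E; case: (D t).
split; last exact: E'.
split.
- by move=> t; case: (D t).
- rewrite E' => t; apply: cvgD; apply: cvgM.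
  + exact: ce.
  + exact: continuous_expR_scale.
  + exact: cvg_cst.
  + apply: cvgM; [exact: (test_fun_continuous te)|exact: continuous_expR_scale].
- by exists a, b; split=> // t /E ->; rewrite mul0r.
Qed.

Lemma primitive_continuous g : mu.-integrable I (EFin \o g) ->
  {within I, continuous (fun t => \int[mu]_(s in `[0, t]) g s)}.
Proof. by move=> ig; apply: parameterized_integral_continuous => //; exact: ltW. Qed.

Lemma integrable_primitive g : mu.-integrable I (EFin \o g) ->
  mu.-integrable I (EFin \o (fun t => \int[mu]_(s in `[0, t]) g s)).
Proof.
move=> ig; apply: continuous_compact_integrable; first exact: segment_compact.
exact: primitive_continuous.
Qed.

(** Integration by parts for a merely integrable [g]: [Fubini_triangle] turns the double integral
    into that of g(s) (eta(T) - eta(s)). As eta vanishes at both ends, c drops out too. *)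
Lemma primitive_weak eta (c : R) g : test_fun T eta -> mu.-integrable I (EFin \o g) ->
  \int[mu]_(t in I) (derive1 eta t * (c + \int[mu]_(s in `[0, t]) g s)) =
  - \int[mu]_(t in I) (eta t * g t).
Proof.
move=> te ig; have [_ ce _] := te; have [e0 eT] := test_fun_endpoints te.
have [M HM] := continuous_itv_bounded (ltW T0) ce.
have F := Fubini_triangle (continuous_measurable_fun ce) HM ig.
have ie : mu.-integrable I (EFin \o derive1 eta).
  by apply: continuous_compact_integrable; [exact: segment_compact|exact: continuous_subspaceT].
have iP := integrable_continuousM ce (integrable_primitive ig).
transitivity (\int[mu]_(t in I) (c * derive1 eta t + derive1 eta t * \int[mu]_(s in `[0, t]) g s)).
  by apply: eq_Rintegral => t _; rewrite mulrDr mulrC.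
rewrite itv_RintegralD//; last exact: itv_integrableZ.
rewrite F itv_RintegralZ// (Rintegral_derive (fun x => test_fun_is_derive x te) ce (ltW T0)).
rewrite e0 eT subrr mulr0 add0r -mulN1r -itv_RintegralZ; last first.
  by apply: integrable_continuousM => //; exact: test_fun_continuous te.
apply: eq_Rintegral => s; rewrite inE/= in_itv/= => /andP[_ sT].
rewrite (Rintegral_derive (fun x => test_fun_is_derive x te) ce sT) eT.
by ring.
Qed.

(** z is e^(- l t) times a primitive, so testing with eta e^(- l t) reduces the claim to
    [primitive_weak]. *)
Lemma mild_weak eta (l c : R) F : test_fun T eta -> mu.-integrable I (EFin \o F) ->
  let z t := expR (- l * t) * c + volt l F t in
  \int[mu]_(t in I) (derive1 eta t * z t) =
  - \int[mu]_(t in I) (eta t * (F t - l * z t)).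
Proof.
move=> te iF z; have ceta := test_fun_continuous te.
have ce : continuous (derive1 eta) by case: te.
have iz : mu.-integrable I (EFin \o z).
  apply: itv_integrableD.
    apply: (@integrable_continuousM (fun t => expR (- l * t)) (cst c)).
      exact: continuous_expR_scale.
    exact: itv_integrable_cst.
  apply: continuous_compact_integrable; first exact: segment_compact.
  by apply: volt_continuous => //; exact: ltW.
have [tpsi dpsi] := test_fun_expM (- l) te.
have ig := integrable_expM l iF.
have := primitive_weak c tpsi ig; rewrite dpsi => E.
have iez := integrable_continuousM ce iz.
have iez2 := integrable_continuousM ceta iz.
have ieF := integrable_continuousM ceta iF.
have E1 : \int[mu]_(t in I) (derive1 eta t * z t - l * (eta t * z t)) =
    - \int[mu]_(t in I) (eta t * F t).
  transitivity (\int[mu]_(t in I) ((derive1 eta t * expR (- l * t) + - l * (eta t * expR (- l * t))) *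
     (c + \int[mu]_(s in `[0%R, t]) (expR (l * s) * F s)))).
    by apply: eq_Rintegral => t _; rewrite /z /volt; ring.
  rewrite E; congr (- _); apply: eq_Rintegral => t _.
  by rewrite -mulrA (mulrA (expR _)) -expRD (_ : _ + _ = 0) ?expR0 ?mul1r//; ring.
have -> : \int[mu]_(t in I) (eta t * (F t - l * z t)) =
    \int[mu]_(t in I) (eta t * F t) - l * \int[mu]_(t in I) (eta t * z t).
  rewrite -itv_RintegralZ// -itv_RintegralB//; last exact: itv_integrableZ.
  by apply: eq_Rintegral => t _; ring.
move: E1; rewrite itv_RintegralB//; last exact: itv_integrableZ.
by rewrite itv_RintegralZ//; lra.
Qed.

(** Integrating factor: e^(l t) b minus the primitive of e^(l s) F has zero weak derivative, hence
    is constant by [du_Bois_Reymond]. *)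
Lemma weak_mild (l : R) b F : measurable_fun setT b ->
  mu.-integrable I (EFin \o b) -> mu.-integrable I (EFin \o F) ->
  (forall eta, test_fun T eta -> \int[mu]_(t in I) (derive1 eta t * b t) =
     - \int[mu]_(t in I) (eta t * (F t - l * b t))) ->
  exists c, aeT T (fun t => b t = expR (- l * t) * c + volt l F t).
Proof.
move=> mb ib iF H; have ig := integrable_expM l iF.
have mI : measurable I by exact: measurable_itv.
pose P t := \int[mu]_(s in `[0%R, t]) (expR (l * s) * F s).
have iP := integrable_primitive ig.
(* [P] is known to be continuous on [0, T] only; cutting it off gives the measurability on the whole
   line that [du_Bois_Reymond] asks for. *)
pose f t := expR (l * t) * b t - (P \_ I) t.
have fE t : I t -> f t = expR (l * t) * b t - P t.
  by move=> It; rewrite /f /patch mem_set.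
have ieb := integrable_expM l ib.
have intf : mu.-integrable I (EFin \o f).
  apply: (@eq_integrable _ _ _ mu I mI (EFin \o (fun t => expR (l * t) * b t + (-1) * P t))).
    by move=> t; rewrite inE => It /=; rewrite fE// mulN1r.
  by apply: itv_integrableD => //; exact: itv_integrableZ.
have mf : measurable_fun setT f.
  apply: measurable_funB.
    by apply: measurable_funM => //; exact: measurable_expR_scale.
  apply/(measurable_restrictT _ mI).
  apply: subspace_continuous_measurable_fun => //.
  exact: primitive_continuous.
have [c hc] : exists c, aeT T (fun t => f t = c).
  apply: du_Bois_Reymond => // eta te.
  have ceta := test_fun_continuous te.
  have ce : continuous (derive1 eta) by case: te.
  have [tpsi dpsi] := test_fun_expM l te.
  have := H _ tpsi; rewrite dpsi => E.
  have := primitive_weak 0 te ig => E2.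
  have cpsi := test_fun_continuous tpsi.
  have E3 : \int[mu]_(t in I) (derive1 eta t * (expR (l * t) * b t)) =
      - \int[mu]_(t in I) (eta t * (expR (l * t) * F t)).
    transitivity (\int[mu]_(t in I) ((derive1 eta t * expR (l * t) + l * (eta t * expR (l * t))) * b t
         - l * (eta t * expR (l * t) * b t))).
      by apply: eq_Rintegral => t _; ring.
    have i1 := integrable_continuousM (test_fun_continuous tpsi) ib.
    have i2 := integrable_continuousM (test_fun_continuous tpsi) iF.
    rewrite itv_RintegralB; last 2 first.
    - have := itv_integrableD (integrable_continuousM ce ieb) (itv_integrableZ l i1).
      by rewrite (_ : (fun x => _ + _) = (fun t => (derive1 eta t * expR (l * t) + l * (eta t * expR (l * t))) * b t))//; apply/funext => t; ring.
    - exact: itv_integrableZ.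
    rewrite E itv_RintegralZ//.
    have -> : \int[mu]_(t in I) (eta t * expR (l * t) * (F t - l * b t)) =
        \int[mu]_(t in I) (eta t * expR (l * t) * F t) - l * \int[mu]_(t in I) (eta t * expR (l * t) * b t).
      rewrite -itv_RintegralZ// -itv_RintegralB//; last exact: itv_integrableZ.
      by apply: eq_Rintegral => t _; ring.
    rewrite opprB addrAC subrr add0r; congr (- _); apply: eq_Rintegral => t _; ring.
  transitivity (\int[mu]_(t in I) (derive1 eta t * (expR (l * t) * b t) -
     derive1 eta t * (0 + P t))).
    by apply: eq_Rintegral => t; rewrite inE => It; rewrite fE//; ring.
  rewrite itv_RintegralB; last 2 first.
  - exact: integrable_continuousM.
  - have := integrable_continuousM ce iP.
    by rewrite (_ : (fun t => derive1 eta t * (0 + P t)) = (fun t => derive1 eta t * P t))//; apply/funext => t; rewrite add0r.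
  by rewrite E2 E3 subrr.
exists c; apply: aeTS hc => t tI; rewrite fE; last by rewrite /I/= in_itv.
move=> <-; rewrite /volt -/(P t) -mulrDr subrK mulrA -expRD (_ : _ + _ = 0) ?expR0 ?mul1r//.
by ring.
Qed.

End WeakODE.

End DuBoisReymond.

(** * Strong measurability and L2 spaces *)

Section StronglyMeasurable.
Context {R : realType}.
Local Notation mu := (@lebesgue_measure R).
Arguments sf_set {R Z} s i.
Arguments sf_vec {R Z} s i.

Section OneSpace.
Context {Z : normedModType R}.
Implicit Types (a b : R -> Z) (s : step_fun Z).

Definition is_step (f : R -> Z) := exists s : step_fun Z, forall t, f t = sf_fun s t.

Lemma is_step_fun s : is_step (sf_fun s).
Proof. by exists s. Qed.

Lemma is_step_cst (v : Z) : is_step (fun=> v).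
Proof.
exists (@StepFun R Z 1 (fun=> setT) (fun=> v) (fun=> measurableT)) => t.
by rewrite /sf_fun big_ord1/= indicE mem_set// scale1r.
Qed.

Lemma is_stepD f g : is_step f -> is_step g -> is_step (fun t => f t + g t).
Proof.
move=> [[n A u mA] hf] [[m B v mB] hg].
pose S (i : 'I_(n + m)) := match fintype.split i with inl j => A j | inr j => B j end.
pose w (i : 'I_(n + m)) := match fintype.split i with inl j => u j | inr j => v j end.
have mS i : measurable (S i) by rewrite /S; case: (fintype.split i).
exists (StepFun w mS) => t; rewrite hf hg /sf_fun/= big_split_ord/=.
by congr (_ + _); apply: eq_bigr => i _; rewrite /S /w ?(unsplitK (inl i)) ?(unsplitK (inr i)).
Qed.

Lemma is_step_indic (E : set R) f : measurable E -> is_step f ->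
  is_step (fun t => \1_E t *: f t).
Proof.
move=> mE [[n A u mA] hf].
exists (@StepFun R Z n (fun i => E `&` A i) u (fun i => measurableI _ _ mE (mA i))) => t.
rewrite hf /sf_fun/= scaler_sumr; apply: eq_bigr => i _.
by rewrite scalerA indicI.
Qed.

(* Along a step function the value ranges over finitely many vectors, so no
   regularity of [phi] is needed. *)
Lemma measurable_step (phi : Z -> R) s : measurable_fun setT (phi \o sf_fun s).
Proof.
case: s => n A u mA.
rewrite (_ : _ \o _ = fun t => phi (\sum_(i < n) \1_(A i) t *: u i))//.
elim: n A u mA phi => [|n IH] A u mA phi.
  by rewrite (_ : (fun t => _) = cst (phi 0))//; apply/funext => t; rewrite big_ord0.
pose A' i := A (lift ord0 i); pose u' i := u (lift ord0 i).
have mA' i : measurable (A' i) by exact: mA.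
rewrite (_ : (fun t => _) = (fun t =>
   \1_(A ord0) t * phi (u ord0 + \sum_(i < n) \1_(A' i) t *: u' i) +
   (1 - \1_(A ord0) t) * phi (\sum_(i < n) \1_(A' i) t *: u' i))).
  have mi : measurable_fun setT (\1_(A ord0) : R -> R) by exact: measurable_indic.
  apply: measurable_funD; apply: measurable_funM => //.
  - exact: (IH _ _ mA' (fun z => phi (u ord0 + z))).
  - exact: measurable_funB.
  - exact: (IH _ _ mA' phi).
apply/funext => t; rewrite big_ord_recl indicE; case: (t \in A ord0).
  by rewrite scale1r mul1r subrr mul0r addr0.
by rewrite scale0r mul0r subr0 mul1r !add0r.
Qed.

(* Convergence everywhere, and not only almost everywhere as in
   [strongly_measurable], makes continuous functions of a Borel measurable. *)
Definition smeas a := exists s : nat -> step_fun Z,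
  forall t, sf_fun (s n) t @[n --> \oo] --> a t.

Lemma smeas_steps a (f : nat -> R -> Z) : (forall n, is_step (f n)) ->
  (forall t, f n t @[n --> \oo] --> a t) -> smeas a.
Proof.
move=> /choice[s hs] h; exists s => t.
by rewrite (_ : (fun n => _) = (fun n => f n t))//; apply/funext => n.
Qed.

Lemma smeas_step f : is_step f -> smeas f.
Proof. by move=> h; apply: (@smeas_steps _ (fun=> f)) => // t; exact: cvg_cst. Qed.

Lemma measurable_smeas (phi : Z -> R) a : continuous phi -> smeas a ->
  measurable_fun setT (phi \o a).
Proof.
move=> cphi [s hs].
apply: (measurable_fun_cvg (fun n => measurable_step phi (s n))) => t _.
by apply: continuous_cvg; [exact: cphi|exact: hs].
Qed.

(** The best approximations of [a t] among d 0, ..., d n are step functions, by recursion on n from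
    the measurable comparison of two distances; density makes them converge. *)
Lemma smeas_dense a (d : nat -> Z) :
  (forall j, measurable_fun setT (fun t => `|a t - d j|)) ->
  (forall t e, 0 < e -> exists j, `|a t - d j| < e) -> smeas a.
Proof.
move=> md dd.
pose fix best n : R -> Z := if n is m.+1 then
  (fun t => if `|a t - d n| < `|a t - best m t| then d n else best m t) else fun=> d 0%N.
have mb n : measurable_fun setT (fun t => `|a t - best n t|).
  elim: n => [|n IH] /=; first exact: md.
  rewrite (_ : (fun t => _) = (fun t => if `|a t - d n.+1| < `|a t - best n t| then
     `|a t - d n.+1| else `|a t - best n t|)).
    by apply: measurable_fun_ifT => //; exact: measurable_fun_ltr.
  by apply/funext => t; case: ifP.
have sb n : is_step (best n).
  elim: n => [|n IH] /=; first exact: is_step_cst.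
  pose E := [set t | `|a t - d n.+1| < `|a t - best n t|].
  have mE : measurable E.
    have := measurable_fun_ltr (md n.+1) (mb n) measurableT (Y := [set true]).
    rewrite setTI (_ : _ @^-1` _ = E); first by apply.
    by apply/seteqP; split => t /=.
  have mEc := measurableC mE.
  have [s hs] := is_stepD (is_step_indic mE (is_step_cst (d n.+1))) (is_step_indic mEc IH).
  exists s => t; rewrite -hs !indicE in_setC.
  rewrite (_ : (t \in E) = (`|a t - d n.+1| < `|a t - best n t|)); last first.
    by apply/idP/idP; rewrite inE.
  by case: ifP => _; rewrite ?scale1r ?scale0r ?addr0 ?add0r.
have le_best n j t : (j <= n)%N -> `|a t - best n t| <= `|a t - d j|.
  elim: n => [|n IH]; first by rewrite leqn0 => /eqP ->.
  rewrite leq_eqVlt => /predU1P[->|/IH H] /=; case: ltP => // h.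
  exact: le_trans (ltW h) H.
apply: (smeas_steps sb) => t; apply/cvgrPdist_lt => e e0.
have [j hj] := dd t e e0; exists j => // n /= jn.
exact: le_lt_trans (le_best _ _ _ jn) hj.
Qed.

(** The values of all the approximating step functions form a countable set whose closure contains
    the values of [a], so [smeas_dense] applies. A diagonal sequence would call for a uniformity
    that pointwise convergence does not give. *)
Lemma smeas_lim a (f : nat -> R -> Z) : (forall n, smeas (f n)) ->
  (forall t, f n t @[n --> \oo] --> a t) -> smeas a.
Proof.
move=> /choice[s hs] h.
(* A code consists of two indices and a list of bits selecting which vectors of [s n m] are summed;
   the selections include all its values. *)
pose d k := if unpickle k is Some (n, m, bs) then
  \sum_(i < sf_card (s n m)) (nth false bs i)%:R *: sf_vec (s n m) i else 0.
have dE n m t : exists k, d k = sf_fun (s n m) t.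
  exists (pickle (n, m, [seq t \in sf_set (s n m) i | i <- enum 'I_(sf_card (s n m))])).
  rewrite /d pickleK /sf_fun; apply: eq_bigr => i _; rewrite indicE.
  by rewrite (nth_map i) ?size_enum_ord// nth_ord_enum.
apply: (@smeas_dense _ d).
- move=> j; have cn : continuous (fun z : Z => `|z - d j|).
    by move=> z; apply: cvg_norm; apply: cvgB; [exact: cvg_id|exact: cvg_cst].
  apply: (@measurable_fun_cvg _ _ _ setT (fun n t => `|f n t - d j|)).
    by move=> n; apply: measurable_smeas cn _; exists (s n); exact: hs.
  by move=> t _; apply: cvg_norm; apply: cvgB; [exact: h|exact: cvg_cst].
- move=> t e e0; have e2 : 0 < e / 2 by rewrite divr_gt0.
  have /cvgrPdist_lt /(_ _ e2) [n _ /(_ n (leqnn _)) /= hn] := h t.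
  have /cvgrPdist_lt /(_ _ e2) [m _ /(_ m (leqnn _)) /= hm] := hs n t.
  have [k hk] := dE n m t; exists k; rewrite hk.
  rewrite (_ : _ - _ = (a t - f n t) + (f n t - sf_fun (s n m) t)); last by rewrite addrA subrK.
  by rewrite (le_lt_trans (ler_normD _ _))// (splitr e) ltrD.
Qed.

Lemma smeasD a b : smeas a -> smeas b -> smeas (fun t => a t + b t).
Proof.
move=> [s hs] [r hr].
apply: (@smeas_steps _ (fun n t => sf_fun (s n) t + sf_fun (r n) t)).
  by move=> n; apply: is_stepD; exact: is_step_fun.
by move=> t; apply: cvgD; [exact: hs|exact: hr].
Qed.

(** The rational multiples of [v] are dense among its real multiples. *)
Lemma smeas_scale_cst (theta : R -> R) (v : Z) : measurable_fun setT theta ->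
  smeas (fun t => theta t *: v).
Proof.
move=> mt; pose d k := if unpickle k is Some r then ratr r *: v else 0.
apply: (@smeas_dense _ d).
- move=> j; rewrite /d; case: (unpickle j) => [r|].
    rewrite (_ : (fun t => _) = (fun t => `|theta t - ratr r| * `|v|)).
      by apply: measurable_funM => //; apply: measurableT_comp => //; exact: measurable_funB.
    by apply/funext => t; rewrite -scalerBl normrZ.
  rewrite (_ : (fun t => _) = (fun t => `|theta t| * `|v|)).
    by apply: measurable_funM => //; exact: measurableT_comp.
  by apply/funext => t; rewrite subr0 normrZ.
- move=> t e e0; have v1 : 0 < `|v| + 1 by rewrite ltr_wpDl.
  have tt : theta t - e / (`|v| + 1) < theta t by rewrite gtrBl divr_gt0.
  have [r] := rat_in_itvoo tt.
  rewrite in_itv/= => /andP[r1 r2]; exists (pickle r); rewrite /d pickleK.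
  rewrite -scalerBl normrZ gtr0_norm ?subr_gt0//.
  rewrite (@le_lt_trans _ _ ((theta t - ratr r) * (`|v| + 1)))//.
    by rewrite ler_wpM2l ?lerDl// subr_ge0 ltW.
  by rewrite -ltr_pdivlMr// ltrBlDr -ltrBlDl.
Qed.

Lemma smeas_sum n (f : 'I_n -> R -> Z) : (forall i, smeas (f i)) ->
  smeas (fun t => \sum_(i < n) f i t).
Proof.
move=> h; elim: n f h => [|n IH] f h.
  rewrite (_ : (fun t => _) = fun=> 0); first by apply: smeas_step; exact: is_step_cst.
  by apply/funext => t; rewrite big_ord0.
rewrite (_ : (fun t => _) = (fun t => \sum_(i < n) f (widen_ord (leqnSn n) i) t + f ord_max t)).
  by apply: smeasD => //; apply: IH.
by apply/funext => t; rewrite big_ord_recr.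
Qed.

Lemma smeasM (theta : R -> R) a : measurable_fun setT theta -> smeas a ->
  smeas (fun t => theta t *: a t).
Proof.
move=> mt [s hs].
apply: (@smeas_lim _ (fun n t => theta t *: sf_fun (s n) t)); last first.
  by move=> t; apply: cvgZl_tmp; exact: hs.
move=> n; rewrite (_ : (fun t => _) = (fun t =>
   \sum_(i < sf_card (s n)) (theta t * \1_(sf_set (s n) i) t) *: sf_vec (s n) i)).
  apply: smeas_sum => i; apply: smeas_scale_cst; apply: measurable_funM => //.
  by apply: measurable_indic; exact: sf_setP.
by apply/funext => t; rewrite /sf_fun scaler_sumr; apply: eq_bigr => i _; rewrite scalerA.
Qed.

Lemma smeasB a b : smeas a -> smeas b -> smeas (fun t => a t - b t).
Proof.
move=> sa sb; apply: smeasD => //.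
rewrite (_ : (fun t => _) = (fun t => cst (-1) t *: b t)); first exact: smeasM.
by apply/funext => t; rewrite scaleN1r.
Qed.

Lemma smeas_norm a : smeas a -> measurable_fun setT (fun t => `|a t|).
Proof. by apply: (@measurable_smeas (fun z => `|z|)); exact: norm_continuous. Qed.

Lemma smeas_strongly (T : R) a b : smeas a -> aeT T (fun t => a t = b t) ->
  strongly_measurable T b.
Proof. by move=> [s hs] ab; exists s; apply: aeTS ab => t _ <-. Qed.

(** An indicator removes the exceptional null set and the outside of [0, T]; convergence almost
    everywhere becomes convergence everywhere. *)
Lemma strongly_smeas (T : R) a : strongly_measurable T a ->
  exists b, [/\ smeas b, aeT T (fun t => a t = b t) &
    forall t, t \notin `[0, T] -> b t = 0].
Proof.
move=> [s [N [mN N0 hN]]].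
pose G := `[0, T]%classic `&` ~` N.
have mG : measurable G by apply: measurableI; [exact: measurable_itv|exact: measurableC].
have HG t : G t -> sf_fun (s n) t @[n --> \oo] --> a t.
  by move=> [tI nN]; apply: contrapT => na; apply: nN; apply: hN => /(_ tI).
exists (fun t => \1_G t *: a t); split.
- apply: (@smeas_steps _ (fun n t => \1_G t *: sf_fun (s n) t)).
    by move=> n; apply: is_step_indic => //; exact: is_step_fun.
  move=> t; rewrite indicE; have [tG|tG] := boolP (t \in G).
    by apply: cvgZl_tmp; apply: HG; rewrite inE in tG.
  by rewrite scale0r (_ : (fun n => _) = fun=> 0); [exact: cvg_cst|apply/funext => n; rewrite scale0r].
- exists N; split => // t /= /not_implyP[tI]; apply: contra_notP => nN.
  by rewrite indicE mem_set ?scale1r.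
- move=> t tI; rewrite indicE memNset ?scale0r// => -[] /=.
  by rewrite (negbTE tI).
Qed.

End OneSpace.

Lemma smeas_linear (Z Z' : normedModType R) (L : {linear Z -> Z'}) (a : R -> Z) :
  continuous L -> smeas a -> smeas (L \o a).
Proof.
move=> cL [s hs].
exists (fun n => @StepFun R Z' (sf_card (s n)) (sf_set (s n)) (L \o sf_vec (s n)) (@sf_setP _ _ (s n))).
move=> t; rewrite (_ : (fun n => _) = (fun n => L (sf_fun (s n) t))).
  by apply: continuous_cvg; [exact: cL|exact: hs].
by apply/funext => n; rewrite /sf_fun/= linear_sum; apply: eq_bigr => i _; rewrite linearZ.
Qed.

End StronglyMeasurable.

Section L2Theory.
Context {R : realType} (T : R).
Local Notation mu := (@lebesgue_measure R).
Let I := `[0%R, T]%classic.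

Section OneSpace.
Context {Z : normedModType R}.
Implicit Types a b : R -> Z.

Lemma L2_int_ae a b : aeT T (fun t => a t = b t) ->
  (\int[mu]_(t in I) (`|a t| ^+ 2)%:E = \int[mu]_(t in I) (`|b t| ^+ 2)%:E)%E.
Proof.
by move=> ab; apply: ae_eq_integral_nomeas; apply: aeTS ab => t _ ->.
Qed.

Lemma L2norm_ae a b : aeT T (fun t => a t = b t) -> L2norm T a = L2norm T b.
Proof. by move=> ab; rewrite /L2norm (L2_int_ae ab). Qed.

Lemma L2_ae a b : aeT T (fun t => a t = b t) -> L2 T a -> L2 T b.
Proof.
move=> ab [[s hs] h]; split; last by rewrite -(L2_int_ae ab).
by exists s; apply: aeT2 ab hs => t _ ->.
Qed.

Lemma L2norm_ge0 a : 0 <= L2norm T a.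
Proof. exact: sqrtr_ge0. Qed.

Lemma sqi_norm a : smeas a -> L2 T a -> sqi T (fun t => `|a t|).
Proof.
move=> sa [_ h]; have ms := smeas_norm sa; split => //.
apply/integrableP; split.
  by apply/measurable_EFinP; apply: measurable_funTS; exact: measurable_funX.
rewrite (@eq_integral _ _ _ mu I (fun t => (`|a t| ^+ 2)%:E))//.
by move=> t _ /=; rewrite ger0_norm ?sqr_ge0.
Qed.

Lemma smeas_L2 a : smeas a -> sqi T (fun t => `|a t|) -> L2 T a.
Proof.
move=> sa [_ h]; split; first by apply: (smeas_strongly sa); exact: aeT_all.
move/integrableP : h => [_]; rewrite (@eq_integral _ _ _ mu I (fun t => (`|a t| ^+ 2)%:E))//.
by move=> t _ /=; rewrite ger0_norm ?sqr_ge0.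
Qed.

Lemma L2_rep a : L2 T a -> exists b, [/\ smeas b, L2 T b, aeT T (fun t => a t = b t)
  & forall t, t \notin `[0, T] -> b t = 0].
Proof.
move=> La; have [sa _] := La; have [b [sb ab b0]] := strongly_smeas sa.
by exists b; split => //; exact: L2_ae ab La.
Qed.

Lemma L2norm_sqr a : L2norm T a ^+ 2 = \int[mu]_(t in I) (`|a t| ^+ 2).
Proof.
rewrite /L2norm sqr_sqrtr// fine_ge0//; apply: integral_ge0 => t _.
by rewrite lee_fin sqr_ge0.
Qed.

Lemma L2_sqi a : smeas a -> L2 T a -> mu.-integrable I (EFin \o (fun t => `|a t| ^+ 2)).
Proof. by move=> sa La; case: (sqi_norm sa La). Qed.

End OneSpace.

Lemma L2_le (Z Z' : normedModType R) (a : R -> Z) (b : R -> Z') (C : R) : 0 <= C ->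
  strongly_measurable T a -> L2 T b -> aeT T (fun t => `|a t| <= C * `|b t|) ->
  L2 T a /\ L2norm T a <= C * L2norm T b.
Proof.
move=> C0 sa Lb ab.
have [c [sc Lc bc _]] := L2_rep Lb; have bcn := L2norm_ae bc.
have [mc ic] := sqi_norm sc Lc.
have H : (\int[mu]_(t in I) (`|a t| ^+ 2)%:E <= (C ^+ 2)%:E * \int[mu]_(t in I) (`|c t| ^+ 2)%:E)%E.
  rewrite -ge0_integralZl//; last 3 first.
  - exact: measurable_itv.
  - by apply/measurable_EFinP; apply: measurable_funTS; exact: measurable_funX.
  - by rewrite lee_fin sqr_ge0.
  apply: ge0_ae_le_integral.
  - by move=> t _; rewrite lee_fin sqr_ge0.
  - by move=> t _; rewrite -EFinM lee_fin mulr_ge0 ?sqr_ge0.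
  - apply: aeT2 ab bc => t _ + bct; rewrite bct => h.
    by rewrite -EFinM lee_fin -exprMn ler_pXn2r ?nnegrE ?mulr_ge0.
have fc : (\int[mu]_(t in I) (`|c t| ^+ 2)%:E \is a fin_num)%E.
  rewrite ge0_fin_numE; first by case: Lc.
  by apply: integral_ge0 => t _; rewrite lee_fin sqr_ge0.
have ha : (\int[mu]_(t in I) (`|a t| ^+ 2)%:E < +oo)%E.
  by rewrite (le_lt_trans H)// -(fineK fc) -EFinM ltry.
split; first by split.
rewrite -(@ler_pXn2r _ 2)// ?nnegrE ?mulr_ge0 ?L2norm_ge0// exprMn bcn !L2norm_sqr.
rewrite /Rintegral -lee_fin fineK; last first.
  by rewrite ge0_fin_numE//; apply: integral_ge0 => t _; rewrite lee_fin sqr_ge0.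
by rewrite EFinM fineK.
Qed.

Section OneSpace.
Context {Z : normedModType R}.
Implicit Types a b : R -> Z.

Lemma strongly_measurableD a b : strongly_measurable T a -> strongly_measurable T b ->
  strongly_measurable T (fun t => a t + b t).
Proof.
move=> /strongly_smeas[a' [sa aa _]] /strongly_smeas[b' [sb bb _]].
by apply: (smeas_strongly (smeasD sa sb)); apply: aeT2 aa bb => t _ -> ->.
Qed.

Lemma strongly_measurableM (theta : R -> R) a : measurable_fun setT theta ->
  strongly_measurable T a -> strongly_measurable T (fun t => theta t *: a t).
Proof.
move=> mt /strongly_smeas[a' [sa aa _]].
by apply: (smeas_strongly (smeasM mt sa)); apply: aeTS aa => t _ ->.
Qed.

Lemma L2M (theta : R -> R) (C : R) a : measurable_fun setT theta ->
  (forall t, 0 <= t <= T -> `|theta t| <= C) -> 0 <= C -> L2 T a ->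
  L2 T (fun t => theta t *: a t) /\ L2norm T (fun t => theta t *: a t) <= C * L2norm T a.
Proof.
move=> mt hC C0 La; apply: L2_le => //.
  by apply: strongly_measurableM => //; case: La.
by apply: aeT_all => t tI; rewrite normrZ ler_wpM2r// hC.
Qed.

Lemma L2Z (c : R) a : L2 T a -> L2 T (fun t => c *: a t).
Proof.
move=> La; have := @L2M (cst c) `|c| a (measurable_cst _) (fun _ _ => lexx _) (normr_ge0 _) La.
by case.
Qed.

Lemma L2D a b : L2 T a -> L2 T b -> L2 T (fun t => a t + b t) /\
  L2norm T (fun t => a t + b t) <= L2norm T a + L2norm T b.
Proof.
move=> La Lb; have [a' [sa La' aa _]] := L2_rep La; have [b' [sb Lb' bb _]] := L2_rep Lb.
have ab : aeT T (fun t => a' t + b' t = a t + b t) by apply: aeT2 aa bb => t _ -> ->.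
have [ma ia] := sqi_norm sa La'; have [mb ib] := sqi_norm sb Lb'.
have mI : measurable I by exact: measurable_itv.
have iab : mu.-integrable I (EFin \o (fun t => (`|a' t| + `|b' t|) ^+ 2)).
  by apply: integrable_sqrD => //; exact: measurable_funTS.
have sab : sqi T (fun t => `|a' t + b' t|).
  have ms := smeas_norm (smeasD sa sb); split => //.
  apply: le_integrable iab => //.
    by apply/measurable_EFinP; apply: measurable_funTS; exact: measurable_funX.
  move=> t _ /=; rewrite lee_fin !ger0_norm ?sqr_ge0// ler_pXn2r ?nnegrE ?addr_ge0//.
  exact: ler_normD.
split; first by apply: L2_ae ab _; exact: smeas_L2 (smeasD sa sb) sab.
rewrite -(L2norm_ae ab) (L2norm_ae aa) (L2norm_ae bb).
rewrite -(@ler_pXn2r _ 2)// ?nnegrE ?addr_ge0 ?L2norm_ge0// sqrrD !L2norm_sqr.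
have := @Rintegral_sqrD _ _ _ mu I mI (fun t => `|a' t|) (fun t => `|b' t|)
  (measurable_funTS ma) (measurable_funTS mb) ia ib.
have := @Rintegral_CauchySchwarz _ _ _ mu I mI (fun t => `|a' t|) (fun t => `|b' t|)
  (measurable_funTS ma) (measurable_funTS mb) ia ib.
rewrite -!L2norm_sqr => CS E.
apply: (@le_trans _ _ (\int[mu]_(t in I) (`|a' t| + `|b' t|) ^+ 2)).
  rewrite L2norm_sqr; apply: le_Rintegral => //; first by case: sab.
  by move=> t _; rewrite ler_pXn2r ?nnegrE ?addr_ge0// ler_normD.
rewrite E lerD2r lerD2l -[leRHS]mulr_natl ler_wpM2l//.
rewrite -exprMn in CS.
rewrite -(@ler_pXn2r _ 2)// ?nnegrE ?mulr_ge0 ?L2norm_ge0//.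
by apply: Rintegral_ge0 => t _; rewrite mulr_ge0.
Qed.

Lemma L2normN a : L2norm T (fun t => - a t) = L2norm T a.
Proof. by rewrite /L2norm; under eq_integral do rewrite normrN. Qed.

Lemma L2N a : L2 T a -> L2 T (fun t => - a t).
Proof.
move=> /(L2Z (-1)); rewrite (_ : (fun t => _) = (fun t => - a t))//.
by apply/funext => t; rewrite scaleN1r.
Qed.

Lemma L2B a b : L2 T a -> L2 T b -> L2 T (fun t => a t - b t) /\
  L2norm T (fun t => a t - b t) <= L2norm T a + L2norm T b.
Proof.
by move=> La /L2N Lb; have := L2D La Lb; rewrite (L2normN b).
Qed.

Lemma L2norm_eq0 a : L2 T a -> L2norm T a = 0 -> aeT T (fun t => a t = 0).
Proof.
move=> La a0; have [b [sb Lb ab _]] := L2_rep La.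
have [mb ib] := sqi_norm sb Lb.
have := L2norm_sqr b; rewrite -(L2norm_ae ab) a0 expr0n/= => /esym h.
have : (\int[mu]_(t in I) `|(`|b t| ^+ 2)%:E| = 0)%E.
  under eq_integral do rewrite /= ger0_norm ?sqr_ge0//.
  rewrite -(@fineK _ (\int[mu]_(t in I) _)%E) ?[fine _]h//.
  by apply: integrable_fin_num => //; exact: measurable_itv.
move/ae_eq_integral_abs => /(_ _ _) H.
have {}H : aeT T (fun t => (`|b t| ^+ 2)%:E = 0%E).
  by apply: H; [exact: measurable_itv|exact: measurable_int ib].
apply: aeT2 ab H => t _ -> [] /eqP; rewrite sqrf_eq0 normr_eq0 => /eqP //.
Qed.

Lemma L20 : L2 T (fun=> 0 : Z) /\ L2norm T (fun=> 0 : Z) = 0.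
Proof.
have E : (\int[mu]_(t in I) (`|0 : Z| ^+ 2)%:E = 0)%E.
  by rewrite integral0_eq// => t _; rewrite normr0 expr0n.
split; last by rewrite /L2norm E sqrtr0.
split; last by rewrite E ltry.
apply: (@smeas_strongly _ _ _ (fun=> 0)); last by exact: aeT_all.
by apply: smeas_step; exact: is_step_cst.
Qed.

End OneSpace.

Lemma L2_linear (Z Z' : normedModType R) (L : {linear Z -> Z'}) (C : R) (a : R -> Z) :
  0 <= C -> (forall z, `|L z| <= C * `|z|) -> L2 T a ->
  L2 T (fun t => L (a t)) /\ L2norm T (fun t => L (a t)) <= C * L2norm T a.
Proof.
move=> C0 hC La; apply: L2_le => //; last exact: aeT_all.
have cL : continuous L.
  by apply: bounded_linear_continuous; apply/linear_boundedP; near=> M => z;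
    rewrite (le_trans (hC z))// ler_wpM2r//; near: M; exact: nbhs_pinfty_ge.
have [sa _] := La; have [b [sb ab _]] := strongly_smeas sa.
by apply: (smeas_strongly (smeas_linear cL sb)); apply: aeTS ab => t _ /= ->.
Unshelve. all: by end_near. Qed.

End L2Theory.

(** * Completeness of the L^2 spaces *)

Section L2Complete.
Context {R : realType} (T : R).
Local Notation mu := (@lebesgue_measure R).
Let I := `[0%R, T]%classic.
Let mI : measurable (I : set (measurableTypeR R)). Proof. exact: measurable_itv. Qed.

(* [dom] and [dual] are declared as normed modules only, so their completeness is
   passed around in this form. *)
Definition abs_complete (Z : normedModType R) := forall u : nat -> Z,
  cvgn (series (fun n => `|u n.+1 - u n|)) -> cvgn u.

Lemma geo_half_sum (n m : nat) : (n <= m)%N ->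
  \sum_(n <= j < m) (2^-1 : R) ^+ j <= 2 * 2^-1 ^+ n.
Proof.
move=> nm; rewrite (_ : \sum_(n <= j < m) _ = 2 * 2^-1 ^+ n - 2 * 2^-1 ^+ m).
  by rewrite gerBl mulr_ge0// exprn_ge0// invr_ge0.
rewrite -(subnKC nm); elim: (m - n)%N => [|k IH].
  by rewrite addn0 big_geq// subrr.
rewrite addnS big_nat_recr/= ?leq_addr// IH exprS mulrA mulfV// mul1r.
by rewrite -addrA; congr (_ + _); ring.
Qed.

Variables (Z : normedModType R) (Zcomplete : abs_complete Z).

(** Riesz-Fischer with a rate: the geometric increments give absolute convergence almost everywhere,
    and Fatou's lemma passes the bound to the limit. *)
Lemma L2_complete (a : nat -> R -> Z) (K : R) : 0 <= K ->
  (forall n, L2 T (a n)) ->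
  (forall n, L2norm T (fun t => a n.+1 t - a n t) <= K * 2^-1 ^+ n) ->
  exists2 b, L2 T b & forall n, L2norm T (fun t => b t - a n t) <= 2 * K * 2^-1 ^+ n.
Proof.
move=> K0 La Ka.
have /choice[b hb] := fun n => L2_rep (La n).
have sb n : smeas (b n) by case: (hb n).
have Lb n : L2 T (b n) by case: (hb n).
have ab n : aeT T (fun t => a n t = b n t) by case: (hb n).
have ND (M : R) (x y : R -> Z) : smeas x -> L2 T x -> smeas y -> L2 T y -> L2norm T (fun t => x t - y t) <= M ->
    mu.-integrable I (EFin \o (fun t => `|x t - y t| ^+ 2)) /\
    (\int[mu]_(t in I) (`|x t - y t| ^+ 2)%:E <= (M ^+ 2)%:E)%E.
  move=> sx Lx sy Ly h.
  have sxy : smeas (fun t => x t - y t).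
    exact: smeasB.
  have [Lxy _] := L2B Lx Ly; have ixy := L2_sqi sxy Lxy.
  split; first exact: ixy.
  rewrite -(fineK (integrable_fin_num mI ixy)) lee_fin -[leLHS]L2norm_sqr.
  rewrite ler_pXn2r ?nnegrE ?L2norm_ge0//.
  exact: le_trans (L2norm_ge0 _ _) h.
have Kb n : L2norm T (fun t => b n.+1 t - b n t) <= K * 2^-1 ^+ n.
  rewrite (le_trans _ (Ka n))// (@L2norm_ae _ _ _ _ (fun t => a n.+1 t - a n t))//.
  by apply: aeT2 (ab n) (ab n.+1) => t _ -> ->.
have Kbm n m : L2norm T (fun t => b (n + m)%N t - b n t) <= 2 * K * 2^-1 ^+ n.
  apply: (@le_trans _ _ (K * \sum_(n <= j < n + m) 2^-1 ^+ j)); last first.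
    by rewrite (mulrC 2) -mulrA ler_wpM2l// geo_half_sum// leq_addr.
  elim: m => [|m IH].
    rewrite addn0 big_geq// mulr0 (_ : (fun t => _) = fun=> 0).
      by case: (L20 T (Z := Z)) => _ ->.
    by apply/funext => t; rewrite subrr.
  rewrite addnS big_nat_recr/= ?leq_addr// mulrDr addrC.
  rewrite (_ : (fun t => _) = (fun t => (b (n + m).+1 t - b (n + m)%N t) + (b (n + m)%N t - b n t))).
    by have [_ H] := L2D (L2B (Lb (n + m).+1) (Lb (n + m)%N)).1 (L2B (Lb (n + m)%N) (Lb n)).1;
      rewrite (le_trans H)// lerD.
  by apply/funext => t; rewrite addrA subrK.
pose g n t := `|b n.+1 t - b n t|.
have mg n : measurable_fun setT (g n).
  by apply: smeas_norm; exact: smeasB.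
(* The weight 2^n is affordable, since the integrals remain at most K^2 2^-n, and it pays for the
   passage from squares to first powers below. *)
pose e n t : \bar R := (2 ^+ n * g n t ^+ 2)%:E.
have e0 n t : (0 <= e n t)%E by rewrite lee_fin; apply: mulr_ge0; [exact: exprn_ge0|exact: sqr_ge0].
have me n : measurable_fun setT (e n).
  by apply/measurable_EFinP; apply: measurable_funM => //; exact: measurable_funX.
pose h t : \bar R := (\sum_(0 <= n <oo) e n t)%E.
have mh : measurable_fun setT h by apply: ge0_emeasurable_sum => //.
have ih : (\int[mu]_(t in I) h t <= (2 * K ^+ 2)%:E)%E.
  rewrite (integral_nneseries mu mI (fun n => measurable_funTS (me n)) (fun n t _ => e0 n t)).
  apply: (@le_trans _ _ (\sum_(0 <= n <oo) (cst 0%E n + ((2 * K ^+ 2) / (2 ^ n.+1)%:R)%:E))%E); last first.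
    apply: le_trans (epsilon_trick _ _ _) _ => //; first by rewrite mulr_ge0// sqr_ge0.
    by rewrite eseries0// add0e.
  apply: lee_nneseries => [n *|n *]; first by apply: integral_ge0 => t _; exact: e0.
  rewrite add0e /e; under eq_integral do rewrite EFinM.
  rewrite ge0_integralZl//; last first.
  - by move=> t _; rewrite lee_fin sqr_ge0.
  - apply/measurable_EFinP; apply: (@measurable_funTS _ _ _ _ I (fun t => g n t ^+ 2)).
    exact: measurable_funX (mg n).
  have [_ H] := ND (K * 2^-1 ^+ n) _ _ (sb n.+1) (Lb n.+1) (sb n) (Lb n) (Kb n).
  apply: le_trans (lee_wpmul2l _ H) _; first by rewrite lee_fin exprn_ge0.
  rewrite -EFinM lee_fin natrX [2 ^+ n.+1]exprS exprVn.
  have : (2 : R) ^+ n != 0 by rewrite expf_neq0.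
  move: (2 ^+ n) => p p0; rewrite le_eqVlt; apply/orP; left; apply/eqP.
  by field.
have iih : mu.-integrable I h.
  apply/integrableP; split; first exact: measurable_funTS.
  rewrite (@eq_integral _ _ _ mu I h).
    by rewrite (le_lt_trans ih)// ltry.
  by move=> t _; rewrite gee0_abs//; apply: nneseries_ge0.
have fh := integrable_ae mI iih.
pose G := I `&` ~` (h @^-1` [set +oo%E]).
have mG : measurable G.
  apply: measurableI => //; apply: measurableC; rewrite -[X in measurable X]setTI.
  by apply: mh => //; exact: emeasurable_set1.
have cvb t : G t -> cvgn (fun n => b n t).
  move=> [tI /= hoo]; apply: Zcomplete.
  have h0 : (0 <= h t)%E by apply: nneseries_ge0.
  have hf : h t \is a fin_num by rewrite ge0_fin_numE// lt_neqAle leey andbT; apply/eqP.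
  apply: nondecreasing_is_cvgn.
    by apply/nondecreasing_seqP => n; rewrite !seriesEnat/= big_nat_recr//= lerDl.
  exists (2 + fine (h t)) => _ [n _ <-]; rewrite seriesEnat/=.
  (* x <= 1 / p + p x^2 with p = 2^k; the first terms sum to at most 2, the second ones to at most
     [h t]. *)
  apply: (@le_trans _ _ (\sum_(0 <= k < n) (2^-1 ^+ k + 2 ^+ k * g k t ^+ 2))).
    apply: ler_sum => k _; rewrite -/(g k t).
    have p0 : 0 < (2 : R) ^+ k by rewrite exprn_gt0.
    rewrite exprVn; move: (2 ^+ k) (g k t) p0 => p x p0.
    rewrite -subr_ge0 (_ : _ - _ = ((p * x - 2^-1) ^+ 2 + (3 / 4)) / p); last by field; exact: lt0r_neq0.
    by rewrite divr_ge0 ?(ltW p0)// addr_ge0 ?sqr_ge0// divr_ge0.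
  rewrite big_split/= lerD//.
    by have := geo_half_sum (leq0n n); rewrite expr0 mulr1.
  rewrite -lee_fin fineK// -sumEFin.
  exact: (@nneseries_lim_ge _ (fun k => e k t) xpredT 0 n).
pose c t := if t \in G then limn (fun n => b n t) else 0.
have sc : smeas c.
  apply: (@smeas_lim _ _ c (fun n t => \1_G t *: b n t)).
    by move=> n; apply: smeasM => //; exact: measurable_indic.
  move=> t; rewrite /c indicE; case: ifPn => tG.
    rewrite (_ : (fun n => _) = (fun n => b n t)); first by apply: cvb; rewrite inE in tG.
    by apply/funext => n; rewrite scale1r.
  by rewrite (_ : (fun n => _) = fun=> 0); [exact: cvg_cst|apply/funext => n; rewrite scale0r].
have cG : aeT T (fun t => b n t @[n --> \oo] --> c t).
  apply: (@aeTS _ _ (fun t => h t \is a fin_num)); last exact: fh.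
  move=> t tI hf; have tG : G t.
    by split; [rewrite /I/= in_itv|move=> /= hoo; rewrite hoo in hf].
  by rewrite /c mem_set//; exact: cvb.
(* Almost everywhere |c - b n|^2 is the limit in m of |b (n + m) - b n|^2, so Fatou's lemma applies
   with the bound [Kbm]. *)
have Fn n : (\int[mu]_(t in I) (`|c t - b n t| ^+ 2)%:E <= ((2 * K * 2^-1 ^+ n) ^+ 2)%:E)%E.
  pose f m t : \bar R := (`|b (n + m)%N t - b n t| ^+ 2)%:E.
  apply: (@le_trans _ _ (\int[mu]_(t in I) limn_einf (f^~ t))%E).
    apply: ge0_ae_le_integral.
    - by move=> t _; rewrite lee_fin sqr_ge0.
    - move=> t _; rewrite limn_einf_lim; apply: lime_ge; first exact: is_cvg_einfs.
      apply: nearW => k; apply: le_ereal_inf_tmp => _ [p _ <-].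
      by rewrite lee_fin sqr_ge0.
    - apply: aeTS cG => t _ ct.
      have bn : b (n + m)%N t @[m --> \oo] --> c t.
        rewrite (_ : (fun m => _) = (fun m => b (m + n)%N t)).
          by rewrite (cvg_shiftn n (fun m => b m t) _).
        by apply/funext => m; rewrite addnC.
      have bn' : (`|b (n + m)%N t - b n t| @[m --> \oo] --> `|c t - b n t|).
        by apply: cvg_norm; apply: cvgB; [exact: bn|exact: cvg_cst].
      have ft : f^~ t @ \oo --> (`|c t - b n t| ^+ 2)%:E.
        by apply: cvg_EFin; [exact: nearW|exact: cvgM].
      by have [-> _] := cvg_limn_einf_sup ft.
  have mf m : measurable_fun I (f m).
    apply/measurable_EFinP; apply: measurable_funTS; apply: measurable_funX.
    by apply: smeas_norm; exact: smeasB.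
  have f0 m t : I t -> (0 <= f m t)%E by rewrite lee_fin sqr_ge0.
  apply: le_trans (fatou mu mI mf f0) _.
  rewrite limn_einf_lim; apply: lime_le; first exact: is_cvg_einfs.
  apply: nearW => m; apply: (@le_trans _ _ (\int[mu]_(t in I) f m t)%E).
    by apply: ereal_inf_lbound; exists m => /=.
  have [_ H] := ND (2 * K * 2^-1 ^+ n) _ _ (sb (n + m)%N) (Lb (n + m)%N) (sb n) (Lb n) (Kbm n m).
  exact: H.
have scb n : strongly_measurable T (fun t => c t - b n t).
  apply: strongly_measurableD; first by apply: (smeas_strongly sc); exact: aeT_all.
  by have [] := L2N (Lb n).
have Lcb n : L2 T (fun t => c t - b n t).
  by split => //; rewrite (le_lt_trans (Fn n))// ltry.
exists c.
  have [H _] := L2D (Lcb 0%N) (Lb 0%N).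
  by rewrite (_ : c = (fun t => c t - b 0%N t + b 0%N t))//; apply/funext => t; rewrite subrK.
move=> n; rewrite (@L2norm_ae _ _ _ _ (fun t => c t - b n t)); last first.
  by apply: aeTS (ab n) => t _ ->.
rewrite -(@ler_pXn2r _ 2)// ?nnegrE ?L2norm_ge0//; last first.
  by rewrite !mulr_ge0 ?exprn_ge0 ?invr_ge0.
rewrite L2norm_sqr -lee_fin fineK; first exact: Fn.
by rewrite ge0_fin_numE; [case: (Lcb n)|apply: integral_ge0 => t _; rewrite lee_fin sqr_ge0].
Qed.

End L2Complete.

Lemma complete_abs_complete (R : realType) (Z : completeNormedModType R) : abs_complete Z.
Proof.
move=> u cu; have c := @normed_cvg R Z (fun n => u n.+1 - u n) cu.
rewrite (_ : u = (fun n => u 0%N + series (fun n => u n.+1 - u n) n)).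
  by apply: is_cvgD => //; exact: is_cvg_cst.
apply/funext => n; rewrite seriesEnat/= telescope_sumr// addrC subrK //.
Qed.

Section DualSpace.
Context {R : realType} {V : normedModType R}.
Implicit Types (f g : dual V) (v : V).

Lemma dualDE f g v : (f + g) v = f v + g v :> R. Proof. by []. Qed.

Lemma dualZE (c : R) f v : (c *: f) v = c * f v :> R. Proof. by []. Qed.

Lemma dual0E v : (0 : dual V) v = 0 :> R. Proof. by []. Qed.

Lemma dualNE f v : (- f) v = - f v :> R.
Proof. by rewrite -scaleN1r dualZE mulN1r. Qed.

Lemma dualBE f g v : (f - g) v = f v - g v :> R.
Proof. by rewrite dualDE dualNE. Qed.

Lemma dual_sumE n (F : 'I_n -> dual V) v : (\sum_(i < n) F i) v = \sum_(i < n) F i v :> R.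
Proof.
by apply: (big_ind2 (fun (f : dual V) (x : R) => f v = x :> R)) => // f x g y <- <-.
Qed.

Lemma dual_le f v : `|f v : R| <= `|f| * `|v|.
Proof. exact: dual_norm_ge. Qed.

Lemma dual_norm_bound f (C : R) : 0 <= C -> (forall v, `|f v : R| <= C * `|v|) -> `|f| <= C.
Proof. exact: dual_norm_le. Qed.

Lemma dualP f g : (forall v, f v = g v :> R) -> f = g.
Proof. by move=> fg; apply: val_inj; apply/funext => v; exact: fg. Qed.

Lemma ev_continuous v : continuous (fun f : dual V => f v : R).
Proof.
move=> f; apply/(@cvgrPdist_le _ _ _ (nbhs f) (nbhs_filter f)) => e e0; near=> g.
have v1 : 0 < `|v| + 1 by rewrite ltr_wpDl.
rewrite -dualBE (le_trans (dual_le _ _))//.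
rewrite (@le_trans _ _ (`|f - g| * (`|v| + 1)))// ?ler_wpM2l ?lerDl//.
rewrite -ler_pdivlMr//; near: g.
by apply: cvgr_dist_le; [exact: cvg_id|rewrite divr_gt0].
Unshelve. all: by end_near. Qed.

Lemma make_dual (F : V -> R) (C : R) : (forall a u v, F (a *: u + v) = a * F u + F v) ->
  (forall v, `|F v| <= C * `|v|) -> exists f : dual V, forall v, f v = F v :> R.
Proof. by move=> lF hC; exists (Dual (bounded_in_dual lF hC)). Qed.

(** The pointwise limit F satisfies |F v - u n v| <= (S - s n) |v|, with S the total variation; this
    gives both its boundedness and the convergence in norm. *)
Lemma dual_abs_complete : abs_complete (dual V).
Proof.
move=> u /cvg_ex[/= S hS].
pose s := series (fun n => `|u n.+1 - u n|).
have nds : {homo s : n m / (n <= m)%N >-> n <= m}.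
  by apply/nondecreasing_seqP => n; rewrite /s !seriesEnat/= big_nat_recr//= lerDl.
have sS n : s n <= S.
  by rewrite -(cvg_lim _ hS)//; apply: nondecreasing_cvgn_le => //; apply/cvg_ex; exists S.
have us n m : (n <= m)%N -> `|u m - u n| <= s m - s n.
  move=> nm; rewrite -(subnKC nm); elim: (m - n)%N => [|k IH].
    by rewrite addn0 !subrr normr0.
  rewrite addnS (_ : s _.+1 = s (n + k)%N + `|u (n + k).+1 - u (n + k)%N|); last first.
    by rewrite /s !seriesEnat/= big_nat_recr.
  rewrite (_ : u _ - u n = (u (n + k).+1 - u (n + k)%N) + (u (n + k)%N - u n)).
    by rewrite (le_trans (ler_normD _ _))// [leRHS]addrAC [leRHS]addrC lerD2l.
  by rewrite addrA subrK.
have usS n m v : (n <= m)%N -> `|u m v - u n v : R| <= (S - s n) * `|v|.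
  move=> nm; rewrite -dualBE (le_trans (dual_le _ _))// ler_wpM2r//.
  by rewrite (le_trans (us _ _ nm))// lerD2r.
have cS : (S - s n) @[n --> \oo] --> (0 : R).
  by rewrite -(subrr S); apply: cvgB; [exact: cvg_cst|exact: hS].
have cv v : cvgn (fun n => u n v : R).
  apply: (@complete_abs_complete R).
  apply: (@series_le_cvg _ _ (fun n => `|u n.+1 - u n| * `|v|)) => //.
  - by move=> n; rewrite -dualBE dual_le.
  - rewrite (_ : series _ = (fun n => s n * `|v|)); last first.
      by apply/funext => n; rewrite /s !seriesEnat/= big_distrl.
    by apply: is_cvgM; [apply/cvg_ex; exists S|exact: is_cvg_cst].
pose F v : R := limn (fun n => u n v : R).
have FB n v : `|F v - u n v| <= (S - s n) * `|v|.
  have h1 : (`|u m v - u n v : R| @[m --> \oo] --> `|F v - u n v|).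
    by apply: cvg_norm; apply: cvgB; [exact: cv|exact: cvg_cst].
  apply: (ler_cvg_to h1 (cvg_cst ((S - s n) * `|v|))).
  by exists n => // m /= nm; exact: usS.
have [f hf] : exists f : dual V, forall v, f v = F v :> R.
  apply: (@make_dual _ (`|u 0%N| + (S - s 0%N))) => [a x y|v].
    apply: (cvg_unique _ (cv (a *: x + y))) => //.
    have -> : (fun n => u n (a *: x + y) : R) = (fun n => a * u n x + u n y).
      by apply/funext => n; exact: (dual_linear (u n)).
    by apply: cvgD; [apply: cvgM; [exact: cvg_cst|exact: cv]|exact: cv].
  rewrite (_ : F v = u 0%N v + (F v - u 0%N v)); last by rewrite addrC subrK.
  by rewrite (le_trans (ler_normD _ _))// mulrDl lerD// dual_le.
apply/cvg_ex; exists f; apply/cvgrPdist_le => e e0.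
have /cvgrPdist_le /(_ e e0) := cS; apply: filterS => n; rewrite sub0r normrN => h.
rewrite (le_trans _ h)// (le_trans _ (ler_norm _))//.
apply: dual_norm_bound; first by rewrite subr_ge0.
by move=> v; rewrite dualBE hf.
Qed.

End DualSpace.

(** * Bochner integrals in a dual space, tested on vectors *)

Section BochnerDual.
Context {R : realType} {V : normedModType R} (T : R).
Local Notation mu := (@lebesgue_measure R).
Let I := `[0%R, T]%classic.
Let mI : measurable (I : set (measurableTypeR R)). Proof. exact: measurable_itv. Qed.
Implicit Types (a : R -> dual V) (v : V).

Lemma measurable_ev a v : smeas a -> measurable_fun setT (fun t => a t v : R).
Proof. by move=> sa; exact: (measurable_smeas (@ev_continuous R V v) sa). Qed.

Lemma itv_Rintegral_sum n (f : 'I_n -> R -> R) :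
  (forall i, mu.-integrable I (EFin \o f i)) ->
  mu.-integrable I (EFin \o (fun t => \sum_(i < n) f i t)) /\
  \int[mu]_(t in I) (\sum_(i < n) f i t) = \sum_(i < n) \int[mu]_(t in I) f i t.
Proof.
elim: n f => [|n IH] f intf.
  have -> : (fun t => \sum_(i < 0) f i t) = cst 0 by apply/funext => t; rewrite big_ord0.
  rewrite big_ord0; split; first exact: itv_integrable_cst.
  by rewrite (Rintegral_cst _ mI 0) mul0r.
have -> : (fun t => \sum_(i < n.+1) f i t) =
    (fun t => f ord0 t + \sum_(i < n) f (lift ord0 i) t).
  by apply/funext => t; rewrite big_ord_recl.
have [i1 E] := IH (fun i => f (lift ord0 i)) (fun i => intf _).
split; first exact: itv_integrableD.
by rewrite itv_RintegralD// E big_ord_recl.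
Qed.

Lemma itv_indic_integrable (S : set R) (c : R) : measurable S ->
  mu.-integrable I (EFin \o (fun t => \1_S t * c)) /\
  \int[mu]_(t in I) (\1_S t * c) = fine (mu (S `&` I)) * c.
Proof.
move=> mS; have ic := itv_integrable_cst 0 T c.
have h : mu.-integrable I (EFin \o (fun t => \1_S t * cst c t)).
  apply: (@itv_integrable_boundedM _ `[0, T] (cst c) \1_S 1) => //.
  by move=> x _; rewrite indicE; case: (x \in S); rewrite ?normr1 ?normr0.
split=> //; rewrite (_ : \int[mu]_(t in I) _ = \int[mu]_(t in I) (c * \1_S t)); last first.
  by apply: eq_Rintegral => t _; rewrite mulrC.
rewrite itv_RintegralZ.
  by rewrite mulrC; congr (_ * _); rewrite /Rintegral integral_indic// setIC.
have := @itv_integrable_boundedM _ `[0, T] (cst 1) \1_S 1.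
rewrite (_ : (fun x => _ * _) = \1_S); last by apply/funext => t; rewrite mulr1.
apply => //; last exact: itv_integrable_cst.
by move=> x _; rewrite indicE; case: (x \in S); rewrite ?normr1 ?normr0.
Qed.

Lemma sf_int_ev (s : step_fun (dual V)) v :
  mu.-integrable I (EFin \o (fun t => sf_fun s t v : R)) /\
  sf_int T s v = \int[mu]_(t in I) (sf_fun s t v : R) :> R.
Proof.
have E t : sf_fun s t v = \sum_(i < sf_card s) (\1_(sf_set i) t * (@sf_vec _ _ s i v : R)) :> R.
  by rewrite dual_sumE.
have [i1 E1] := itv_Rintegral_sum (fun i => (itv_indic_integrable (@sf_vec _ _ s i v : R) (@sf_setP _ _ s i)).1).
have -> : (fun t => sf_fun s t v : R) = (fun t => \sum_(i < sf_card s) (\1_(sf_set i) t * (@sf_vec _ _ s i v : R))).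
  by apply/funext => t; exact: E.
split=> //; rewrite (_ : \int[mu]_(t in I) _ = \int[mu]_(t in I) (\sum_(i < sf_card s) (\1_(sf_set i) t * (@sf_vec _ _ s i v : R)))).
  rewrite E1 dual_sumE; apply: eq_bigr => i _.
  by rewrite (itv_indic_integrable _ (@sf_setP _ _ s i)).2.
by [].
Qed.

Lemma integrable_ev a v : smeas a -> mu.-integrable I (EFin \o (fun t => `|a t|)) ->
  mu.-integrable I (EFin \o (fun t => a t v : R)).
Proof.
move=> sa ia; have := itv_integrableZ `|v| ia; apply: le_integrable => //.
  by apply/measurable_EFinP; apply: measurable_funTS; exact: measurable_ev.
move=> t _ /=; rewrite lee_fin [leRHS]ger0_norm ?mulr_ge0// mulrC.
exact: dual_le.
Qed.

Lemma Rintegral_ev_le a v : smeas a -> mu.-integrable I (EFin \o (fun t => `|a t|)) ->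
  `|\int[mu]_(t in I) (a t v : R)| <= (\int[mu]_(t in I) `|a t|) * `|v|.
Proof.
move=> sa ia; have iv := integrable_ev v sa ia.
rewrite mulrC -itv_RintegralZ//.
apply: le_trans (le_normr_Rintegral mI iv) _.
apply: le_Rintegral => //.
- exact: integrable_abse iv.
- exact: itv_integrableZ.
- by move=> t _; rewrite mulrC; exact: dual_le.
Qed.

Lemma Rintegral_ae (f g : R -> R) : aeT T (fun t => f t = g t) ->
  \int[mu]_(t in I) f t = \int[mu]_(t in I) g t.
Proof.
by move=> fg; congr fine; apply: ae_eq_integral_nomeas; apply: aeTS fg => t _ ->.
Qed.

Lemma smeas_sf_fun (Z : normedModType R) (s : step_fun Z) : smeas (sf_fun s).
Proof. by apply: smeas_step; exact: is_step_fun. Qed.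

(** Evaluation at v commutes with the integral of step functions and is a bounded functional, so the
    identity survives the limit. *)
Lemma bochner_elim a (J : dual V) v : bochner T a J ->
  J v = \int[mu]_(t in I) (a t v : R) :> R.
Proof.
move=> [sa [s [hs hJ]]]; have [b [sb ab _]] := strongly_smeas sa.
rewrite (@Rintegral_ae _ (fun t => b t v : R)); last by apply: aeTS ab => t _ ->.
have E n : (\int[mu]_(t in I) `|a t - sf_fun (s n) t|%:E = \int[mu]_(t in I) `|b t - sf_fun (s n) t|%:E)%E.
  by apply: ae_eq_integral_nomeas; apply: aeTS ab => t _ ->.
pose e n := (\int[mu]_(t in I) `|b t - sf_fun (s n) t|%:E)%E.
have he : e n @[n --> \oo] --> 0%E.
  have -> : e = (fun n => \int[mu]_(t in I) `|a t - sf_fun (s n) t|%:E)%E.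
    by apply/funext => n; rewrite E.
  exact: hs.
have sd n : smeas (fun t => b t - sf_fun (s n) t) by apply: smeasB => //; exact: smeas_sf_fun.
have fine_e : (fine (e n) @[n --> \oo] --> (0 : R)) by exact: fine_cvg he.
have close : \forall n \near \oo, `|\int[mu]_(t in I) (b t v : R) - sf_int T (s n) v| <= fine (e n) * `|v|.
  have /fine_cvgP[] := he; move=> + _; apply: filterS => n en.
  have id : mu.-integrable I (EFin \o (fun t => `|b t - sf_fun (s n) t|)).
    apply/integrableP; split.
      by apply/measurable_EFinP; apply: measurable_funTS; exact: smeas_norm.
    under eq_integral do rewrite /= normr_id.
    by rewrite -ge0_fin_numE//; apply: integral_ge0.
  have [is_ Es] := sf_int_ev (s n) v.
  have idv := integrable_ev v (sd n) id.
  rewrite Es.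
  have ib : mu.-integrable I (EFin \o (fun t => b t v : R)).
    have := itv_integrableD idv is_; congr (_.-integrable _ (_ \o _)).
    by apply/funext => t; rewrite dualBE subrK.
  rewrite -itv_RintegralB//.
  rewrite (_ : \int[mu]_(t in I) _ = \int[mu]_(t in I) ((b t - sf_fun (s n) t) v : R)).
    exact: Rintegral_ev_le.
  by apply: eq_Rintegral => t _; rewrite dualBE.
have c1 : (sf_int T (s n) v : R) @[n --> \oo] --> (J v : R).
  exact: (cvg_comp _ _ hJ (@ev_continuous R V v J)).
apply: (cvg_unique _ c1) => //.
apply/cvgrPdist_le => eps eps0.
have v1 : 0 < `|v| + 1 by rewrite ltr_wpDl.
have : \forall n \near \oo, fine (e n) <= eps / (`|v| + 1).
  have /cvgrPdist_le /(_ _ (divr_gt0 eps0 v1)) := fine_e.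
  by apply: filterS => n; rewrite sub0r normrN => /(le_trans (ler_norm _)).
move: close; apply: filterS2 => n h1 h2; rewrite (le_trans h1)//.
rewrite (@le_trans _ _ (eps / (`|v| + 1) * `|v|))// ?ler_wpM2r//.
by rewrite -mulrA ler_piMr ?(ltW eps0)// ler_pdivrMl// mulr1 lerDl.
Qed.

Lemma integrable_norm (Z : normedModType R) (a b : R -> Z) : smeas b ->
  aeT T (fun t => a t = b t) -> (\int[mu]_(t in I) `|a t|%:E < +oo)%E ->
  mu.-integrable I (EFin \o (fun t => `|b t|)).
Proof.
move=> sb ab la; apply/integrableP; split.
  by apply/measurable_EFinP; apply: measurable_funTS; exact: smeas_norm.
under eq_integral do rewrite /= normr_id.
have <- : (\int[mu]_(t in I) `|a t|%:E = \int[mu]_(t in I) `|b t|%:E)%E.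
  by apply: ae_eq_integral_nomeas; apply: aeTS ab => t _ ->.
exact: la.
Qed.

(** The candidate J is already given by its values, so it remains to approximate a in L^1 by step
    functions; their integrals then converge to J in the operator norm by testing on each v. *)
Lemma bochner_intro a (J : dual V) : strongly_measurable T a ->
  (\int[mu]_(t in I) `|a t|%:E < +oo)%E ->
  (forall v, J v = \int[mu]_(t in I) (a t v : R) :> R) -> bochner T a J.
Proof.
move=> sa la hJ; split => //; have [b [sb ab _]] := strongly_smeas sa.
have ib := integrable_norm sb ab la.
have [s hs] := sb.
(* Keeping the step functions only where their norm is at most 2 |b| yields the dominating function
   3 |b|. *)
pose E n := [set t | `|sf_fun (s n) t| <= 2 * `|b t|].
have mE n : measurable (E n).
  have m1 : measurable_fun setT (fun t => `|sf_fun (s n) t|) by apply: smeas_norm; exact: smeas_sf_fun.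
  have m2 : measurable_fun setT (fun t => 2 * `|b t|) by apply: measurable_funM => //; exact: smeas_norm.
  have := measurable_fun_ler m1 m2 measurableT (Y := [set true]).
  rewrite setTI (_ : _ @^-1` _ = E n); first by apply.
  by apply/seteqP; split => t /=.
have /choice[r hr] := fun n => is_step_indic (mE n) (is_step_fun (s n)).
have rb n t : `|b t - sf_fun (r n) t| <= 3 * `|b t|.
  rewrite -hr indicE; have [|_] := boolP (t \in E n).
    rewrite inE /E/= scale1r => h; rewrite (le_trans (ler_normB _ _))//.
    by move: h; move: `|_| `|_| => x y; lra.
  by rewrite scale0r subr0 ler_peMl// ler1n.
(* At a zero of b the truncated functions vanish; elsewhere |b| < 2 |b|, and truncation stops acting
   for large n. *)
have rc t : sf_fun (r n) t @[n --> \oo] --> b t.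
  have [b0|b0] := eqVneq (b t) 0.
    rewrite (_ : (fun n => _) = fun=> b t); first exact: cvg_cst.
    apply/funext => n; apply/esym/eqP; rewrite -subr_eq0 -normr_le0.
    by rewrite (le_trans (rb n t))// b0 normr0 mulr0.
  apply: cvg_trans (hs t); apply: near_eq_cvg.
  have nb : `|b t| < 2 * `|b t| by rewrite ltr_pMl ?normr_gt0// ltr1n.
  have : \forall n \near \oo, `|sf_fun (s n) t| <= 2 * `|b t|.
    exact: (cvgr_le _ (cvg_norm (hs t)) _ nb).
  by apply: filterS => n h; rewrite -hr indicE mem_set ?scale1r.
have sd n : smeas (fun t => b t - sf_fun (r n) t) by apply: smeasB => //; exact: smeas_sf_fun.
have id n : mu.-integrable I (EFin \o (fun t => `|b t - sf_fun (r n) t|)).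
  have := itv_integrableZ 3 ib; apply: le_integrable => //.
    by apply/measurable_EFinP; apply: measurable_funTS; exact: smeas_norm.
  by move=> t _ /=; rewrite lee_fin normr_id [leRHS]ger0_norm ?mulr_ge0.
have DC : (\int[mu]_(t in I) `|b t - sf_fun (r n) t|%:E @[n --> \oo] --> 0)%E.
  have h1 : {ae mu, forall t, I t -> `|b t - sf_fun (r n) t|%:E @[n --> \oo] --> 0%E}.
    apply: aeW => t _; apply: cvg_EFin; first exact: nearW.
    rewrite -(@normr0 _ (dual V)) -(subrr (b t)).
    by apply: cvg_norm; apply: cvgB; [exact: cvg_cst|exact: rc].
  have h2 : {ae mu, forall t n, I t -> (`| `|b t - sf_fun (r n) t|%:E | <= (3 * `|b t|)%:E)%E}.
    by apply: aeW => t n _ /=; rewrite lee_fin normr_id.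
  have [_ _] := @dominated_convergence _ _ _ mu I mI
    (fun n t => `|b t - sf_fun (r n) t|%:E) (cst 0%E) (fun t => (3 * `|b t|)%:E)
    (fun n => measurable_int mu (id n)) (measurable_cst _) h1 (itv_integrableZ 3 ib) h2.
  by rewrite integral0.
exists r; split.
  have -> : (fun n => \int[mu]_(t in I) `|a t - sf_fun (r n) t|%:E)%E =
      (fun n => \int[mu]_(t in I) `|b t - sf_fun (r n) t|%:E)%E.
    by apply/funext => n; apply: ae_eq_integral_nomeas; apply: aeTS ab => t _ ->.
  exact: DC.
have fine_DC : (fine (\int[mu]_(t in I) `|b t - sf_fun (r n) t|%:E)%E @[n --> \oo] --> (0 : R)).
  exact: fine_cvg DC.
apply/cvgrPdist_le => e e0.
have /cvgrPdist_le /(_ _ e0) := fine_DC; apply: filterS => n.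
rewrite sub0r normrN => h; rewrite (le_trans _ (le_trans (ler_norm _) h))//.
apply: dual_norm_bound.
  by rewrite fine_ge0//; apply: integral_ge0 => t _; rewrite lee_fin.
move=> v; rewrite dualBE hJ (@Rintegral_ae _ (fun t => b t v : R)); last by apply: aeTS ab => t _ ->.
have [is_ ->] := sf_int_ev (r n) v.
rewrite -itv_RintegralB//; last exact: integrable_ev.
rewrite (_ : \int[mu]_(t in I) _ = \int[mu]_(t in I) ((b t - sf_fun (r n) t) v : R)).
  exact: Rintegral_ev_le.
by apply: eq_Rintegral => t _; rewrite dualBE.
Qed.

Lemma dual_integral a : strongly_measurable T a -> (\int[mu]_(t in I) `|a t|%:E < +oo)%E ->
  exists J : dual V, forall v, J v = \int[mu]_(t in I) (a t v : R) :> R.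
Proof.
move=> sa la; have [b [sb ab _]] := strongly_smeas sa.
have ib := integrable_norm sb ab la.
have [J hJ] : exists J : dual V, forall v, J v = \int[mu]_(t in I) (b t v : R) :> R.
  apply: (@make_dual _ _ _ (\int[mu]_(t in I) `|b t|)) => [c u v|v]; last exact: Rintegral_ev_le.
  rewrite -itv_RintegralZ -?itv_RintegralD//; try exact: integrable_ev.
    by apply: eq_Rintegral => t _; exact: (dual_linear (b t)).
  by apply: itv_integrableZ; exact: integrable_ev.
by exists J => v; rewrite hJ; apply: Rintegral_ae; apply: aeTS ab => t _ ->.
Qed.

End BochnerDual.

(** * Weak derivatives with values in a dual space *)

Section WeakDerivative.
Context {R : realType} {V : normedModType R} (T : R).
Hypothesis T0 : 0 < T.
Local Notation mu := (@lebesgue_measure R).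
Let I := `[0%R, T]%classic.
Implicit Types b db : R -> dual V.

Lemma L2_L1 (Z : normedModType R) (a : R -> Z) : L2 T a ->
  (\int[mu]_(t in I) `|a t|%:E < +oo)%E.
Proof.
move=> La; have [b [sb Lb ab _]] := L2_rep La.
have := sqi_integrable (sqi_norm sb Lb) => /integrableP[_].
have -> : (\int[mu]_(t in I) `|a t|%:E = \int[mu]_(t in I) `|b t|%:E)%E.
  by apply: ae_eq_integral_nomeas; apply: aeTS ab => t _ ->.
by under eq_integral do rewrite /= normr_id.
Qed.

Lemma L2_test (Z : normedModType R) (a : R -> Z) (phi : R -> R) : continuous phi -> L2 T a ->
  L2 T (fun t => phi t *: a t).
Proof.
move=> cphi La; have [M HM] := continuous_itv_bounded (ltW T0) cphi.
have M0 : 0 <= M by apply: le_trans (HM 0 _) => //; rewrite lexx ltW.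
by have [] := L2M (continuous_measurable_fun cphi) HM M0 La.
Qed.

Lemma weak_derivative_ev b db eta v : weak_derivative T b db -> test_fun T eta ->
  \int[mu]_(t in I) (derive1 eta t * (b t v : R)) = - \int[mu]_(t in I) (eta t * (db t v : R)).
Proof.
move=> wd te; have [J [h1 h2]] := wd _ te.
have := bochner_elim v h1; have := bochner_elim v h2.
rewrite dualNE => e2 e1; apply/eqP; rewrite eq_sym eqr_oppLR; apply/eqP.
by rewrite -[LHS]e2 -[X in _ = - X]e1.
Qed.

(** Both Bochner integrals J and K exist anyway; to see that J + K = 0 it is enough to test on a
    separating set of vectors, such as the eigenvectors. *)
Lemma weak_derivative_intro (D : set V) b db :
  (forall f : dual V, (forall v, D v -> f v = 0 :> R) -> f = 0) ->
  L2 T b -> L2 T db ->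
  (forall eta v, test_fun T eta -> D v ->
    \int[mu]_(t in I) (derive1 eta t * (b t v : R)) = - \int[mu]_(t in I) (eta t * (db t v : R))) ->
  weak_derivative T b db.
Proof.
move=> hD Lb Ldb H eta te.
have ce : continuous (derive1 eta) by case: te.
have Leb := L2_test ce Lb; have Ledb := L2_test (test_fun_continuous te) Ldb.
have [J hJ] := dual_integral (proj1 Leb) (L2_L1 Leb).
have [K hK] := dual_integral (proj1 Ledb) (L2_L1 Ledb).
have JK : J + K = 0.
  apply: hD => v Dv; rewrite dualDE hJ hK.
  by apply/eqP; rewrite addr_eq0; apply/eqP; exact: H.
exists J; split; first exact: bochner_intro (proj1 Leb) (L2_L1 Leb) hJ.
apply: bochner_intro (proj1 Ledb) (L2_L1 Ledb) _ => v.
by rewrite -[in LHS](addrK K J) JK sub0r opprK hK.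
Qed.

End WeakDerivative.

(** * The scale of spaces D(A^s) *)

Section HilbertScale.
Context {R : realType} {H : hilbertType R} (A : eigensystem H).
Local Notation lam := (eigval A).
Local Notation phi := (eigvec A).

Lemma lam_gt0 k : 0 < lam k. Proof. exact: eigval_gt0. Qed.

Lemma lams_gt0 (s : R) k : 0 < lam k `^ s.
Proof. by rewrite powR_gt0// lam_gt0. Qed.

Lemma coef_sum (c : nat -> R) n k : ip (\sum_(0 <= j < n) c j *: phi j) (phi k) = if (k < n)%N then c k else 0.
Proof.
rewrite ip_suml; case: ltnP => kn.
  rewrite (bigD1_seq k)/= ?iota_uniq ?mem_index_iota//.
  rewrite ipZl eigvec_orthonormal eqxx mulr1 big1 ?addr0// => i ik.
  by rewrite ipZl eigvec_orthonormal (negbTE ik) mulr0.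
rewrite big_nat_cond big1// => i /andP[/andP[_ ik] _].
rewrite ipZl eigvec_orthonormal; case: eqP => [E|_]; last by rewrite mulr0.
by move: ik; rewrite E ltnNge kn.
Qed.

Lemma coef_ext (u v : H) : (forall k, ip u (phi k) = ip v (phi k)) -> u = v.
Proof.
move=> uv; apply: (cvg_unique _ (eigvec_basis A u)); first exact: norm_hausdorff.
rewrite (_ : series _ = series (fun k => ip v (phi k) *: phi k)).
  exact: eigvec_basis.
by congr series; apply/funext => k; rewrite uv.
Qed.

Lemma synthesis (c : nat -> R) : cvgn (series (fun k => c k ^+ 2)) ->
  exists u : H, forall k, ip u (phi k) = c k.
Proof.
move=> cc; have h := @cvg_series_eigvec _ _ A _ cc.
exists (limn (series (fun k => c k *: phi k))) => k.
have h2 := cvg_comp _ _ h (@ip_continuousl R H (phi k) _).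
apply: (@cvg_unique R _ _ _ _ _ h2); first exact: norm_hausdorff.
apply: cvg_near_cst; near=> n; rewrite /= seriesEnat/= coef_sum ifT//.
by near: n; exact: nbhs_infty_gt.
Unshelve. all: by end_near. Qed.

Lemma trunc_sum_le (e : nat -> R) n m : (forall k, 0 <= e k) ->
  \sum_(0 <= k < m) (if (k < n)%N then e k else 0) <= \sum_(0 <= k < n) e k.
Proof.
move=> e0; have -> : \sum_(0 <= k < m) (if (k < n)%N then e k else 0) = \sum_(0 <= k < minn m n) e k.
  elim: m => [|m IH]; first by rewrite min0n !big_geq.
  rewrite big_nat_recr//= IH; case: ltnP => mn.
    by rewrite (minn_idPl mn) big_nat_recr.
  by rewrite addr0 (minn_idPr (leqW mn)).
rewrite [leRHS](big_cat_nat (leq0n _) (geq_minr m n))/= lerDl.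
by apply: sumr_ge0 => k _; exact: e0.
Qed.

Section Dom.
Variable s : R.
Implicit Types (u v : dom A s).

Definition wco u k := lam k `^ s * ip (val u) (phi k).

Lemma dom_parseval u : series (fun k => wco u k ^+ 2) @ \oo --> `|u| ^+ 2.
Proof.
have h : `|series (fun k => wco u k *: phi k) n| @[n --> \oo] --> `|u|.
  exact: cvg_norm (in_dom_cvg (dom_valP u)).
apply: cvg_trans (cvgM h h); apply: near_eq_cvg; apply: nearW => n /=.
by rewrite !seriesEnat/= -expr2 norm_sum_eigvec.
Qed.

Lemma dom_bessel u n : \sum_(0 <= k < n) wco u k ^+ 2 <= `|u| ^+ 2.
Proof.
have h := @dom_parseval u; rewrite -(cvg_lim _ h)//.
have -> : \sum_(0 <= k < n) wco u k ^+ 2 = series (fun k => wco u k ^+ 2) n by rewrite seriesEnat.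
apply: nondecreasing_cvgn_le; last by apply/cvg_ex; exists (`|u| ^+ 2).
by apply/nondecreasing_seqP => m; rewrite !seriesEnat/= big_nat_recr//= lerDl sqr_ge0.
Qed.

Lemma dom_norm_sqr_le u (C : R) : (forall n, \sum_(0 <= k < n) wco u k ^+ 2 <= C) -> `|u| ^+ 2 <= C.
Proof.
move=> h; apply: (ler_cvg_to (@dom_parseval u) (cvg_cst C)).
by apply: nearW => n; rewrite seriesEnat; exact: h.
Qed.

Lemma dom_ext u v : (forall k, ip (val u) (phi k) = ip (val v) (phi k)) -> u = v.
Proof. by move=> uv; apply: val_inj; exact: coef_ext. Qed.

Lemma dom_coefB u v k : ip (val (u - v)) (phi k) = ip (val u) (phi k) - ip (val v) (phi k).
Proof. by rewrite raddfB/= ipBl. Qed.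

Lemma dom_coefZ (c : R) u k : ip (val (c *: u)) (phi k) = c * ip (val u) (phi k).
Proof. by rewrite linearZ/= ipZl. Qed.

Lemma dom_coef0 k : ip (val (0 : dom A s)) (phi k) = 0.
Proof. by rewrite raddf0 ip0l. Qed.

Lemma dom_coef_le u k : `|ip (val u) (phi k)| <= (lam k `^ s)^-1 * `|u|.
Proof.
rewrite mulrC ler_pdivlMr ?lams_gt0// -(@ler_pXn2r _ 2)// ?nnegrE ?mulr_ge0 ?powR_ge0//.
apply: le_trans (dom_bessel u k.+1).
rewrite big_nat_recr//= mulrC /wco !exprMn real_normK ?num_real// lerDr.
by apply: sumr_ge0 => i _; exact: sqr_ge0.
Qed.

Hypothesis s0 : 0 <= s.

Lemma dom_synthesis (c : nat -> R) : cvgn (series (fun k => (lam k `^ s * c k) ^+ 2)) ->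
  exists u, forall k, ip (val u) (phi k) = c k.
Proof.
move=> cc; have [u hu] : exists u : H, forall k, ip u (phi k) = c k.
  apply: synthesis.
  apply: (@series_le_cvg _ _ (fun k => (lam 0%N `^ s) ^- 2 * (lam k `^ s * c k) ^+ 2)).
  - by move=> k; exact: sqr_ge0.
  - by move=> k; rewrite mulr_ge0 ?invr_ge0 ?sqr_ge0.
  - move=> k; rewrite mulrC ler_pdivlMr ?exprn_gt0 ?lams_gt0// mulrC exprMn ler_wpM2r ?sqr_ge0//.
    rewrite ler_pXn2r ?nnegrE ?powR_ge0//.
    rewrite ge0_ler_powR ?nnegrE ?(ltW (lam_gt0 _))//.
    exact: eigval_nd.
  - exact: is_cvg_seriesZ.
have ud : u \in in_dom A s.
  apply/in_domP; rewrite (_ : (fun k => _) = (fun k => (lam k `^ s * c k) ^+ 2))//.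
  by apply/funext => k; rewrite in_domE hu.
by exists (Dom ud).
Qed.

Lemma ph_subproof k : exists u : dom A s, forall j, ip (val u) (phi j) = (j == k)%:R.
Proof.
apply: dom_synthesis.
rewrite (_ : series _ = (fun n => if (k < n)%N then (lam k `^ s) ^+ 2 else 0)).
  apply/cvg_ex; exists ((lam k `^ s) ^+ 2); apply: cvg_near_cst; near=> n.
  by rewrite ifT//; near: n; exact: nbhs_infty_gt.
apply/funext => n; rewrite seriesEnat/=; case: ltnP => kn.
  rewrite (bigD1_seq k)/= ?iota_uniq ?mem_index_iota// eqxx mulr1 big1 ?addr0// => i ik.
  by rewrite (negbTE ik) mulr0 expr0n.
rewrite big_nat_cond big1// => i /andP[/andP[_ ik] _].
case: eqP => [E|_]; last by rewrite mulr0 expr0n.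
by move: ik; rewrite E ltnNge kn.
Unshelve. all: by end_near. Qed.

(** The eigenvector phi_k as an element of D(A^s), produced by synthesis from its coefficients;
    [val_ph] identifies it. *)
Definition ph k : dom A s := projT1 (cid (ph_subproof k)).

Lemma phE k j : ip (val (ph k)) (phi j) = (j == k)%:R.
Proof. by rewrite /ph; case: cid. Qed.

Lemma val_ph k : val (ph k) = phi k.
Proof. by apply: coef_ext => j; rewrite phE eigvec_orthonormal eq_sym. Qed.

Lemma coef_psum (c : nat -> R) n k :
  ip (val (\sum_(0 <= j < n) c j *: ph j)) (phi k) = if (k < n)%N then c k else 0.
Proof.
rewrite raddf_sum -coef_sum; congr ip; apply: eq_bigr => j _.
by rewrite -[LHS]/(val (c j *: ph j)) linearZ/= val_ph.
Qed.

(** By Parseval the squared norm of the remainder is |v|^2 minus a partial sum of the series for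
    |v|^2. *)
Lemma dom_series v : (\sum_(0 <= k < n) ip (val v) (phi k) *: ph k) @[n --> \oo] --> v.
Proof.
pose S n : dom A s := \sum_(0 <= k < n) ip (val v) (phi k) *: ph k.
have E n : `|v - S n| ^+ 2 = `|v| ^+ 2 - \sum_(0 <= k < n) wco v k ^+ 2.
  apply: (cvg_unique _ (@dom_parseval (v - S n))); first exact: norm_hausdorff.
  have h : (series (fun k => wco v k ^+ 2) m - \sum_(0 <= k < n) wco v k ^+ 2) @[m --> \oo] -->
      `|v| ^+ 2 - \sum_(0 <= k < n) wco v k ^+ 2.
    by apply: cvgB; [exact: dom_parseval|exact: cvg_cst].
  apply: cvg_trans h; apply: near_eq_cvg; near=> m.
  have nm : (n <= m)%N by near: m; exact: nbhs_infty_ge.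
  rewrite !seriesEnat/= (big_cat_nat (leq0n n) nm)/= addrAC subrr add0r.
  rewrite [RHS](big_cat_nat (leq0n n) nm)/= [X in _ = X + _]big_nat_cond.
  rewrite [X in _ = X + _]big1 ?add0r.
    apply: eq_big_nat => k /andP[nk _]; rewrite /wco dom_coefB coef_psum ifF ?subr0//.
    by rewrite ltnNge nk.
  move=> k /andP[/andP[_ kn] _]; rewrite /wco dom_coefB coef_psum kn subrr mulr0 expr0n//.
have c0 : `|v - S n| ^+ 2 @[n --> \oo] --> (0 : R).
  rewrite (_ : (fun n => _) = (fun n => `|v| ^+ 2 - series (fun k => wco v k ^+ 2) n)).
    by rewrite -(subrr (`|v| ^+ 2)); apply: cvgB; [exact: cvg_cst|exact: dom_parseval].
  by apply/funext => n; rewrite E seriesEnat.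
apply/cvgrPdist_le => e e0.
have /cvgrPdist_le /(_ _ (exprn_gt0 2 e0)) := c0; apply: filterS => n.
rewrite sub0r normrN ger0_norm ?sqr_ge0// ler_pXn2r ?nnegrE ?(ltW e0)//.
Unshelve. all: by end_near. Qed.

Implicit Types F G : dual (dom A s).

Lemma dual_sum_ph F (c : nat -> R) n :
  F (\sum_(0 <= k < n) c k *: ph k) = \sum_(0 <= k < n) c k * (F (ph k) : R) :> R.
Proof.
have F0 : F 0 = 0 :> R by have := dualZ F 0 0; rewrite scaler0 mul0r.
have FD u v : F (u + v) = F u + F v :> R.
  by have := dual_linear F 1 u v; rewrite !scale1r.
rewrite !big_mkord; elim/big_ind2 : _ => [//|u x w y <- <-|k _]; first exact: FD.
exact: dualZ.
Qed.

Lemma dual_series F v :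
  (\sum_(0 <= k < n) ip (val v) (phi k) * (F (ph k) : R)) @[n --> \oo] --> (F v : R).
Proof.
have := cvg_comp _ _ (@dom_series v) (@dual_continuous _ _ F v).
apply: cvg_trans; apply: near_eq_cvg; apply: nearW => n /=.
exact: dual_sum_ph.
Qed.

Lemma dual_coef_ext F G : (forall k, F (ph k) = G (ph k) :> R) -> F = G.
Proof.
move=> FG; apply: dualP => v.
apply: (cvg_unique _ (@dual_series F v)); first exact: norm_hausdorff.
rewrite (_ : (fun n => _) = (fun n => \sum_(0 <= k < n) ip (val v) (phi k) * (G (ph k) : R))).
  exact: dual_series.
by apply/funext => n; apply: eq_bigr => k _; rewrite FG.
Qed.

(** F is tested on its own truncated Riesz representative v, for which F v = Q and |v|^2 <= Q; hence
    Q^2 <= |F|^2 Q. *)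
Lemma dual_bessel F n : \sum_(0 <= k < n) ((lam k `^ s)^-1 * (F (ph k) : R)) ^+ 2 <= `|F| ^+ 2.
Proof.
set Q := \sum_(0 <= k < n) _.
have Q0 : 0 <= Q by apply: sumr_ge0 => k _; exact: sqr_ge0.
pose v : dom A s := \sum_(0 <= k < n) ((lam k `^ s) ^- 2 * (F (ph k) : R)) *: ph k.
have FvQ : F v = Q :> R.
  by rewrite dual_sum_ph; apply: eq_bigr => k _; rewrite exprMn exprVn -mulrA -expr2.
have vQ : `|v| ^+ 2 <= Q.
  apply: dom_norm_sqr_le => m; rewrite /Q.
  have E k : wco v k ^+ 2 = if (k < n)%N then ((lam k `^ s)^-1 * (F (ph k) : R)) ^+ 2 else 0.
    rewrite /wco coef_psum; case: ifP => _; last by rewrite mulr0 expr0n.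
    by congr (_ ^+ 2); move: (lam k `^ s) (lams_gt0 s k) => p p0; field; rewrite gt_eqF.
  rewrite (eq_bigr _ (fun k _ => E k)); apply: trunc_sum_le => k; exact: sqr_ge0.
have := dual_le F v; rewrite FvQ (ger0_norm Q0) => h.
have [->|Qn0] := eqVneq Q 0; first exact: sqr_ge0.
have Qp : 0 < Q by rewrite lt_def Qn0.
have : Q ^+ 2 <= `|F| ^+ 2 * Q.
  apply: (@le_trans _ _ (`|F| ^+ 2 * `|v| ^+ 2)); last by rewrite ler_wpM2l ?sqr_ge0.
  by rewrite -exprMn ler_pXn2r ?nnegrE ?mulr_ge0.
by rewrite expr2 ler_pM2r.
Qed.

End Dom.

End HilbertScale.

Section HilbertScale2.
Context {R : realType} {H : hilbertType R} (A : eigensystem H).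
Local Notation lam := (eigval A).
Local Notation phi := (eigvec A).

(** Cauchy-Schwarz in H for two combinations of the orthonormal eigenvectors. *)
Lemma sum_CauchySchwarz (a b : nat -> R) n :
  (\sum_(0 <= k < n) a k * b k) ^+ 2 <=
  (\sum_(0 <= k < n) a k ^+ 2) * (\sum_(0 <= k < n) b k ^+ 2).
Proof.
have := ip_CauchySchwarz (\sum_(0 <= k < n) a k *: phi k) (\sum_(0 <= k < n) b k *: phi k).
rewrite -(@ler_pXn2r _ 2)// ?nnegrE ?mulr_ge0// exprMn !norm_sum_eigvec.
rewrite real_normK ?num_real// ip_suml; congr (_ ^+ 2 <= _).
apply: eq_big_nat => k /andP[_ kn].
by rewrite ipZl ip_sym coef_sum kn.
Qed.

Lemma pivot_ph s (s0 : 0 <= s) h k : pivot A s h (ph A s0 k) = ip h (phi k) :> R.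
Proof. by rewrite pivotE// val_ph. Qed.

(** Converse of [dual_bessel]: in the series for F v the weights lambda_k^s and lambda_k^(-s) are
    distributed over the two factors before Cauchy-Schwarz. *)
Lemma dual_coef_bound s (s0 : 0 <= s) (F : dual (dom A s)) (C : R) : 0 <= C ->
  (forall n, \sum_(0 <= k < n) ((lam k `^ s)^-1 * (F (ph A s0 k) : R)) ^+ 2 <= C ^+ 2) ->
  `|F| <= C.
Proof.
move=> C0 hC; apply: dual_norm_bound => // v.
have h := cvg_norm (@dual_series _ _ A s s0 F v).
apply: (ler_cvg_to (h _) (cvg_cst (C * `|v|))); apply: nearW => n.
rewrite -(@ler_pXn2r _ 2)// ?nnegrE ?mulr_ge0// real_normK ?num_real// exprMn mulrC.
rewrite (_ : \sum_(0 <= k < n) _ =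
  \sum_(0 <= k < n) (wco v k) * ((lam k `^ s)^-1 * (F (ph A s0 k) : R))).
  apply: le_trans (sum_CauchySchwarz _ _ _) _.
  apply: ler_pM; try by apply: sumr_ge0 => k _; exact: sqr_ge0.
    exact: dom_bessel.
  exact: hC.
apply: eq_bigr => k _; rewrite /wco; move: (lam k `^ s) (lams_gt0 A s k) => p p0.
by field; rewrite gt_eqF.
Qed.

(** An inequality between the multipliers lambda_k^s transfers to the norms. With b = 0 it yields
    embeddings, with both terms interpolation. *)
Lemma dom_norm_compare s s1 s2 (w : dom A s) (u : dom A s1) (v : dom A s2) (a b : R) :
  0 <= a -> 0 <= b -> val u = val w -> val v = val w ->
  (forall k, (lam k `^ s) ^+ 2 <= a * (lam k `^ s1) ^+ 2 + b * (lam k `^ s2) ^+ 2) ->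
  `|w| ^+ 2 <= a * `|u| ^+ 2 + b * `|v| ^+ 2.
Proof.
move=> a0 b0 uw vw h; apply: dom_norm_sqr_le => n.
apply: (@le_trans _ _ (a * \sum_(0 <= k < n) wco u k ^+ 2 + b * \sum_(0 <= k < n) wco v k ^+ 2)).
  rewrite !big_distrr -big_split/=; apply: ler_sum => k _.
  have eu : wco u k = lam k `^ s1 * ip (val w) (phi k) by rewrite -uw.
  have ev : wco v k = lam k `^ s2 * ip (val w) (phi k) by rewrite -vw.
  rewrite eu ev /wco; move: (ip _ _) (h k) => x hk.
  rewrite [X in X <= _]exprMn [X in a * X]exprMn [X in b * X]exprMn.
  rewrite (mulrA a) (mulrA b) -mulrDl.
  by rewrite ler_wpM2r ?sqr_ge0.
by rewrite lerD// ler_wpM2l// dom_bessel.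
Qed.

Lemma dom_le s s' : s <= s' -> exists2 C : R, 0 <= C &
  forall u : dom A s', exists2 w : dom A s, val w = val u & `|w| <= C * `|u|.
Proof.
move=> ss'; pose C := (lam 0%N `^ (s' - s))^-1.
have C0 : 0 <= C by rewrite invr_ge0 powR_ge0.
have hC k : lam k `^ s <= C * lam k `^ s'.
  rewrite mulrC ler_pdivlMr ?lams_gt0// mulrC.
  rewrite (_ : lam k `^ s' = lam k `^ (s' - s) * lam k `^ s); last first.
    by rewrite -powRD ?subrK// (gt_eqF (lam_gt0 A k)) implybT.
  rewrite ler_wpM2r ?powR_ge0// ge0_ler_powR ?nnegrE ?subr_ge0 ?(ltW (lam_gt0 _ _))//.
  exact: eigval_nd.
exists C => // u.
have ud : val u \in in_dom A s.
  have /in_domP cu := dom_valP u; apply/in_domP.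
  apply: (@series_le_cvg _ _ (fun k => C ^+ 2 * (lam k `^ (2 * s') * ip (val u) (phi k) ^+ 2))).
  - by move=> k; rewrite in_domE; exact: sqr_ge0.
  - by move=> k; rewrite in_domE; apply: mulr_ge0; exact: sqr_ge0.
  - move=> k; rewrite (@in_domE _ _ A s) (@in_domE _ _ A s') [X in X <= _]exprMn [X in _ <= _ * X]exprMn (mulrA (C ^+ 2)).
    rewrite -[C ^+ 2 * _]exprMn ler_wpM2r ?sqr_ge0//.
    by rewrite ler_pXn2r ?nnegrE ?mulr_ge0 ?powR_ge0.
  - exact: is_cvg_seriesZ.
exists (Dom ud) => //.
rewrite -(@ler_pXn2r _ 2)// ?nnegrE ?mulr_ge0// exprMn.
have := @dom_norm_compare _ _ _ (Dom ud) u u (C ^+ 2) 0 (sqr_ge0 _) (lexx _) erefl erefl.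
rewrite !mul0r !addr0; apply => k; rewrite mul0r addr0 -exprMn.
by rewrite ler_pXn2r ?nnegrE ?mulr_ge0 ?powR_ge0.
Qed.

Lemma Apow_isometry s (u v : dom A s) :
  `|Apow A s (val u) - Apow A s (val v)| = `|u - v|.
Proof.
rewrite dom_normE (_ : val (u - v) = (-1) *: val v + val u).
  by rewrite Apow_linear ?dom_valP// scaleN1r addrC.
by rewrite raddfB/= scaleN1r addrC.
Qed.

(** [Apow] is an isometry into the complete space H, and it is onto: the preimage has coefficients
    divided by lambda_k^s. *)
Lemma dom_abs_complete s : 0 <= s -> abs_complete (dom A s).
Proof.
move=> s0 u cu.
pose y n := Apow A s (val (u n)).
have yB n m : `|y n - y m| = `|u n - u m| by exact: Apow_isometry.
have cy : cvgn y.
  apply: complete_abs_complete; rewrite (_ : series _ = series (fun n => `|u n.+1 - u n|))//.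
  by congr series; apply/funext => n; rewrite yB.
have ycoef n k : ip (y n) (phi k) = lam k `^ s * ip (val (u n)) (phi k).
  by rewrite ip_Apow// dom_valP.
pose L := limn y.
have [v hv] : exists v : dom A s, forall k, ip (val v) (phi k) = (lam k `^ s)^-1 * ip L (phi k).
  apply: dom_synthesis => //.
  rewrite (_ : (fun k => _) = (fun k => ip L (phi k) ^+ 2)); last first.
    by apply/funext => k; rewrite mulVKf// gt_eqF// lams_gt0.
  have h : (`|series (fun k => ip L (phi k) *: phi k) n| @[n --> \oo] --> `|L|).
    exact: cvg_norm (eigvec_basis A L).
  apply/cvg_ex; exists (`|L| * `|L|); apply: cvg_trans (cvgM h h).
  by apply: near_eq_cvg; apply: nearW => n /=; rewrite !seriesEnat/= -expr2 norm_sum_eigvec.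
have ALv : Apow A s (val v) = L.
  by apply: (@coef_ext _ _ A) => k; rewrite ip_Apow ?dom_valP// hv mulVKf// gt_eqF// lams_gt0.
apply/cvg_ex; exists v; apply/cvgrPdist_le => e e0.
have /cvgrPdist_le /(_ _ e0) : y @ \oo --> L by exact: cy.
by apply: filterS => n; rewrite -ALv Apow_isometry.
Qed.

End HilbertScale2.

(** * Bounded inverse of an injective operator with closed range *)

Section BoundedInverse.
Context {R : realType} {W : normedModType R} {Y : completeNormedModType R}.
Variable i : {linear W -> Y}.
Hypotheses (Wc : abs_complete W) (ci : continuous i) (inji : injective i)
  (clo : closed (range i)).

Lemma cvg_of_half (Z : normedModType R) (u : nat -> Z) (K : R) : abs_complete Z -> 0 <= K ->
  (forall n, `|u n.+1 - u n| <= K * 2^-1 ^+ n) ->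
  exists2 l : Z, u @ \oo --> l & forall n, `|l - u n| <= 2 * K * 2^-1 ^+ n.
Proof.
move=> Zc K0 hu.
have cu : cvgn u.
  apply: Zc; apply: (@series_le_cvg _ _ (fun n => K * 2^-1 ^+ n)) => //.
  - by move=> n; rewrite mulr_ge0 ?exprn_ge0 ?invr_ge0.
  - apply: nondecreasing_is_cvgn.
      apply/nondecreasing_seqP => n; rewrite !seriesEnat/= big_nat_recr//= lerDl.
      by rewrite mulr_ge0 ?exprn_ge0 ?invr_ge0.
    exists (K * 2) => _ [n _ <-]; rewrite seriesEnat/= -big_distrr ler_wpM2l//.
    by have := @geo_half_sum R 0 n (leq0n n); rewrite expr0 mulr1.
exists (limn u) => // n.
have um m : (n <= m)%N -> `|u m - u n| <= K * \sum_(n <= j < m) 2^-1 ^+ j.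
  move=> nm; rewrite -(subnKC nm); elim: (m - n)%N => [|k IH].
    by rewrite addn0 subrr normr0 big_geq// mulr0.
  rewrite addnS big_nat_recr/= ?leq_addr// mulrDr [leRHS]addrC.
  rewrite (_ : u _ - u n = (u (n + k).+1 - u (n + k)%N) + (u (n + k)%N - u n)).
    by rewrite (le_trans (ler_normD _ _))// lerD.
  by rewrite addrA subrK.
have h : `|u m - u n| @[m --> \oo] --> `|limn u - u n|.
  by apply: cvg_norm; apply: cvgB; [exact: cu|exact: cvg_cst].
apply: (ler_cvg_to h (cvg_cst (2 * K * 2^-1 ^+ n))); exists n => // m /= nm.
rewrite (le_trans (um _ nm))// (mulrC 2) -mulrA ler_wpM2l//.
exact: geo_half_sum.
Qed.

(* If no ball of the range were approximated by the images of a fixed ball, nested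
   balls avoiding the images of the balls of radius n would meet in a point of the
   closed range. *)
Lemma baire_range : exists n x e, 0 < e /\ forall x', `|i x' - i x| < e ->
  forall d, 0 < d -> exists2 w, `|w| <= n%:R & `|i x' - i w| < d.
Proof.
apply: contrapT => N.
(* The factor 2 leaves a margin: the limit point is within [q.2] of the new centre, hence still at
   distance at least [q.2] from the excluded images. *)
have S (n : nat) (p : W * R) : 0 < p.2 -> exists q : W * R, [/\ `|i q.1 - i p.1| < p.2 / 2,
    0 < q.2, q.2 <= p.2 / 2 & forall w, `|w| <= n%:R -> 2 * q.2 <= `|i q.1 - i w|].
  case: p => x e /= e0; have e2 : 0 < e / 2 by rewrite divr_gt0.
  apply: contrapT => N2; apply: N; exists n, x, (e / 2); split => // x' xx' d d0.
  apply: contrapT => N3; apply: N2; exists (x', Num.min (d / 2) (e / 2)); split => //=.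
  - by rewrite lt_min divr_gt0.
  - by rewrite ge_min lexx orbT.
  - move=> w wn; rewrite leNgt; apply/negP => h; apply: N3; exists w => //.
    apply: (lt_le_trans h); rewrite -ler_pdivlMl// mulrC.
    by rewrite ge_min lexx.
have /choice[g hg] : forall np : nat * (W * R), exists q : W * R, 0 < np.2.2 -> [/\ `|i q.1 - i np.2.1| < np.2.2 / 2,
    0 < q.2, q.2 <= np.2.2 / 2 & forall w, `|w| <= np.1%:R -> 2 * q.2 <= `|i q.1 - i w|].
  case=> n p /=; have [p0|p0] := boolP (0 < p.2); last by exists p.
  by have [q hq] := S n p p0; exists q.
pose fix s n := if n is m.+1 then g (m, s m) else (0, 1).
have s0 n : 0 < (s n).2 by elim: n => [|n IH] //=; have [] := hg (n, s n) IH.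
have hs n := hg (n, s n) (s0 n).
have half m n : (s (m + n)%N).2 <= (s m).2 * 2^-1 ^+ n.
  elim: n => [|n IH]; first by rewrite addn0 mulr1.
  rewrite addnS exprSr mulrA; have [_ _ h _] := hs (m + n)%N.
  by rewrite (le_trans h)// ler_wpM2r ?invr_ge0.
have step m n : `|i (s (m + n).+1).1 - i (s (m + n)%N).1| <= (s m).2 / 2 * 2^-1 ^+ n.
  have [h _ _ _] := hs (m + n)%N; rewrite (le_trans (ltW h))//.
  by rewrite [leRHS]mulrAC ler_wpM2r ?invr_ge0//; exact: half.
have [y cy _] := @cvg_of_half Y (fun n => i (s n).1) _ (@complete_abs_complete R Y)
  (divr_ge0 (ltW (s0 0%N)) (ler0n R 2)) (step 0%N).
have [w _ wy] : range i y.
  apply: (@closed_cvg _ _ \oo _ (fun n => i (s n).1) (range i) clo _ y cy).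
  by apply: nearW => n; exists (s n).1.
have step' m n : `|i (s (m + n.+1)%N).1 - i (s (m + n)%N).1| <= (s m).2 / 2 * 2^-1 ^+ n.
  by rewrite addnS.
have near_y m : `|y - i (s m).1| <= (s m).2.
  have [z cz hz] := @cvg_of_half Y (fun n => i (s (m + n)%N).1) _ (@complete_abs_complete R Y)
    (divr_ge0 (ltW (s0 m)) (ler0n R 2)) (step' m).
  have cz' : i (s (n + m)%N).1 @[n --> \oo] --> z.
    by rewrite (_ : (fun n => i (s (n + m)%N).1) = (fun n => i (s (m + n)%N).1))//; apply/funext => n; rewrite addnC.
  have -> : y = z.
    move: cz'; rewrite (cvg_shiftn m (fun n => i (s n).1) _) => cz'.
    by apply: (cvg_unique _ cy cz'); exact: norm_hausdorff.
  by have := hz 0%N; rewrite addn0 expr0 mulr1 mulrC divfK.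
pose n := (Num.truncn `|w|).+1.
have wn : `|w| <= n%:R by rewrite ltW// truncnS_gt.
have [_ _ _ /(_ w wn) h] := hs n.
have h2 := near_y n.+1; rewrite -wy distrC in h2.
have := s0 n.+1; move: (le_trans h h2) => /=; lra.
Qed.

(* The successive approximation step of the open mapping theorem. *)
Lemma bounded_inverse : exists2 C, 0 <= C & forall w, `|w| <= C * `|i w|.
Proof.
have [n [x0 [e [e0 hx0]]]] := baire_range.
(* Subtracting approximations of i (x0 + x) and i x0 moves the ball to the origin and doubles the
   radius n. *)
have B x d : `|i x| < e -> 0 < d -> exists2 w, `|w| <= 2 * n%:R & `|i x - i w| < d.
  move=> xe d0; have d2 : 0 < d / 2 by rewrite divr_gt0.
  have [|w1 w1n h1] := hx0 (x0 + x) _ (d / 2) d2; first by rewrite linearD addrC addKr.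
  have [|w2 w2n h2] := hx0 x0 _ (d / 2) d2; first by rewrite subrr normr0.
  exists (w1 - w2); first by rewrite (le_trans (ler_normB _ _))// mulr_natl mulr2n lerD.
  rewrite linearB (_ : _ - _ = (i (x0 + x) - i w1) - (i x0 - i w2)).
    by rewrite (le_lt_trans (ler_normB _ _))// (splitr d) ltrD.
  rewrite linearD (addrC (i x0)) !opprB -2![RHS]addrA; congr (_ + _).
  by rewrite [RHS]addrCA (addrCA (i x0)) subrr addr0 addrC.
(* Rescaling i x to norm e / 2 costs the factor 2 |i x| / e, which multiplies the bound 2 n from
   [B]. *)
pose M := 4 * n%:R / e.
have M0 : 0 <= M by rewrite divr_ge0 ?(ltW e0)// mulr_ge0.
have C x : exists w, `|w| <= M * `|i x| /\ `|i x - i w| <= `|i x| / 2.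
  have [->|xn0] := eqVneq (i x) 0.
    by exists 0; rewrite !normr0 linear0 subrr normr0 mul0r mulr0 lexx.
  have r0 : 0 < `|i x| by rewrite normr_gt0.
  pose c := e / (2 * `|i x|).
  have c0 : 0 < c by rewrite divr_gt0// mulr_gt0.
  have cx : `|i (c *: x)| < e.
    rewrite linearZ normrZ gtr0_norm// /c invfM mulrA mulfVK ?gt_eqF//.
    by rewrite ltr_pdivrMr// mulr_natr mulr2n ltrDl.
  have cd : 0 < c * (`|i x| / 2) by rewrite mulr_gt0// divr_gt0.
  have [w wn hw] := B (c *: x) _ cx cd.
  exists (c^-1 *: w); split.
    rewrite normrZ gtr0_norm ?invr_gt0// /c invf_div.
    rewrite (le_trans (ler_wpM2l _ wn)) ?divr_ge0 ?mulr_ge0 ?(ltW e0)//.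
    by rewrite le_eqVlt; apply/orP; left; apply/eqP; rewrite /M; ring.
  rewrite -(ler_pM2l c0) -{1}(gtr0_norm c0) -normrZ scalerBr -!linearZ/=.
  by rewrite scalerK ?gt_eqF// ltW.
have [f hf] := choice C.
exists (2 * M); first by rewrite mulr_ge0.
move=> x; pose fix r k : W := if k is m.+1 then r m - f (r m) else x.
have rk k : `|i (r k)| <= `|i x| * 2^-1 ^+ k.
  elim: k => [|k IH]; first by rewrite mulr1.
  rewrite /= linearB; have [_ h] := hf (r k); rewrite (le_trans h)//.
  by rewrite exprSr mulrA ler_wpM2r ?invr_ge0.
have step k : `|(x - r k.+1) - (x - r k)| <= M * `|i x| * 2^-1 ^+ k.
  rewrite (_ : _ - _ = f (r k)); last first.
    by rewrite /= opprB addrC opprB addrA subrK addrC subrK.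
  have [h _] := hf (r k); rewrite (le_trans h)// -mulrA ler_wpM2l//.
have [s cs hs] := cvg_of_half Wc (mulr_ge0 M0 (normr_ge0 _)) step.
have is_ : (i (x - r k) : Y) @[k --> \oo] --> (i s : Y).
  by apply: (@continuous_cvg _ _ _ _ _ (fun k => x - r k) i s); [exact: ci|exact: cs].
have ix : (i (x - r k) : Y) @[k --> \oo] --> (i x : Y).
  apply/cvgrPdist_le => d d0.
  have h : (`|i x| * 2^-1 ^+ k @[k --> \oo] --> (0 : R)).
    rewrite -(mulr0 `|i x|); apply: cvgM; first exact: cvg_cst.
    by apply: cvg_expr; rewrite ger0_norm ?invr_ge0// invf_lt1 ?ltr1n.
  have /cvgrPdist_le /(_ _ d0) := h; apply: filterS => k.
  rewrite sub0r normrN => hk; rewrite linearB opprB addrC subrK.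
  by rewrite (le_trans (rk k))// (le_trans (ler_norm _)).
have sx : s = x.
  by apply: inji; apply: (cvg_unique _ is_ ix); exact: norm_hausdorff.
by have := hs 0%N; rewrite /= subrr subr0 expr0 mulr1 mulrA sx.
Qed.

End BoundedInverse.

(** * Mild solutions of the linear equation *)

Section Mild.
Context {R : realType} {H : hilbertType R} (A : eigensystem H) (T : R).
Hypothesis T0 : 0 < T.
Local Notation mu := (@lebesgue_measure R).
Local Notation lam := (eigval A).
Local Notation phi := (eigvec A).
Let I := `[0%R, T]%classic.
Let mI : measurable (I : set (measurableTypeR R)). Proof. exact: measurable_itv. Qed.

Section DomL2.
Variables (s : R) (s0 : 0 <= s).

Lemma wco_continuous k : continuous (fun u : dom A s => wco u k).
Proof.
move=> u; apply/(@cvgrPdist_le _ _ _ (nbhs u) (nbhs_filter u)) => e e0; near=> v.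
have -> : wco u k - wco v k = wco (u - v) k by rewrite /wco dom_coefB mulrBr.
rewrite /wco normrM (ger0_norm (powR_ge0 _ _)).
apply: (@le_trans _ _ `|u - v|).
  by rewrite -ler_pdivlMl ?lams_gt0// dom_coef_le.
by near: v; apply: cvgr_dist_le; [exact: cvg_id|].
Unshelve. all: by end_near. Qed.

Lemma measurable_wco (z : R -> dom A s) k : smeas z -> measurable_fun setT (fun t => wco (z t) k).
Proof. by move=> sz; exact: (measurable_smeas (@wco_continuous k) sz). Qed.

(* Monotone convergence in Parseval's identity. *)
Lemma dom_L2_bound (z : R -> dom A s) (B : R) : smeas z ->
  (forall k, mu.-integrable I (EFin \o (fun t => wco (z t) k ^+ 2))) ->
  (forall n, \sum_(0 <= k < n) \int[mu]_(t in I) (wco (z t) k ^+ 2) <= B) ->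
  L2 T z /\ L2norm T z ^+ 2 <= B.
Proof.
move=> sz iz hB.
have E t : (`|z t| ^+ 2)%:E = (\sum_(0 <= k <oo) (wco (z t) k ^+ 2)%:E)%E.
  apply/esym/cvg_lim => //.
  rewrite (_ : (fun n => _) = (fun n => (series (fun k => wco (z t) k ^+ 2) n)%:E)).
    by apply: cvg_EFin; [exact: nearW|exact: dom_parseval].
  by apply/funext => n; rewrite seriesEnat/= sumEFin.
have h : (\int[mu]_(t in I) (`|z t| ^+ 2)%:E <= B%:E)%E.
  rewrite (@eq_integral _ _ _ mu I (fun t => \sum_(0 <= k <oo) (wco (z t) k ^+ 2)%:E)%E); last by move=> t _; rewrite E.
  have mw k : measurable_fun I (fun t => (wco (z t) k ^+ 2)%:E).
    by apply: measurable_int (iz k).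
  rewrite (integral_nneseries mu mI mw); last by move=> k t _; rewrite lee_fin sqr_ge0.
  apply: lime_le.
    by apply: is_cvg_nneseries => k _ _; apply: integral_ge0 => t _; rewrite lee_fin sqr_ge0.
  apply: nearW => n; rewrite (eq_bigr (fun k => (\int[mu]_(t in I) (wco (z t) k ^+ 2))%:E)).
    by rewrite sumEFin lee_fin.
  by move=> k _; rewrite /Rintegral fineK//; exact: integrable_fin_num (iz k).
split.
  split; first by apply: (smeas_strongly sz); exact: aeT_all.
  by rewrite (le_lt_trans h)// ltry.
rewrite L2norm_sqr -lee_fin fineK//.
rewrite ge0_fin_numE; first by rewrite (le_lt_trans h)// ltry.
by apply: integral_ge0 => t _; rewrite lee_fin sqr_ge0.
Qed.

(** The integrated bound makes the sum of squares finite almost everywhere, and synthesis is done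
    pointwise there. Measurability comes from the partial sums, not from the choice of the
    values. *)
Lemma dom_fun_synthesis (c : nat -> R -> R) (B : R) :
  (forall k, measurable_fun setT (c k)) ->
  (forall k, mu.-integrable I (EFin \o (fun t => (lam k `^ s * c k t) ^+ 2))) ->
  (forall n, \sum_(0 <= k < n) \int[mu]_(t in I) ((lam k `^ s * c k t) ^+ 2) <= B) ->
  exists2 z : R -> dom A s, smeas z &
    aeT T (fun t => forall k, ip (val (z t)) (phi k) = c k t).
Proof.
move=> mc ic hS.
pose e k t : \bar R := ((lam k `^ s * c k t) ^+ 2)%:E.
have me k : measurable_fun setT (e k).
  by apply/measurable_EFinP; apply: measurable_funX; exact: measurable_funM.
have e0 k t : (0 <= e k t)%E by rewrite lee_fin sqr_ge0.
pose h t : \bar R := (\sum_(0 <= k <oo) e k t)%E.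
have mh : measurable_fun setT h by apply: ge0_emeasurable_sum => //.
have ih : mu.-integrable I h.
  apply/integrableP; split; first exact: measurable_funTS.
  rewrite (@eq_integral _ _ _ mu I h); last first.
    by move=> t _; rewrite gee0_abs//; apply: nneseries_ge0.
  rewrite (integral_nneseries mu mI (fun n => measurable_funTS (me n)) (fun n t _ => e0 n t)).
  apply: (@le_lt_trans _ _ (B)%:E); last by rewrite ltry.
  apply: lime_le.
    by apply: is_cvg_nneseries => k _ _; apply: integral_ge0 => t _; exact: e0.
  apply: nearW => n; rewrite (eq_bigr (fun k => (\int[mu]_(t in I) ((lam k `^ s * c k t) ^+ 2))%:E)).
    by rewrite sumEFin lee_fin.
  by move=> k _; rewrite /Rintegral fineK//; exact: integrable_fin_num (ic k).
have fh := integrable_ae mI ih.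
pose G := ~` (h @^-1` [set +oo%E]).
have mG : measurable G.
  apply: measurableC; rewrite -[X in measurable X]setTI.
  by apply: mh => //; exact: emeasurable_set1.
have cv t : exists u : dom A s, G t -> forall k, ip (val u) (phi k) = c k t.
  have [tG|tG] := pselect (G t); last by exists 0 => /tG.
  suff [u hu] : exists u : dom A s, forall k, ip (val u) (phi k) = c k t by exists u.
  apply: dom_synthesis => //.
  have h0 : (0 <= h t)%E by apply: nneseries_ge0.
  have hf : h t \is a fin_num by rewrite ge0_fin_numE// lt_neqAle leey andbT; apply/eqP.
  apply: nondecreasing_is_cvgn.
    by apply/nondecreasing_seqP => n; rewrite !seriesEnat/= big_nat_recr//= lerDl sqr_ge0.
  exists (fine (h t)) => _ [n _ <-]; rewrite seriesEnat/= -lee_fin fineK// -sumEFin.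
  exact: (@nneseries_lim_ge _ (fun k => e k t) xpredT 0 n).
have [u hu] := choice cv.
exists (fun t => \1_G t *: u t).
  apply: (@smeas_lim _ _ _ (fun n t => \sum_(k < n) (\1_G t * c k t) *: ph A s0 k)).
    move=> n; apply: smeas_sum => k; apply: smeas_scale_cst; exact: measurable_funM.
  move=> t; rewrite indicE; have [tG|tG] := boolP (t \in G); last first.
    rewrite scale0r (_ : (fun n => _) = fun=> 0); first exact: cvg_cst.
    by apply/funext => n; rewrite big1// => k _; rewrite mul0r scale0r.
  rewrite scale1r; apply: cvg_trans (@dom_series _ _ A s s0 (u t)).
  apply: near_eq_cvg; apply: nearW => n; rewrite big_mkord; apply: eq_bigr => k _.
  by rewrite mul1r hu//; rewrite inE in tG.
apply: (@aeTS _ _ (fun t => h t \is a fin_num)); last exact: fh.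
move=> t _ hf k; have tG : G t by move=> /= hoo; rewrite hoo in hf.
by rewrite indicE mem_set// scale1r hu.
Qed.

End DomL2.

Lemma volt_ae (l : R) (g g' : R -> R) t : 0 <= t <= T -> aeT T (fun s => g s = g' s) ->
  volt l g t = volt l g' t.
Proof.
move=> /andP[t0 tT] gg; congr (_ * fine _); apply: ae_eq_integral_nomeas.
suff : aeT t (fun s => (expR (l * s) * g s)%:E = (expR (l * s) * g' s)%:E) by [].
case: gg => N [mN N0 hN]; exists N; split => // s /= hs; apply: hN => /= h.
apply: hs => st; congr (_ * _)%:E; apply: h; move: st; rewrite !in_itv/= => /andP[-> st].
exact: le_trans st tT.
Qed.

Lemma integrable_aeT (f g : R -> R) : mu.-integrable I (EFin \o f) -> measurable_fun setT g ->
  aeT T (fun t => f t = g t) -> mu.-integrable I (EFin \o g).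
Proof.
move=> /integrableP[_ fi] mg fg; apply/integrableP; split.
  by apply/measurable_EFinP; exact: measurable_funTS.
rewrite (_ : (\int[mu]_(t in I) _)%E = \int[mu]_(t in I) `|(EFin \o f) t|)%E//.
by apply: ae_eq_integral_nomeas; apply: aeTS fg => t _ /= ->.
Qed.

Lemma continuous_itv_integrable (f : R -> R) : {within `[0, T], continuous f} ->
  mu.-integrable I (EFin \o f).
Proof. by move=> cf; apply: continuous_compact_integrable; first exact: segment_compact. Qed.

Lemma continuous_itv_sqi (f : R -> R) : {within `[0, T], continuous f} ->
  mu.-integrable I (EFin \o (fun t => f t ^+ 2)).
Proof.
move=> cf; apply: continuous_itv_integrable => x.
by apply: (@continuousM R (subspace I) f f); exact: cf.
Qed.

Lemma mild_continuous (l a : R) (g : R -> R) : mu.-integrable I (EFin \o g) ->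
  {within `[0, T], continuous (fun t => expR (- l * t) * a + volt l g t)}.
Proof.
move=> ig x.
apply: (@continuousD R R (subspace I) (fun t => expR (- l * t) * a) (volt l g)).
  apply: (@continuousM R (subspace I) (fun t => expR (- l * t)) (fun=> a)).
    exact/continuous_subspaceT/continuous_expR_scale.
  exact: cst_continuous.
by apply: volt_continuous => //; exact: ltW.
Qed.

(** The powers of l are the right ones: multiplied by the squared weight of U, l^-1 leaves the
    squared weight of W and l^-2 that of V^*. *)
Lemma mild_coef_bound (l a : R) (g : R -> R) : 0 < l -> sqi T g ->
  \int[mu]_(t in I) ((expR (- l * t) * a + volt l g t) ^+ 2) <=
  l^-1 * a ^+ 2 + 2 * l ^- 2 * \int[mu]_(t in I) (g t ^+ 2).
Proof.
move=> l0 sg; have ig := sqi_integrable sg.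
have cz := @mild_continuous l a g ig.
have cv : {within I, continuous (volt l g)} by apply: volt_continuous => //; exact: ltW.
have iz := continuous_itv_sqi cz; have iv := continuous_itv_sqi cv.
have cE : {within I, continuous (fun t => expR (- (2 * l) * t))}.
  exact/continuous_subspaceT/continuous_expR_scale.
have iE := continuous_itv_integrable cE.
apply: (@le_trans _ _ (\int[mu]_(t in I) ((2 * a ^+ 2) * expR (- (2 * l) * t) + 2 * volt l g t ^+ 2))).
  apply: le_Rintegral => //; first by apply: itv_integrableD; exact: itv_integrableZ.
  move=> t _; rewrite (_ : expR (- (2 * l) * t) = expR (- l * t) ^+ 2); last first.
    by rewrite expr2 -expRD; congr expR; ring.
  by rewrite -subr_ge0 (_ : _ - _ = (expR (- l * t) * a - volt l g t) ^+ 2) ?sqr_ge0//; ring.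
rewrite itv_RintegralD; [|exact: itv_integrableZ|exact: itv_integrableZ].
rewrite !itv_RintegralZ// Rintegral_expR ?(ltW T0)//; last first.
  by rewrite oppr_eq0 mulf_neq0// gt_eqF.
apply: lerD; last first.
  by rewrite -mulrA ler_wpM2l// volt_L2// ltW.
rewrite mulr0 expR0; set x := expR _.
have -> : 2 * a ^+ 2 * ((x - 1) / - (2 * l)) = (l^-1 * a ^+ 2) * (1 - x) by field; exact: lt0r_neq0.
apply: ler_piMr; first by apply: mulr_ge0; [rewrite invr_ge0 ltW|exact: sqr_ge0].
by rewrite lerBlDr lerDl expR_ge0.
Qed.

Lemma linear_pack (U V : lmodType R) (f : U -> V) : linear f ->
  exists g : {linear U -> V}, forall x, g x = f x.
Proof.
move=> lf; pose m := GRing.isLinear.Build R U V _ f lf.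
by exists (HB.pack f m : {linear U -> V}).
Qed.

Section Sigma.
Variables (sigma : R) (hsigma : 0 <= sigma <= 1).

Lemma spV_ge0 : 0 <= (1 - sigma) / 2.
Proof. by move: hsigma => /andP[? ?]; rewrite divr_ge0// subr_ge0. Qed.

Lemma spU_ge0 : 0 <= (1 + sigma) / 2.
Proof. by move: hsigma => /andP[? ?]; rewrite divr_ge0// addr_ge0. Qed.

Lemma spW_ge0 : 0 <= sigma / 2.
Proof. by move: hsigma => /andP[? ?]; rewrite divr_ge0. Qed.

Local Notation pV := (ph A spV_ge0).
(** The weight of the k-th coefficient in V^*. By [lamU] and [lamW] the weight in U is
    [lam k * wt k], and the weight in W is the geometric mean of the two. *)
Let wt k := (lam k `^ ((1 - sigma) / 2))^-1.

Let wt_gt0 k : 0 < wt k. Proof. by rewrite invr_gt0 lams_gt0. Qed.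

Lemma lamU k : lam k `^ ((1 + sigma) / 2) = lam k * wt k.
Proof.
apply: (@mulIf _ (lam k `^ ((1 - sigma) / 2))); first by rewrite gt_eqF ?lams_gt0.
rewrite divfK ?gt_eqF ?lams_gt0// -powRD; last by rewrite (gt_eqF (lam_gt0 A k)) implybT.
by rewrite (_ : (1 + sigma) / 2 + _ = 1) ?powRr1 ?(ltW (lam_gt0 A k))//; field.
Qed.

Lemma lamW k : (lam k `^ (sigma / 2)) ^+ 2 = lam k * wt k ^+ 2.
Proof.
have p0 : lam k `^ ((1 - sigma) / 2) != 0 by rewrite gt_eqF ?lams_gt0.
apply: (@mulIf _ ((lam k `^ ((1 - sigma) / 2)) ^+ 2)); first by rewrite expf_neq0.
rewrite /wt exprVn divfK ?expf_neq0// -!powR_mulrn ?powR_ge0// -!powRrM -powRD.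
  by rewrite (_ : sigma / 2 * _ + _ = 1) ?powRr1 ?(ltW (lam_gt0 A k))//; field.
by rewrite (gt_eqF (lam_gt0 A k)) implybT.
Qed.

Local Notation mco F w0 k :=
  (fun t => expR (- lam k * t) * ip (val w0) (phi k) + volt (lam k) (fun s => F s (pV k) : R) t).

(** The k-th coefficient of F is the value [F s (pV k)] of a functional, since F takes values in V^*
    only. All coefficients are prescribed outside one common null set, so they determine z almost
    everywhere. *)
Definition mild (F : R -> spV' A sigma) (w0 : spW A sigma) (z : R -> spU A sigma) : Prop :=
  L2 T z /\ aeT T (fun t => forall k, ip (val (z t)) (phi k) = mco F w0 k t).

Lemma coef_sqi (F : R -> spV' A sigma) k : smeas F -> L2 T F -> sqi T (fun t => F t (pV k) : R).
Proof.
move=> sF LF; have mF := measurable_ev (pV k) sF; split => //.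
have [_ iF] := sqi_norm sF LF.
have := itv_integrableZ (`|pV k| ^+ 2) iF; apply: le_integrable => //.
  by apply/measurable_EFinP; apply: measurable_funTS; exact: measurable_funX mF.
move=> t _ /=; rewrite lee_fin ger0_norm ?sqr_ge0// ger0_norm ?mulr_ge0 ?sqr_ge0//.
have := dual_le (F t) (pV k); move: (F t (pV k) : R) => x hx.
by rewrite mulrC -exprMn -(real_normK (num_real x)) ler_pXn2r ?nnegrE ?mulr_ge0.
Qed.

Lemma coef_bessel (F : R -> spV' A sigma) n : smeas F -> L2 T F ->
  \sum_(0 <= k < n) wt k ^+ 2 * \int[mu]_(t in I) ((F t (pV k) : R) ^+ 2) <= L2norm T F ^+ 2.
Proof.
move=> sF LF; have [_ iF] := sqi_norm sF LF.
have ik k := itv_integrableZ (wt k ^+ 2) (coef_sqi k sF LF).2.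
rewrite L2norm_sqr big_mkord.
have [i1 E] := itv_Rintegral_sum (fun k : 'I_n => ik k).
rewrite (eq_bigr (fun k : 'I_n => \int[mu]_(t in I) (wt k ^+ 2 * (F t (pV k) : R) ^+ 2))); last first.
  by move=> k _; rewrite itv_RintegralZ//; exact: (coef_sqi k sF LF).2.
rewrite -E; apply: le_Rintegral => //.
move=> t _; have := @dual_bessel _ _ A _ spV_ge0 (F t) n.
by rewrite big_mkord; under eq_bigr do rewrite exprMn.
Qed.

Lemma mild_ae (F F' : R -> spV' A sigma) w0 z z' : aeT T (fun t => F t = F' t) ->
  aeT T (fun t => z t = z' t) -> mild F w0 z -> mild F' w0 z'.
Proof.
move=> FF zz [Lz hz]; split; first exact: L2_ae zz Lz.
apply: aeT2 zz hz => t tI zt h k; rewrite -zt h; congr (_ + _).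
by apply: volt_ae => //; apply: aeTS FF => s _ ->.
Qed.

(** Stated for the coefficient formulas, before a function with these coefficients is available: it
    serves both to construct z and to bound it. *)
Lemma mco_energy (F : R -> spV' A sigma) (w0 : spW A sigma) : smeas F -> L2 T F ->
  [/\ forall k, {within `[0, T], continuous (mco F w0 k)},
    forall k, mu.-integrable I (EFin \o (fun t => (lam k `^ ((1 + sigma) / 2) * mco F w0 k t) ^+ 2)) &
    forall n, \sum_(0 <= k < n) \int[mu]_(t in I) ((lam k `^ ((1 + sigma) / 2) * mco F w0 k t) ^+ 2) <=
      `|w0| ^+ 2 + 2 * L2norm T F ^+ 2].
Proof.
move=> sF LF.
have cc k : {within I, continuous (mco F w0 k)}.
  by apply: mild_continuous; exact: sqi_integrable (coef_sqi k sF LF).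
have E k t : (lam k `^ ((1 + sigma) / 2) * mco F w0 k t) ^+ 2 =
  lam k `^ ((1 + sigma) / 2) ^+ 2 * mco F w0 k t ^+ 2 by exact: exprMn.
have ic k := continuous_itv_sqi (cc k).
split=> // [k|n].
  by under eq_fun do rewrite E; exact: itv_integrableZ.
apply: (@le_trans _ _ (\sum_(0 <= k < n) (wco w0 k ^+ 2 + 2 * (wt k ^+ 2 * \int[mu]_(t in I) ((F t (pV k) : R) ^+ 2))))).
  apply: ler_sum => k _; under eq_Rintegral do rewrite E; rewrite (itv_RintegralZ _ (ic k)).
  have := mild_coef_bound (ip (val w0) (phi k)) (lam_gt0 A k) (coef_sqi k sF LF).
  move=> /(ler_wpM2l (sqr_ge0 (lam k `^ ((1 + sigma) / 2)))) h.
  apply: (le_trans h); rewrite /wco [X in _ <= X + _]exprMn lamW lamU.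
  move: (lam k) (lam_gt0 A k) (wt k) => l l0 w.
  by rewrite le_eqVlt; apply/orP; left; apply/eqP; field; exact: lt0r_neq0.
rewrite big_split/= -big_distrr/= lerD ?dom_bessel//.
by rewrite ler_wpM2l// coef_bessel.
Qed.

Lemma mild_bound_smeas (F : R -> spV' A sigma) (w0 : spW A sigma) (z : R -> spU A sigma) :
  smeas F -> L2 T F -> smeas z ->
  aeT T (fun t => forall k, ip (val (z t)) (phi k) = mco F w0 k t) ->
  L2 T z /\ L2norm T z ^+ 2 <= `|w0| ^+ 2 + 2 * L2norm T F ^+ 2.
Proof.
move=> sF LF sz hz; have [_ ic hS] := mco_energy w0 sF LF.
have E k : aeT T (fun t => (lam k `^ ((1 + sigma) / 2) * mco F w0 k t) ^+ 2 = wco (z t) k ^+ 2).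
  by apply: aeTS hz => t _ h; rewrite /wco h.
apply: dom_L2_bound => // [k|n].
  apply: (integrable_aeT (ic k) _ (E k)).
  by apply: measurable_funX; exact: measurable_wco.
by rewrite -(eq_bigr _ (fun k _ => Rintegral_ae (E k))).
Qed.

Lemma mild_exists (F : R -> spV' A sigma) (w0 : spW A sigma) : L2 T F -> exists z, mild F w0 z.
Proof.
move=> LF; have [F' [sF LF' FF _]] := L2_rep LF.
have [cc ic hS] := mco_energy w0 sF LF'.
(* The formulas are continuous on [0, T] only; cut off, they become measurable on the line. *)
pose c k := mco F' w0 k \_ I.
have mI' : measurable I by exact: measurable_itv.
have mc k : measurable_fun setT (c k).
  apply/(measurable_restrictT _ mI').
  by apply: subspace_continuous_measurable_fun => //; exact: cc.
have cE k t : 0 <= t <= T -> c k t = mco F' w0 k t.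
  by move=> tI; rewrite /c /patch ifT// inE /I/= in_itv.
have E k : aeT T (fun t => (lam k `^ ((1 + sigma) / 2) * mco F' w0 k t) ^+ 2 =
    (lam k `^ ((1 + sigma) / 2) * c k t) ^+ 2) by apply: aeT_all => t tI; rewrite cE.
have [|n|z sz hz] := @dom_fun_synthesis _ spU_ge0 c (`|w0| ^+ 2 + 2 * L2norm T F' ^+ 2) mc.
- move=> k; apply: (integrable_aeT (ic k) _ (E k)).
  by apply: measurable_funX; exact: measurable_funM.
- by rewrite -(eq_bigr _ (fun k _ => Rintegral_ae (E k))).
have hz' : aeT T (fun t => forall k, ip (val (z t)) (phi k) = mco F' w0 k t).
  by apply: aeTS hz => t tI h k; rewrite h cE.
have [Lz _] := mild_bound_smeas sF LF' sz hz'.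
exists z; apply: (@mild_ae F' F w0 z z) => //; last exact: aeT_all.
by apply: aeTS FF => t _ ->.
Qed.

Lemma mild_bound (F : R -> spV' A sigma) (w0 : spW A sigma) z : L2 T F -> mild F w0 z ->
  L2norm T z ^+ 2 <= `|w0| ^+ 2 + 2 * L2norm T F ^+ 2.
Proof.
move=> LF mz; have [F' [sF LF' FF _]] := L2_rep LF.
have [z' [sz Lz' zz _]] := L2_rep mz.1.
have [_ h] := mild_ae FF zz mz.
by rewrite (L2norm_ae FF) (L2norm_ae zz); have [_] := mild_bound_smeas sF LF' sz h.
Qed.

Lemma volt_ext (l : R) (g g' : R -> R) t : (forall s, 0 <= s <= t -> g s = g' s) ->
  volt l g t = volt l g' t.
Proof.
move=> h; congr (_ * _); apply: eq_Rintegral => s; rewrite inE/= in_itv/= => st.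
by rewrite h.
Qed.

Lemma voltB (l : R) (g g' : R -> R) t : mu.-integrable I (EFin \o g) ->
  mu.-integrable I (EFin \o g') -> 0 <= t <= T ->
  volt l (fun s => g s - g' s) t = volt l g t - volt l g' t.
Proof.
move=> ig ig' /andP[t0 tT].
have J f : mu.-integrable I (EFin \o f) ->
    mu.-integrable [set` `[0, t]] (EFin \o (fun s => expR (l * s) * f s)).
  move=> /(integrable_expM l); apply: integrable_subitv => x /=.
  by rewrite !in_itv/= => /andP[-> h]; exact: le_trans h tT.
rewrite /volt -mulrBr -(itv_RintegralB (J _ ig) (J _ ig')).
by congr (_ * _); apply: eq_Rintegral => s _; rewrite mulrBr.
Qed.

Lemma mildB (F F' : R -> spV' A sigma) w w' z z' : L2 T F -> L2 T F' ->
  mild F w z -> mild F' w' z' ->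
  mild (fun t => F t - F' t) (w - w') (fun t => z t - z' t).
Proof.
move=> LF LF' mz mz'; have [G [sG LG FG _]] := L2_rep LF.
have [G' [sG' LG' FG' _]] := L2_rep LF'.
have z1 := mild_ae FG (aeT_all (fun t _ => erefl (z t))) mz.
have z2 := mild_ae FG' (aeT_all (fun t _ => erefl (z' t))) mz'.
apply: (@mild_ae (fun t => G t - G' t) _ _ (fun t => z t - z' t)).
- by apply: aeT2 FG FG' => t _ -> ->.
- exact: aeT_all.
split; first exact: (L2B mz.1 mz'.1).1.
apply: aeT2 z1.2 z2.2 => t tI h1 h2 k.
rewrite dom_coefB h1 h2 dom_coefB.
under [X in _ = _ + X]volt_ext do rewrite dualBE.
rewrite voltB//; [ring|exact: sqi_integrable (coef_sqi k sG LG)|exact: sqi_integrable (coef_sqi k sG' LG')].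
Qed.

(** The Volterra integral at time t sees F on [0, t] only. This allows a right-hand side to be cut
    off without changing the past. *)
Lemma mild_causal (F G : R -> spV' A sigma) w y z t1 : mild F w y -> mild G w z ->
  (forall t, t <= t1 -> F t = G t) -> aeT T (fun t => t <= t1 -> y t = z t).
Proof.
move=> my mz FG; apply: aeT2 my.2 mz.2 => t _ h1 h2 tt1; apply: dom_ext => k.
rewrite h1 h2; congr (_ + _); apply: volt_ext => s /andP[_ st].
by rewrite FG// (le_trans st).
Qed.

(* In the exponentially weighted norm, the dissipation rate lambda_k becomes
   lambda_k + kap. *)
Lemma mild_weighted (s kap M : R) (F : R -> spV' A sigma) z (y : R -> dom A s) :
  0 <= kap -> (forall k, (lam k `^ s) ^+ 2 * (lam k + kap) ^- 2 <= M * wt k ^+ 2) ->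
  L2 T F -> mild F 0 z -> L2 T y -> aeT T (fun t => val (y t) = val (z t)) ->
  L2norm T (fun t => expR (- kap * t) *: y t) ^+ 2 <=
  M * L2norm T (fun t => expR (- kap * t) *: F t) ^+ 2.
Proof.
move=> kap0 hM LF mz Ly yz.
have [F' [sF LF' FF _]] := L2_rep LF; have [y' [sy Ly' yy _]] := L2_rep Ly.
pose G t := expR (- kap * t) *: F' t.
pose x t := expR (- kap * t) *: y' t.
have sG : smeas G by apply: smeasM => //; exact: measurable_expR_scale.
have LG : L2 T G by apply: L2_test => //; exact: continuous_expR_scale.
have sx : smeas x by apply: smeasM => //; exact: measurable_expR_scale.
rewrite (@L2norm_ae _ T _ _ x); last by apply: aeTS yy => t _ ->.
rewrite (@L2norm_ae _ T _ _ G); last by apply: aeTS FF => t _ ->.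
have E k : aeT T (fun t => lam k `^ s ^+ 2 * volt (lam k + kap) (fun r => G r (pV k) : R) t ^+ 2
    = wco (x t) k ^+ 2).
  have [_ m2] := mild_ae FF (aeT_all (fun t _ => erefl (z t))) mz.
  apply: aeT2 (aeTI yz yy) m2 => t tI [h1 h2] h3.
  rewrite /wco /x dom_coefZ -h2 h1 h3 dom_coef0 mulr0 add0r -exprMn; congr ((_ * _) ^+ 2).
  by rewrite volt_exp.
have lk k : 0 < lam k + kap by rewrite ltr_wpDr// lam_gt0.
have cv k := @volt_continuous _ T (lam k + kap) _ (ltW T0) (sqi_integrable (coef_sqi k sG LG)).
have ic k := continuous_itv_sqi (cv k).
suff : L2 T x /\ L2norm T x ^+ 2 <= M * L2norm T G ^+ 2 by case.
apply: dom_L2_bound => //.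
  move=> k; apply: (integrable_aeT _ _ (E k)); first exact: itv_integrableZ.
  by apply: measurable_funX; exact: measurable_wco.
have M0 : 0 <= M.
  rewrite -(@pmulr_lge0 _ (wt 0 ^+ 2)) ?exprn_gt0//; apply: le_trans (hM 0).
  by rewrite mulr_ge0 ?invr_ge0 ?sqr_ge0// exprn_ge0// ltW.
move=> n.
apply: (@le_trans _ _ (\sum_(0 <= k < n) M * (wt k ^+ 2 * \int[mu]_(t in I) ((G t (pV k) : R) ^+ 2)))).
  apply: ler_sum => k _; rewrite -(Rintegral_ae (E k)) itv_RintegralZ//.
  have h := volt_L2 (ltW T0) (lk k) (coef_sqi k sG LG).
  apply: (le_trans (ler_wpM2l (sqr_ge0 (lam k `^ s)) h)).
  rewrite [leLHS]mulrA [leRHS]mulrA ler_wpM2r//.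
  by apply: Rintegral_ge0 => t _; exact: sqr_ge0.
rewrite -mulr_sumr; apply: (ler_wpM2l M0); exact: (coef_bessel n sG LG).
Qed.

(** lambda_k / (lambda_k + kap) <= 1: in U the exponential weight costs nothing. *)
Lemma mild_weighted_U (kap : R) F z : 0 <= kap -> L2 T F -> mild F 0 z ->
  L2norm T (fun t => expR (- kap * t) *: z t) ^+ 2 <=
  L2norm T (fun t => expR (- kap * t) *: F t) ^+ 2.
Proof.
move=> kap0 LF mz; rewrite -[leRHS]mul1r; apply: (mild_weighted kap0 _ LF mz mz.1).
  move=> k; have l0 := lam_gt0 A k; have lk : 0 < lam k + kap by rewrite ltr_wpDr.
  rewrite lamU mul1r ler_pdivrMr ?exprn_gt0// exprMn mulrC ler_wpM2l ?sqr_ge0//.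
  by rewrite ler_pXn2r ?nnegrE ?(ltW l0) ?(ltW lk)// lerDl.
exact: aeT_all.
Qed.

(** lambda_k / (lambda_k + kap)^2 <= 1 / (4 kap) by the inequality of means: in the weaker space W a
    large kap produces a small factor. *)
Lemma mild_weighted_W (kap : R) F z (y : R -> spW A sigma) : 0 < kap -> L2 T F ->
  mild F 0 z -> L2 T y -> aeT T (fun t => val (y t) = val (z t)) ->
  L2norm T (fun t => expR (- kap * t) *: y t) ^+ 2 <=
  (4 * kap)^-1 * L2norm T (fun t => expR (- kap * t) *: F t) ^+ 2.
Proof.
move=> kap0 LF mz Ly yz; apply: (mild_weighted (ltW kap0) _ LF mz Ly yz) => k.
have l0 := lam_gt0 A k; have lk : 0 < lam k + kap by rewrite ltr_wpDr// ltW.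
rewrite lamW mulrAC ler_wpM2r ?sqr_ge0// ler_pdivrMr ?exprn_gt0//.
rewrite ler_pdivlMl ?mulr_gt0// -subr_ge0.
by rewrite (_ : _ - _ = (lam k - kap) ^+ 2) ?sqr_ge0//; ring.
Qed.

Lemma pivot_linear : linear (fun h : H => pivotV A sigma h).
Proof.
by move=> a h h'; apply: dualP => v; rewrite dualDE dualZE !(pivotE _ _ spV_ge0) ipDl ipZl.
Qed.

Lemma pivot_bound : exists2 C, 0 <= C & forall h, `|pivotV A sigma h| <= C * `|h|.
Proof.
have [C C0 hC] := le_norm_Apow A spV_ge0; exists C => // h.
apply: dual_norm_bound; first exact: mulr_ge0.
move=> v; rewrite (pivotE _ _ spV_ge0) (le_trans (ip_CauchySchwarz _ _))//.
rewrite (mulrC C) -mulrA ler_wpM2l//; exact: hC (dom_valP v).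
Qed.

Lemma pivot_val_bound (s : R) : 0 <= s ->
  exists2 C, 0 <= C & forall u : dom A s, `|pivotV A sigma (val u)| <= C * `|u|.
Proof.
move=> s0; have [C C0 hC] := pivot_bound; have [D D0 hD] := le_norm_Apow A s0.
exists (C * D); first exact: mulr_ge0.
move=> u; rewrite (le_trans (hC _))// -mulrA ler_wpM2l//; exact: hD (dom_valP u).
Qed.

Lemma L2_pivot (s : R) (y : R -> dom A s) : 0 <= s -> L2 T y ->
  L2 T (fun t => pivotV A sigma (val (y t))).
Proof.
move=> s0; have [C C0 hC] := pivot_val_bound s0.
have lin : linear (fun u : dom A s => pivotV A sigma (val u)).
  by move=> a u v; rewrite linearP/= pivot_linear.
have [L hL] := linear_pack lin.
move=> Ly; have [|h _] := @L2_linear _ T _ _ L C y C0 _ Ly; first by move=> u; rewrite hL.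
by rewrite (_ : (fun t => _) = (fun t => L (y t)))//; apply/funext => t; rewrite hL.
Qed.

Section Evolution.
Variable Aop : {linear spU A sigma -> spV' A sigma}.
Hypothesis AopE : forall u k, Aop u (pV k) = lam k * ip (val u) (phi k) :> R.

Lemma Aop_le u : `|Aop u| <= `|u|.
Proof.
apply: (@dual_coef_bound _ _ A _ spV_ge0) => // n.
apply: le_trans (dom_bessel u n); apply: ler_sum => k _.
by rewrite AopE mulrA (mulrC _ (lam k)) -lamU.
Qed.

Lemma L2_Aop y : L2 T y ->
  L2 T (fun t => Aop (y t)) /\ L2norm T (fun t => Aop (y t)) <= L2norm T y.
Proof.
by move=> Ly; rewrite -[X in _ <= X]mul1r; apply: L2_linear => // u; rewrite mul1r Aop_le.
Qed.

(** The eigenvectors separate functionals, so the weak derivative is tested on them only, where it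
    reduces to the scalar [mild_weak]. *)
Lemma mild_H1 F w0 z : L2 T F -> mild F w0 z ->
  H1 T (fun t => pivotV A sigma (val (z t))) (fun t => F t - Aop (z t)).
Proof.
move=> LF mz; have Lp := L2_pivot spU_ge0 mz.1; have [LA _] := L2_Aop mz.1.
have [LFA _] := L2B LF LA; split => //.
apply: (@weak_derivative_intro _ _ _ T0 (range pV)) => //.
  by move=> f hf; apply: (@dual_coef_ext _ _ A _ spV_ge0) => k; rewrite hf//; exists k.
move=> eta _ teta [k _ <-].
have [F' [sF LF' FF _]] := L2_rep LF.
have [_ m2] := mild_ae FF (aeT_all (fun t _ => erefl (z t))) mz.
have := @mild_weak _ _ T0 eta (lam k) (ip (val w0) (phi k)) _ teta (sqi_integrable (coef_sqi k sF LF')).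
rewrite /= => h; transitivity (\int[mu]_(t in I) (derive1 eta t * (expR (- lam k * t) * ip (val w0) (phi k) + volt (lam k) (fun s => F' s (pV k) : R) t))).
  by apply: Rintegral_ae; apply: aeTS m2 => t _ hk; rewrite pivot_ph hk.
rewrite h; congr (- _); apply: Rintegral_ae; apply: aeT2 FF m2 => t _ E hk.
have := dualBE (F' t) (Aop (z t)) (pV k); rewrite AopE hk -E => <-.
by [].
Qed.

Lemma volt0 (l : R) (g : R -> R) : volt l g 0 = 0.
Proof. by rewrite /volt set_itv1 Rintegral_set1 mulr0. Qed.

Lemma sqi_subitv g t : 0 <= t <= T -> sqi T g ->
  \int[mu]_(s in `[0, t]) (g s ^+ 2) <= \int[mu]_(s in I) (g s ^+ 2).
Proof.
move=> /andP[t0 tT] [mg ig].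
have sub : [set` `[0, t]] `<=` [set` `[0, T]].
  by move=> x /=; rewrite !in_itv/= => /andP[-> h]; exact: le_trans h tT.
apply: fine_le.
- exact: (integrable_fin_num _ (integrable_subitv sub ig)).
- exact: (integrable_fin_num _ ig).
- apply: ge0_subset_integral => //.
    by apply/measurable_EFinP; apply: measurable_funTS; exact: measurable_funX.
  by move=> x _; rewrite lee_fin sqr_ge0.
Qed.

(** Weierstrass test in W: the squared weighted coefficients are dominated, uniformly in time, by a
    summable sequence, so the continuous partial sums converge uniformly on [0, T]. *)
Lemma mild_cont F w0 z : L2 T F -> mild F w0 z -> exists c : R -> spW A sigma,
  [/\ {within `[0, T], continuous c}, c 0 = w0 & aeT T (fun t => val (c t) = val (z t))].
Proof.
move=> LF mz; have [F' [sF LF' FF _]] := L2_rep LF.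
have [_ m2] := mild_ae FF (aeT_all (fun t _ => erefl (z t))) mz.
pose ck k t := expR (- lam k * t) * ip (val w0) (phi k) + volt (lam k) (fun s => F' s (pV k) : R) t.
(* In the second term the squared weight lambda_k wt_k^2 of W meets 2 / (2 lambda_k) from
   [volt_sup]. *)
pose e k := 2 * wco w0 k ^+ 2 + wt k ^+ 2 * \int[mu]_(t in I) ((F' t (pV k) : R) ^+ 2).
have sk k := coef_sqi k sF LF'.
have cc k : {within I, continuous (ck k)}.
  by apply: mild_continuous; exact: sqi_integrable (sk k).
have e0 k : 0 <= e k.
  apply: addr_ge0; first by rewrite mulr_ge0// sqr_ge0.
  by apply: mulr_ge0; [exact: sqr_ge0|apply: Rintegral_ge0 => t _; exact: sqr_ge0].
have ne : nondecreasing_seq (series e).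
  by apply/nondecreasing_seqP => n; rewrite !seriesEnat/= big_nat_recr//= lerDl.
have ce : cvgn (series e).
  apply: nondecreasing_is_cvgn => //; exists (2 * `|w0| ^+ 2 + L2norm T F' ^+ 2) => _ [n _ <-].
  rewrite seriesEnat/= big_split/= -mulr_sumr; apply: lerD; last exact: coef_bessel.
  by rewrite ler_wpM2l// dom_bessel.
have hk k t : 0 <= t <= T -> (lam k `^ (sigma / 2) * ck k t) ^+ 2 <= e k.
  move=> tI; rewrite exprMn.
  have v := volt_sup (lam_gt0 A k) (sk k) tI.
  have v2 := sqi_subitv tI (sk k).
  have l0 := lam_gt0 A k; have E1 := expR_ge0 (- lam k * t).
  have E2 : expR (- lam k * t) <= 1.
    by rewrite -expR0 ler_expR mulNr oppr_le0 mulr_ge0 ?(ltW l0)//; case/andP: tI.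
  have v3 : lam k * wt k ^+ 2 * (2 * volt (lam k) (fun s => F' s (pV k) : R) t ^+ 2) <=
      wt k ^+ 2 * \int[mu]_(s in I) ((F' s (pV k) : R) ^+ 2).
    rewrite mulrAC mulrC ler_wpM2l ?sqr_ge0// mulrA mulrC -ler_pdivlMr ?mulr_gt0//.
    apply: (le_trans v); rewrite mulrC (mulrC 2) ler_wpM2r//.
    by rewrite invr_ge0 mulr_ge0// ltW.
  rewrite lamW; apply: (@le_trans _ _ (lam k * wt k ^+ 2 * (2 * ip (val w0) (phi k) ^+ 2 + 2 * volt (lam k) (fun s => F' s (pV k) : R) t ^+ 2))).
    apply: ler_wpM2l; first by rewrite mulr_ge0 ?sqr_ge0// ltW.
    rewrite /ck; move: (volt _ _ _) (ip _ _) (expR _) E1 E2 => y a x x0 x1.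
    apply: (@le_trans _ _ (2 * (x * a) ^+ 2 + 2 * y ^+ 2)).
      by rewrite -subr_ge0 (_ : _ - _ = (x * a - y) ^+ 2) ?sqr_ge0//; ring.
    by rewrite lerD2r ler_wpM2l// exprMn ler_piMl ?sqr_ge0// expr_le1.
  by rewrite mulrDr lerD// /e /wco [X in _ <= 2 * X]exprMn lamW mulrCA.
have [c hc] : exists c : R -> spW A sigma, forall t, 0 <= t <= T -> forall k, ip (val (c t)) (phi k) = ck k t.
  suff /choice[c hc] : forall t, exists u : spW A sigma, 0 <= t <= T -> forall k, ip (val u) (phi k) = ck k t by exists c.
  move=> t; have [tI|tI] := boolP (0 <= t <= T); last by exists 0.
  have [|u hu] := @dom_synthesis _ _ A (sigma / 2) spW_ge0 (fun k => ck k t); last by exists u.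
  by apply: series_le_cvg ce => // k; [exact: sqr_ge0|exact: hk].
exists c; split; last 2 first.
- apply: dom_ext => k; rewrite hc ?lexx ?(ltW T0)// /ck mulr0 expR0 mul1r volt0 addr0//.
- by apply: aeTS m2 => t tI h; apply: (@coef_ext _ _ A) => k; rewrite hc// h.
pose S N t := \sum_(0 <= k < N) ck k t *: ph A spW_ge0 k.
have cS N : {within I, continuous (S N)}.
  elim: N => [|N IH].
    rewrite (_ : S 0%N = fun=> 0); first exact: cst_continuous.
    by apply/funext => t; rewrite /S big_geq.
  rewrite (_ : S N.+1 = (fun t => S N t + ck N t *: ph A spW_ge0 N)); last first.
    by apply/funext => t; rewrite /S big_nat_recr.
  move=> x; apply: (@continuousD R (spW A sigma) (subspace I) (S N) (fun t => ck N t *: ph A spW_ge0 N)).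
    exact: IH.
  by apply: cvgZr_tmp; exact: cc.
have tail N t : 0 <= t <= T -> `|c t - S N t| ^+ 2 <= limn (series e) - series e N.
  move=> tI; apply: dom_norm_sqr_le => n.
  apply: (@le_trans _ _ (\sum_(0 <= k < n) (if (k < N)%N then 0 else e k))).
    apply: ler_sum => k _; rewrite /wco dom_coefB hc// coef_psum.
    by case: ifP => _; rewrite ?subrr ?mulr0 ?expr0n// subr0 hk.
  apply: (@le_trans _ _ (\sum_(0 <= k < n + N) (if (k < N)%N then 0 else e k))).
    rewrite [leRHS](big_cat_nat (n:=n))/= ?leq_addr// lerDl sumr_ge0// => k _.
    by case: ifP.
  rewrite (big_cat_nat (n:=N))/= ?leq_addl// big_nat big1 ?add0r; last by move=> k /andP[_ ->].
  rewrite big_nat (eq_bigr e); last by move=> k /andP[]; rewrite leqNgt => /negbTE ->.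
  rewrite -big_nat lerBrDl addrC.
  apply: le_trans (nondecreasing_cvgn_le ne ce (n + N)%N).
  by rewrite !seriesEnat/= [leRHS](big_cat_nat (n:=N))/= ?leq_addl// addrC.
apply/subspace_continuousP => x xI.
apply/(@cvgrPdist_le _ _ _ (within I (nbhs x)) _) => d d0.
have d3 : 0 < d / 3 by rewrite divr_gt0.
have [N hN] : exists N, limn (series e) - series e N <= (d / 3) ^+ 2.
  have /cvgrPdist_le/(_ _ (exprn_gt0 2 d3)) /filter_ex[N hN] := ce.
  by exists N; rewrite (le_trans (ler_norm _)).
have near_ t : 0 <= t <= T -> `|c t - S N t| <= d / 3.
  move=> tI; rewrite -(@ler_pXn2r _ 2)// ?nnegrE ?(ltW d3)//.
  exact: le_trans (tail N t tI) hN.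
have /subspace_continuousP/(_ x xI)/(@cvgrPdist_le _ _ _ (within I (nbhs x)) _)/(_ _ d3) := cS N.
move=> h; near=> t.
have tI : 0 <= t <= T.
  suff : I t by rewrite /I/= in_itv.
  by near: t; exact: withinT.
have xI' : 0 <= x <= T by move: xI; rewrite /I/= in_itv.
rewrite (_ : c x - c t = (c x - S N x) + (S N x - S N t) - (c t - S N t)); last first.
  by rewrite opprB !addrA !subrK.
rewrite (le_trans (ler_normB _ _))// (_ : d = d / 3 + d / 3 + d / 3); last by field.
apply: lerD; last exact: near_.
rewrite (le_trans (ler_normD _ _))// lerD//; first exact: near_.
by near: t.
Unshelve. all: by end_near. Qed.

(* The last hypothesis encodes the initial value 0. *)
Lemma weak_solution_mild (y : R -> spU A sigma) (b db : R -> spV' A sigma) :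
  L2 T y -> H1 T b db -> aeT T (fun t => b t = pivotV A sigma (val (y t))) ->
  (forall (P : R -> Prop) e k, aeT T P -> 0 < e -> exists t,
     [/\ 0 <= t <= T, t < e, P t & `|ip (val (y t)) (phi k)| < e]) ->
  mild (fun t => db t + Aop (y t)) 0 y.
Proof.
move=> Ly [Lb Ldb wd] by_ init.
have [LG _] := L2D Ldb (L2_Aop Ly).1.
have [G [sG LG' GG _]] := L2_rep LG; have [b' [sb Lb' bb _]] := L2_rep Lb.
split=> //; apply: aeT_countable => k.
have yk : aeT T (fun t => b' t (pV k) = ip (val (y t)) (phi k) :> R).
  by apply: aeT2 bb by_ => t _ <- ->; rewrite pivot_ph.
have [|c hc] := @weak_mild _ T T0 (lam k) _ _ (measurable_ev (pV k) sb)
    (sqi_integrable (coef_sqi k sb Lb')) (sqi_integrable (coef_sqi k sG LG')).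
  move=> eta teta; have h := weak_derivative_ev (pV k) wd teta.
  transitivity (\int[mu]_(t in I) (derive1 eta t * (b t (pV k) : R))).
    by apply: Rintegral_ae; apply: aeTS bb => t _ ->.
  rewrite h; congr (- _); apply: Rintegral_ae; apply: aeT2 yk GG => t _ -> <-.
  by rewrite dualDE AopE addrK.
suff c0 : c = 0.
  apply: aeT2 hc yk => t tI h1 h2.
  rewrite -h2 h1 dom_coef0 mulr0 c0 mulr0; congr (_ + _).
  by apply: volt_ae => //; apply: aeTS GG => s _ ->.
(* The mild formula is continuous with value c at 0, yet [init] yields times near 0 at which it
   equals the coefficient of y and that coefficient is below |c| / 2. *)
apply: contrapT => /eqP c0; have nc : 0 < `|c| / 2 by rewrite divr_gt0// normr_gt0.
have /subspace_continuousP/(_ 0) := @mild_continuous (lam k) c _ (sqi_integrable (coef_sqi k sG LG')).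
have I0 : `[0, T]%classic 0 by rewrite /= in_itv/= lexx ltW.
move=> /(_ I0)/cvgrPdist_lt/(_ _ nc) [d /= d0 hd].
have [|t [tI td [h1 h2] hy]] := init _ (Num.min d (`|c| / 2)) k (aeTI hc yk).
  by rewrite lt_min d0.
have t0 : 0 <= t by case/andP: tI.
have := hd t; rewrite /ball/= sub0r normrN ger0_norm//.
move=> /(_ (lt_le_trans td _)); rewrite ge_min lexx => /(_ isT); rewrite in_itv/= => /(_ tI).
rewrite /from_subspace mulr0 expR0 mul1r volt0 addr0 -h1 h2 => h3.
have := ler_normD (c - ip (val (y t)) (phi k)) (ip (val (y t)) (phi k)).
rewrite subrK => h4; have h5 : `|ip (val (y t)) (phi k)| < `|c| / 2.
  by apply: (lt_le_trans hy); rewrite ge_min lexx orbT.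
by move: h3 h4 h5; move: `|_ - _| `|ip _ _| => p q; lra.
Qed.

End Evolution.
End Sigma.
End Mild.

(** * The skew-symmetric part as a lower order perturbation *)

Section SkewPart.
Context {R : realType} {H : hilbertType R} (A : eigensystem H) (sigma : R)
  (hsigma : 0 <= sigma <= 1) (D : set H) (cA cS : H -> H)
  (B : {bilinear spU A sigma -> spW A sigma -> spV' A sigma})
  (hst : structural D cA cS B).
Local Notation lam := (eigval A).
Local Notation phi := (eigvec A).

Let half0 : 0 <= 1 / 2 :> R. Proof. by rewrite divr_ge0. Qed.

Lemma skew_linear_bounded : exists2 L : {linear dom A (1 / 2) -> H},
  (forall u, L u = cS (val u)) & exists2 C, 0 <= C & forall u, `|L u| <= C * `|u|.
Proof.
have [_ _ lin] := st_S_linear hst; have [C hC] := st_S_bounded hst.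
have linS : linear (fun u : dom A (1 / 2) => cS (val u)).
  by move=> a u v; rewrite linearP/= lin//; [exact: (dom_valP u)|exact: (dom_valP v)].
have [L hL] := linear_pack linS; exists L => //; exists `|C| => // u.
by rewrite hL (le_trans (hC u))// ler_wpM2r// ler_norm.
Qed.

(* Skewness is given on D only, hence on the eigenvectors; boundedness of cS
   extends it. *)
Lemma skew_domhalf (u v : dom A (1 / 2)) : ip (cS (val u)) (val v) = - ip (val u) (cS (val v)).
Proof.
have [L LE [C C0 hC]] := skew_linear_bounded; rewrite -!LE.
have [K K0 hK] := le_norm_Apow A half0.
pose b (x y : dom A (1 / 2)) := ip (L x) (val y) + ip (val x) (L y).
have b_sym x y : b x y = b y x by rewrite /b addrC (ip_sym (L y)) (ip_sym (L x)).
have b_lin y a x x' : b (a *: x + x') y = a * b x y + b x' y.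
  by rewrite /b !linearP/= !ipDl !ipZl; ring.
have b_le y x : `|b x y| <= (C * (K * `|y|) + K * (C * `|y|)) * `|x|.
  have k1 : `|val x| <= K * `|x| := hK _ (dom_valP x).
  have k2 : `|val y| <= K * `|y| := hK _ (dom_valP y).
  rewrite /b (le_trans (ler_normD _ _))// mulrDl lerD// (le_trans (ip_CauchySchwarz _ _))//.
    rewrite mulrAC; exact: ler_pM (normr_ge0 _) (normr_ge0 _) (hC x) k2.
  rewrite mulrAC; exact: ler_pM (normr_ge0 _) (normr_ge0 _) k1 (hC y).
(* For fixed j this is a bounded functional of x, hence zero once it vanishes at the eigenvectors;
   symmetry of b lets the argument be applied to each variable in turn. *)
have b0 x j : (forall k, b (ph A half0 k) j = 0) -> b x j = 0.
  move=> h; have [f fE] := make_dual (b_lin j) (b_le j).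
  rewrite -fE (_ : f = 0) ?dual0E//; apply: (@dual_coef_ext _ _ A _ half0) => k.
  by rewrite fE h.
have bph j k : b (ph A half0 j) (ph A half0 k) = 0.
  have [[Dj _] [Dk _]] := (st_A_eigvec hst j, st_A_eigvec hst k).
  by rewrite /b !LE !val_ph (st_S_skew hst Dj Dk) addNr.
apply/eqP; rewrite -addr_eq0 -/(b u v) b0// => k.
by rewrite b_sym b0// => j.
Qed.

(* For sigma > 0 the bounded map cS : D(A^(1/2)) -> H is of lower order than U -> V^*
   and an interpolation inequality applies; for sigma = 0 both orders agree, but
   skewness moves cS to the test function. *)
Lemma skew_estimate (e : R) : 0 < e -> exists2 C, 0 <= C &
  forall (u : spU A sigma) (w : spW A sigma), val w = val u ->
    `|pivotV A sigma (cS (val u))| ^+ 2 <= e * `|u| ^+ 2 + C * `|w| ^+ 2.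
Proof.
move=> e0; have [s0 s1] := andP hsigma.
have [L LE [C C0 hC]] := skew_linear_bounded.
have h1 : 1 / 2 <= (1 + sigma) / 2 by rewrite ler_pM2r ?invr_gt0// lerDl.
have [K K0 hK] := dom_le A h1.
have [sE|sN] := eqVneq sigma 0.
  have h2 : 1 / 2 <= (1 - sigma) / 2 by rewrite sE subr0.
  have [K' K'0 hK'] := dom_le A h2; have [M M0 hM] := le_norm_Apow A (spW_ge0 hsigma).
  exists ((M * C * K') ^+ 2); first exact: sqr_ge0.
  move=> u w wu; have [u' u'E _] := hK u.
  apply: (@le_trans _ _ ((M * C * K') ^+ 2 * `|w| ^+ 2)); last first.
    by rewrite lerDr mulr_ge0 ?sqr_ge0// ltW.
  have nw := mulr_ge0 (mulr_ge0 (mulr_ge0 M0 C0) K'0) (normr_ge0 w).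
  rewrite -exprMn ler_pXn2r ?nnegrE//; apply: dual_norm_bound => // v.
  have [v' v'E v'n] := hK' v.
  have -> : pivotV A sigma (cS (val u)) v = - ip (val w) (L v') :> R.
    apply: (etrans (pivotE _ _ (spV_ge0 hsigma))).
    apply: (etrans (f_equal2 (fun x y => ip (cS x) y) (esym u'E) (esym v'E))).
    apply: (etrans (skew_domhalf u' v')).
    exact: (f_equal2 (fun x y => - ip x y) (etrans u'E (esym wu)) (esym (LE v'))).
  rewrite normrN (le_trans (ip_CauchySchwarz _ _))//.
  have k1 : `|val w| <= M * `|w| := hM _ (dom_valP w).
  have k2 := le_trans (hC v') (ler_wpM2l C0 v'n).
  apply: (le_trans (ler_pM (normr_ge0 _) (normr_ge0 _) k1 k2)).
  by rewrite le_eqVlt; apply/orP; left; apply/eqP; ring.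
have sp : 0 < sigma by rewrite lt_neqAle eq_sym sN.
have [M M0 hM] := pivot_bound A hsigma.
pose a := e / ((M * C) ^+ 2 + 1).
have d0 : 0 < (M * C) ^+ 2 + 1 by rewrite ltr_wpDl ?sqr_ge0.
have a0 : 0 < a by rewrite divr_gt0.
(* [l0] is the threshold where a lambda^sigma = 1: above it lambda^(1 - sigma) <= a lambda, below it
   lambda^(1 - sigma) <= b. *)
pose l0 := a `^ (- sigma^-1); pose b := l0 `^ (1 - sigma).
exists ((M * C) ^+ 2 * b); first by rewrite mulr_ge0 ?sqr_ge0 ?powR_ge0.
move=> u w wu; have [u' u'E _] := hK u.
have cmp : `|u'| ^+ 2 <= a * `|u| ^+ 2 + b * `|w| ^+ 2.
  apply: (@dom_norm_compare _ _ A _ _ _ u' u w a b (ltW a0) (powR_ge0 _ _)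
    (esym u'E) (etrans wu (esym u'E))) => k.
  have lk := lam_gt0 A k.
  rewrite -!powR_mulrn ?powR_ge0// -!powRrM !divfK// powRr1 ?(ltW lk)//.
  have E1 : lam k `^ (1 + sigma) = lam k * lam k `^ sigma.
    by rewrite powRD ?powRr1 ?(ltW lk)// (gt_eqF lk) implybT.
  have E2 : lam k = lam k `^ (1 - sigma) * lam k `^ sigma.
    by rewrite -powRD ?subrK ?powRr1 ?(ltW lk)// (gt_eqF lk) implybT.
  rewrite E1 mulrA -mulrDl {1}E2 ler_wpM2r ?powR_ge0//.
  have [ll|ll] := leP (lam k) l0.
    apply: (@le_trans _ _ b); last by rewrite lerDr mulr_ge0 ?ltW.
    by rewrite ge0_ler_powR ?nnegrE ?subr_ge0 ?(ltW lk) ?powR_ge0.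
  apply: (@le_trans _ _ (a * lam k)); last by rewrite lerDl powR_ge0.
  rewrite [X in a * X]E2 mulrCA ler_peMr ?powR_ge0// -ler_pdivrMl// mulr1.
  rewrite (_ : a^-1 = l0 `^ sigma); last first.
    by rewrite /l0 -powRrM mulNr mulVf ?gt_eqF// powRN powRr1// ltW.
  by rewrite ge0_ler_powR ?nnegrE ?(ltW lk) ?powR_ge0// ltW.
have k1 : `|pivotV A sigma (cS (val u))| <= M * C * `|u'|.
  apply: (le_trans (hM _)); rewrite -mulrA; apply: (ler_wpM2l M0).
  have -> : cS (val u) = L u' by apply: (etrans (congr1 cS (esym u'E))).
  exact: hC.
have MC := mulr_ge0 M0 C0.
apply: (@le_trans _ _ ((M * C * `|u'|) ^+ 2)).
  by rewrite ler_pXn2r ?nnegrE ?mulr_ge0.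
rewrite exprMn; apply: (le_trans (ler_wpM2l (sqr_ge0 _) cmp)).
rewrite mulrDr -(mulrA _ b) lerD2r (mulrA _ a); apply: ler_wpM2r; first exact: sqr_ge0.
by rewrite /a mulrCA ler_piMr ?(ltW e0)// ler_pdivrMr// mul1r lerDl.
Qed.

End SkewPart.

(** * The nonlinear problem *)

Section WeightedFixedPoint.
Context {R : realType} (T : R) {Z : normedModType R} (kap : R).
Hypotheses (T0 : 0 < T) (kap0 : 0 <= kap) (Zc : abs_complete Z).
Implicit Types F G : R -> Z.

(** A Bielecki norm, equivalent to [L2norm] by [wnorm_le] and [L2norm_wnorm]. *)
Definition wnorm F := L2norm T (fun t => expR (- kap * t) *: F t).

Lemma L2_weighted F : L2 T F -> L2 T (fun t => expR (- kap * t) *: F t).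
Proof. by apply: L2_test => //; exact: continuous_expR_scale. Qed.

Lemma wnorm_le F : L2 T F -> wnorm F <= L2norm T F.
Proof.
move=> LF; have := @L2M _ T _ (fun t => expR (- kap * t)) 1 F (@measurable_expR_scale _ _ setT).
rewrite mul1r => h; apply: (h _ ler01 LF).2 => t /andP[t0 _].
by rewrite ger0_norm ?expR_ge0// -expR0 ler_expR mulNr oppr_le0 mulr_ge0.
Qed.

Lemma L2norm_wnorm F : L2 T F -> L2norm T F <= expR (kap * T) * wnorm F.
Proof.
move=> LF; have h := @L2M _ T _ (fun t => expR (kap * t)) (expR (kap * T))
  (fun t => expR (- kap * t) *: F t) (@measurable_expR_scale _ _ setT).
have {}h := (h _ (expR_ge0 _) (L2_weighted LF)).2.
apply: le_trans (h _); last first.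
  by move=> t /andP[t0 tT]; rewrite ger0_norm ?expR_ge0// ler_expR ler_wpM2l//.
rewrite le_eqVlt; apply/orP; left; apply/eqP/L2norm_ae/aeT_all => t _.
by rewrite scalerA -expRD mulNr subrr expR0 scale1r.
Qed.

Lemma wnorm_ae F G : aeT T (fun t => F t = G t) -> wnorm F = wnorm G.
Proof. by move=> FG; apply: L2norm_ae; apply: aeTS FG => t _ ->. Qed.

Lemma wnormD F G : L2 T F -> L2 T G -> wnorm (fun t => F t + G t) <= wnorm F + wnorm G.
Proof.
move=> /L2_weighted LF /L2_weighted LG; rewrite /wnorm.
by under [X in L2norm _ X]eq_fun do rewrite scalerDr; exact: (L2D LF LG).2.
Qed.

Lemma wnormN F : wnorm (fun t => - F t) = wnorm F.
Proof.
rewrite /wnorm -[RHS]L2normN; congr L2norm; apply/funext => t.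
by rewrite scalerN.
Qed.

Lemma wnormB F G : L2 T F -> L2 T G -> wnorm (fun t => F t - G t) <= wnorm F + wnorm G.
Proof. by move=> LF LG; rewrite -(wnormN G); exact: wnormD LF (L2N LG). Qed.

(** Picard iteration; the ratio 1/2 and |Phi 0| <= r / 2 keep the iterates in the ball of radius r.
    [L2_complete] is applied to the iterates multiplied by e^(- kap t), and the limit is multiplied
    back. *)
Lemma weighted_fixed_point (Phi : (R -> Z) -> (R -> Z)) (r : R) : 0 < r ->
  (forall F, L2 T F -> L2 T (Phi F)) ->
  (forall F G, L2 T F -> L2 T G -> wnorm F <= r -> wnorm G <= r ->
     wnorm (fun t => Phi F t - Phi G t) <= wnorm (fun t => F t - G t) / 2) ->
  wnorm (Phi (fun=> 0)) <= r / 2 ->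
  exists F, [/\ L2 T F, wnorm F <= r & aeT T (fun t => F t = Phi F t)].
Proof.
move=> r0 LPhi contr Phi0.
pose a n := iter n Phi (fun=> 0 : Z).
have L0 : L2 T (fun=> 0 : Z) := (L20 T).1.
have n0 : wnorm (fun=> 0 : Z) = 0.
  by rewrite -[RHS](@L20 _ T Z).2; apply: L2norm_ae; apply: aeT_all => t _; rewrite scaler0.
have La n : L2 T (a n) by elim: n => [|n IH]; [exact: L0|exact: LPhi].
have an n : wnorm (a n) <= r.
  elim: n => [|n IH]; first by rewrite n0 ltW.
  rewrite (@wnorm_ae _ (fun t => (Phi (a n) t - Phi (fun=> 0) t) + Phi (fun=> 0) t)); last first.
    by apply: aeT_all => t _; rewrite subrK.
  rewrite (le_trans (wnormD (L2B (LPhi _ (La n)) (LPhi _ L0)).1 (LPhi _ L0)))//.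
  rewrite (splitr r) lerD// (le_trans (contr _ _ _ _ _ _))// ?n0 ?(ltW r0)//.
  rewrite ler_pM2r ?invr_gt0// (@wnorm_ae _ (a n))//.
  by apply: aeT_all => t _; rewrite subr0.
have d n : wnorm (fun t => a n.+1 t - a n t) <= r / 2 * 2^-1 ^+ n.
  elim: n => [|n IH].
    by rewrite mulr1 (@wnorm_ae _ (a 1%N))//; apply: aeT_all => t _; rewrite subr0.
  apply: le_trans (contr _ _ (La n.+1) (La n) (an _) (an _)) _.
  by rewrite exprSr mulrA ler_pM2r// invr_gt0.
have r2 : 0 <= r / 2 by rewrite divr_ge0// ltW.
have [|b Lb hb] := L2_complete Zc r2 (fun n => L2_weighted (La n)).
  move=> n; rewrite (@L2norm_ae _ T _ _ (fun t => expR (- kap * t) *: (a n.+1 t - a n t))); first exact: d.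
  by apply: aeT_all => t _; rewrite scalerBr.
pose F t := expR (kap * t) *: b t.
have LF : L2 T F by apply: L2_test => //; exact: continuous_expR_scale.
have hF n : wnorm (fun t => F t - a n t) <= 2 * (r / 2) * 2^-1 ^+ n.
  rewrite /wnorm (@L2norm_ae _ T _ _ (fun t => b t - expR (- kap * t) *: a n t)); first exact: hb.
  apply: aeT_all => t _; rewrite scalerBr scalerA -expRD mulNr addNr expR0 scale1r//.
have small (x c : R) : 0 <= c -> (forall n, x <= c * 2^-1 ^+ n) -> x <= 0.
  move=> c0 h; have cv : (c * 2^-1 ^+ n @[n --> \oo] --> (0 : R)).
    rewrite -(mulr0 c); apply: cvgM; first exact: cvg_cst.
    by apply: cvg_expr; rewrite ger0_norm ?invr_ge0// invf_lt1 ?ltr1n.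
  by apply: (ler_cvg_to (cvg_cst x) cv); exact: nearW.
have Fr : wnorm F <= r.
  rewrite -subr_le0; apply: (@small _ (2 * (r / 2))) => [|n]; first exact: mulr_ge0.
  rewrite lerBlDr; apply: le_trans (lerD (hF n) (an n)).
  rewrite (@wnorm_ae _ (fun t => (F t - a n t) + a n t)); last by apply: aeT_all => t _; rewrite subrK.
  exact: wnormD (L2B LF (La n)).1 (La n).
exists F; split => //.
have LPF := LPhi _ LF.
have z : wnorm (fun t => F t - Phi F t) <= 0.
  apply: (@small _ (2 * (2 * (r / 2)))) => [|n]; first by rewrite !mulr_ge0// ltW.
  rewrite (@wnorm_ae _ (fun t => (F t - a n.+1 t) - (Phi F t - Phi (a n) t))); last first.
    by apply: aeT_all => t _; rewrite opprB addrA subrK.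
  apply: le_trans (wnormB (L2B LF (La _)).1 (L2B LPF (LPhi _ (La n))).1) _.
  have h1 := hF n.+1; have h2 := contr _ _ LF (La n) Fr (an n).
  have h3 := hF n; have e0 : 0 <= 2^-1 ^+ n :> R by rewrite exprn_ge0.
  move: h1; rewrite exprS; move: h2 h3 e0; move: (2^-1 ^+ n) => x.
  move: (wnorm _) (wnorm _) (wnorm _) => p q s; nra.
have LD := L2B LF LPF.
have := L2norm_eq0 (L2_weighted LD.1); rewrite -/(wnorm _) => h.
have /h : wnorm (fun t => F t - Phi F t) = 0 by apply/eqP; rewrite eq_le z L2norm_ge0.
apply: aeTS => t _ /eqP; rewrite scaler_eq0 gt_eqF ?expR_gt0//= subr_eq0 => /eqP.
by [].
Qed.

End WeightedFixedPoint.

(** * Linear structure of the solution spaces *)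

Section L2H1Algebra.
Context {R : realType} (T : R).
Hypothesis T0 : 0 < T.
Local Notation mu := (@lebesgue_measure R).
Let I := `[0%R, T]%classic.

Lemma weak_derivative_lin (V : normedModType R) (a : R) (b db c dc : R -> dual V) :
  L2 T b -> L2 T db -> L2 T c -> L2 T dc ->
  weak_derivative T b db -> weak_derivative T c dc ->
  weak_derivative T (fun t => a *: b t + c t) (fun t => a *: db t + dc t).
Proof.
move=> Lb Ldb Lc Ldc wb wc.
have h x y : L2 T x -> L2 T y -> L2 T (fun t => a *: x t + y t).
  by move=> Lx Ly; exact: (L2D (L2Z a Lx) Ly).1.
apply: (@weak_derivative_intro _ _ _ T0 setT); [|exact: h|exact: h|].
  by move=> f hf; apply: dualP => v; rewrite hf.
move=> eta v teta _.
have key (psi : R -> R) (x y : R -> dual V) : continuous psi -> L2 T x -> L2 T y ->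
    \int[mu]_(t in I) (psi t * ((a *: x t + y t) v : R)) =
    a * \int[mu]_(t in I) (psi t * (x t v : R)) + \int[mu]_(t in I) (psi t * (y t v : R)).
  move=> cpsi /L2_rep[x' [sx Lx xx _]] /L2_rep[y' [sy Ly yy _]].
  have ev (z : R -> dual V) : smeas z -> L2 T z -> mu.-integrable I (EFin \o (fun t => psi t * (z t v : R))).
    move=> sz Lz; apply: integrable_continuousM => //; apply: integrable_ev => //.
    exact: sqi_integrable (sqi_norm sz Lz).
  rewrite (@Rintegral_ae _ T (fun t => psi t * (x t v : R)) (fun t => psi t * (x' t v : R))); last first.
    by apply: aeTS xx => t _ ->.
  rewrite (@Rintegral_ae _ T (fun t => psi t * (y t v : R)) (fun t => psi t * (y' t v : R))); last first.
    by apply: aeTS yy => t _ ->.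
  rewrite -(itv_RintegralZ _ (ev _ sx Lx)) -(itv_RintegralD (itv_integrableZ a (ev _ sx Lx)) (ev _ sy Ly)).
  apply: Rintegral_ae; apply: aeT2 xx yy => t _ -> ->.
  by rewrite dualDE dualZE mulrDr mulrCA.
have [_ c1 _] := teta.
rewrite (key _ _ _ c1 Lb Lc) (key _ _ _ (test_fun_continuous teta) Ldb Ldc).
rewrite (weak_derivative_ev v wb teta) (weak_derivative_ev v wc teta).
by rewrite mulrN -opprD.
Qed.

Section Norm.
Context {Z1 Z2 : normedModType R}.
Implicit Types (u : R -> Z1) (b db : R -> Z2).

Lemma H1norm_bounds b db :
  [/\ L2norm T b <= H1norm T b db, L2norm T db <= H1norm T b db
    & H1norm T b db <= L2norm T b + L2norm T db].
Proof.
have nb := L2norm_ge0 T b; have nd := L2norm_ge0 T db.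
split.
- by rewrite -{1}(ger0_norm nb) -sqrtr_sqr ler_sqrt ?addr_ge0 ?sqr_ge0// lerDl sqr_ge0.
- by rewrite -{1}(ger0_norm nd) -sqrtr_sqr ler_sqrt ?addr_ge0 ?sqr_ge0// lerDr sqr_ge0.
- rewrite -[leRHS]ger0_norm ?addr_ge0// -sqrtr_sqr ler_sqrt ?sqr_ge0//.
  by rewrite sqrrD -addrA lerD2l lerDr mulrn_wge0// mulr_ge0.
Qed.

Lemma L2H1norm_ge0 u b db : 0 <= L2H1norm T u b db.
Proof. by rewrite addr_ge0 ?L2norm_ge0 ?sqrtr_ge0. Qed.

(** The factor 2 comes from comparing the Euclidean combination in [H1norm] with the sum of its two
    terms. *)
Lemma L2H1normD u b db v c dc : L2 T u -> L2 T b -> L2 T db -> L2 T v -> L2 T c -> L2 T dc ->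
  L2H1norm T (fun t => u t + v t) (fun t => b t + c t) (fun t => db t + dc t) <=
  2 * (L2H1norm T u b db + L2H1norm T v c dc).
Proof.
move=> Lu Lb Ldb Lv Lc Ldc.
have [_ _ h] := H1norm_bounds (fun t => b t + c t) (fun t => db t + dc t).
have [h1 h2 _] := H1norm_bounds b db; have [h3 h4 _] := H1norm_bounds c dc.
have [_ n1] := L2D Lu Lv; have [_ n2] := L2D Lb Lc; have [_ n3] := L2D Ldb Ldc.
have p1 := L2norm_ge0 T u; have p2 := L2norm_ge0 T v.
rewrite /L2H1norm; move: h h1 h2 h3 h4 n1 n2 n3 p1 p2.
move: (H1norm T _ _) (H1norm T b db) (H1norm T c dc) => x1 x2 x3.
move: (L2norm T (fun t => u t + v t)) (L2norm T (fun t => b t + c t)) => x4 x5.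
move: (L2norm T (fun t => db t + dc t)) (L2norm T u) (L2norm T v) => x6 x7 x8.
by move: (L2norm T b) (L2norm T db) (L2norm T c) (L2norm T dc) => *; lra.
Qed.
End Norm.

Lemma L2H1_lin (Z1 : normedModType R) (V : normedModType R) (E : lmodType R)
    (e1 : {linear Z1 -> E}) (e2 : {linear dual V -> E}) (a : R) u b db v c dc :
  L2H1 T e1 e2 u b db -> L2H1 T e1 e2 v c dc ->
  L2H1 T e1 e2 (fun t => a *: u t + v t) (fun t => a *: b t + c t) (fun t => a *: db t + dc t).
Proof.
move=> [Lu [Lb Ldb wb] ub] [Lv [Lc Ldc wc] vc].
have h (Z : normedModType R) (x y : R -> Z) : L2 T x -> L2 T y -> L2 T (fun t => a *: x t + y t).
  by move=> Lx Ly; exact: (L2D (L2Z a Lx) Ly).1.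
split; [exact: h|split; [exact: h|exact: h|exact: weak_derivative_lin]|].
by apply: aeT2 ub vc => t _ h1 h2; rewrite !linearP h1 h2.
Qed.

Lemma L2H1D (Z1 : normedModType R) (V : normedModType R) (E : lmodType R)
    (e1 : {linear Z1 -> E}) (e2 : {linear dual V -> E}) u b db v c dc :
  L2H1 T e1 e2 u b db -> L2H1 T e1 e2 v c dc ->
  L2H1 T e1 e2 (fun t => u t + v t) (fun t => b t + c t) (fun t => db t + dc t) /\
  L2H1norm T (fun t => u t + v t) (fun t => b t + c t) (fun t => db t + dc t) <=
  2 * (L2H1norm T u b db + L2H1norm T v c dc).
Proof.
move=> hu hv; split; last first.
  by case: hu hv => ? [? ? _] _ [? [? ? _] _]; exact: L2H1normD.
have := L2H1_lin 1 hu hv.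
by do !under [X in L2H1 _ _ _ X _ _]eq_fun do rewrite scale1r;
  do !under [X in L2H1 _ _ _ _ X _]eq_fun do rewrite scale1r;
  do !under [X in L2H1 _ _ _ _ _ X]eq_fun do rewrite scale1r.
Qed.

Lemma L2H1B (Z1 : normedModType R) (V : normedModType R) (E : lmodType R)
    (e1 : {linear Z1 -> E}) (e2 : {linear dual V -> E}) u b db v c dc :
  L2H1 T e1 e2 u b db -> L2H1 T e1 e2 v c dc ->
  L2H1 T e1 e2 (fun t => u t - v t) (fun t => b t - c t) (fun t => db t - dc t).
Proof.
move=> hu hv; have := L2H1_lin (-1) hv hu.
have E2 (Z : normedModType R) (x y : R -> Z) : (fun t => -1 *: y t + x t) = (fun t => x t - y t).
  by apply/funext => t; rewrite scaleN1r addrC.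
by rewrite !E2.
Qed.

Lemma cont_repB (Z1 Z2 : normedModType R) (E : lmodType R) (e1 : {linear Z1 -> E})
  (e2 : {linear Z2 -> E}) u v c d : cont_rep T e1 e2 u c -> cont_rep T e1 e2 v d ->
  cont_rep T e1 e2 (fun t => u t - v t) (fun t => c t - d t).
Proof.
move=> [cc uc] [cd vd]; split.
  by move=> x; apply: (@continuousB R Z2 (subspace I) c d); [exact: cc|exact: cd].
by apply: aeT2 uc vd => t _ h1 h2; rewrite !linearB h1 h2.
Qed.

Lemma cont_repD (Z1 Z2 : normedModType R) (E : lmodType R) (e1 : {linear Z1 -> E})
  (e2 : {linear Z2 -> E}) u v c d : cont_rep T e1 e2 u c -> cont_rep T e1 e2 v d ->
  cont_rep T e1 e2 (fun t => u t + v t) (fun t => c t + d t).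
Proof.
move=> [cc uc] [cd vd]; split.
  by move=> x; apply: (@continuousD R Z2 (subspace I) c d); [exact: cc|exact: cd].
by apply: aeT2 uc vd => t _ h1 h2; rewrite !linearD h1 h2.
Qed.

(** An identity valid almost everywhere says nothing at the single time 0; this supplies times near
    0 that avoid the null set and where c is close to its initial value. *)
Lemma continuous_itv_near0 (Z : normedModType R) (c : R -> Z) (P : R -> Prop) (e : R) :
  {within `[0, T], continuous c} -> aeT T P -> 0 < e ->
  exists t, [/\ 0 <= t <= T, t < e, P t & `|c 0 - c t| < e].
Proof.
move=> /subspace_continuousP/(_ 0).
have I0 : `[0, T]%classic 0 by rewrite /= in_itv/= lexx ltW.
move=> /(_ I0)/(@cvgrPdist_lt _ _ _ (within I (nbhs 0)) _) cc hP e0.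
have [d /= d0 hd] := cc _ e0.
have m0 : 0 < Num.min d e by rewrite lt_min d0.
have T00 : (0 : R) <= 0 <= T by rewrite lexx ltW.
have [t [tI td Pt]] := aeT_exists m0 hP T00 T0.
have t0 : 0 <= t by case/andP: tI.
rewrite subr0 ger0_norm// lt_min in td; case/andP: td => td te.
exists t; split => //; apply: hd; last by rewrite /I/= in_itv.
by rewrite /ball/= sub0r normrN ger0_norm.
Qed.

End L2H1Algebra.

(** The images are chosen pointwise; the choice is linear because [val] is linear and injective. *)
Lemma dom_inclusion (R : realType) (H : hilbertType R) (A : eigensystem H) (s s' : R) : s <= s' ->
  exists2 J : {linear dom A s' -> dom A s}, (forall u, val (J u) = val u) &
    exists2 C, 0 <= C & forall u, `|J u| <= C * `|u|.
Proof.
move=> ss; have [C C0 hC] := dom_le A ss.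
have /choice[J hJ] : forall u : dom A s', exists w : dom A s, val w = val u /\ `|w| <= C * `|u|.
  by move=> u; have [w] := hC u; exists w.
have lin : linear J.
  have vL r a (u v : dom A r) : val (a *: u + v) = a *: val u + val v by rewrite linearP.
  move=> a u v; apply: val_inj; apply: (etrans (etrans (hJ _).1 (vL _ _ _ _))); symmetry.
  apply: (etrans (vL _ _ _ _)).
  exact: (f_equal2 (fun x y : H => a *: x + y) (hJ u).1 (hJ v).1).
have [L LE] := linear_pack lin; exists L.
  by move=> u; rewrite LE; exact: (hJ u).1.
by exists C => // u; rewrite LE; exact: (hJ u).2.
Qed.

Lemma L2norm_sqr_le (R : realType) (T : R) (Z Z1 Z2 : normedModType R) (a : R -> Z) (b : R -> Z1)
    (c : R -> Z2) (p q : R) : L2 T a -> L2 T b -> L2 T c -> 0 <= p -> 0 <= q ->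
  aeT T (fun t => `|a t| ^+ 2 <= p * `|b t| ^+ 2 + q * `|c t| ^+ 2) ->
  L2norm T a ^+ 2 <= p * L2norm T b ^+ 2 + q * L2norm T c ^+ 2.
Proof.
move=> /L2_rep[a' [sa La aa _]] /L2_rep[b' [sb Lb bb _]] /L2_rep[c' [sc Lc cc _]] p0 q0 h.
rewrite (L2norm_ae aa) (L2norm_ae bb) (L2norm_ae cc) !L2norm_sqr.
have ia := L2_sqi sa La; have ib := L2_sqi sb Lb; have ic := L2_sqi sc Lc.
rewrite -!itv_RintegralZ// -itv_RintegralD; try exact: itv_integrableZ.
have ir := itv_integrableD (itv_integrableZ p ib) (itv_integrableZ q ic).
apply: fine_le.
- exact: (integrable_fin_num _ ia).
- exact: (integrable_fin_num _ ir).
apply: ge0_ae_le_integral.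
- by move=> t _; rewrite lee_fin sqr_ge0.
- by move=> t _; rewrite lee_fin addr_ge0// mulr_ge0// sqr_ge0.
suff : aeT T (fun t => (`|a' t| ^+ 2)%:E <= (p * `|b' t| ^+ 2 + q * `|c' t| ^+ 2)%:E)%E by [].
by apply: aeT2 (aeTI aa (aeTI bb cc)) h => t _ [<- [<- <-]]; rewrite lee_fin.
Qed.

(** * Existence and uniqueness for the lifted problem *)

Section LiftedProblem.
Context (R : realType) (T : R) (hT : 0 < T)
    (sigma : R) (hsigma : 0 <= sigma <= 1)
    (H : hilbertType R) (A : eigensystem H)
    (D : set H) (cA cS : H -> H)
    (B : {bilinear spU A sigma -> spW A sigma -> spV' A sigma})
    (hstruct : structural D cA cS B)
    (E : lmodType R) (eV' : {linear spV' A sigma -> E})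
    (Ut Vt Wt : completeNormedModType R)
    (eU : {linear Ut -> E}) (eV : {linear Vt -> E}) (eW : {linear Wt -> E})
    (iU : {linear spU A sigma -> Ut}) (iV : {linear spV A sigma -> Vt})
    (iW : {linear spW A sigma -> Wt})
    (hL1 : lifting_spaces T eV' eU eV eW iU iV iW)
    (Dt : set H) (cAt cSt : H -> H)
    (At St : {linear Ut -> spV' A sigma})
    (Bt : {bilinear Ut -> Ut -> spV' A sigma})
    (hL3 : lifted_operators T eV' eU iU D cA cS B Dt cAt cSt At St Bt).
Local Notation mu := (@lebesgue_measure R).
Local Notation pV := (ph A (spV_ge0 hsigma)).
Local Notation Xt := (L2H1 T eU eV').
Local Notation NX := (L2H1norm T).
Local Notation mild := (mild T hsigma).

(** Evaluation at the k-th eigenvector is continuous on V^* and keeps only the k-th term of the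
    series in [lo_At_X]. *)
Lemma lifted_A_exists : exists2 A0 : {linear spU A sigma -> spV' A sigma},
  (forall u, A0 u = At (iU u)) &
  forall u k, A0 u (pV k) = eigval A k * ip (val u) (eigvec A k) :> R.
Proof.
have lin : linear (fun u => At (iU u)) by move=> a u v; rewrite !linearP.
have [A0 A0E] := linear_pack lin; exists A0 => // u k; rewrite A0E.
pose S n := \sum_(0 <= j < n) (eigval A j * ip (val u) (eigvec A j)) *: pivotV A sigma (eigvec A j).
have SE : S = series (fun j => (eigval A j * ip (val u) (eigvec A j)) *: pivotV A sigma (eigvec A j)).
  by apply/funext => n; rewrite seriesEnat.
have h : (S n (pV k) : R) @[n --> \oo] --> (At (iU u) (pV k) : R).
  apply: (cvg_comp S (fun f : spV' A sigma => f (pV k) : R) _ (@ev_continuous _ _ (pV k) (At (iU u)))).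
  rewrite SE; exact: (lo_At_X hL3).
apply: (@cvg_unique R _ _ _ _ _ h); first exact: norm_hausdorff.
apply: cvg_near_cst; near=> n.
rewrite /S big_mkord dual_sumE -(big_mkord xpredT (fun j => ((eigval A j * ip (val u) (eigvec A j)) *: pivotV A sigma (eigvec A j)) (pV k) : R)).
have ev j : ((eigval A j * ip (val u) (eigvec A j)) *: pivotV A sigma (eigvec A j)) (pV k) =
    eigval A j * ip (val u) (eigvec A j) * (j == k)%:R :> R.
  by apply: (etrans (dualZE _ _ _)); rewrite pivot_ph eigvec_orthonormal.
rewrite (eq_bigr _ (fun j _ => ev j)).
have kn : (k < n)%N by near: n; exact: nbhs_infty_gt.
rewrite (bigD1_seq k)/= ?iota_uniq//; last by rewrite mem_index_iota.
rewrite eqxx mulr1 big1 ?addr0// => j jk; by rewrite (negbTE jk) mulr0.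
Unshelve. all: by end_near. Qed.

Lemma linear_bound (V1 V2 : normedModType R) (L : {linear V1 -> V2}) : continuous L ->
  exists2 C, 0 <= C & forall v, `|L v| <= C * `|v|.
Proof.
move=> /linear_bounded_continuous/linear_boundedP/filter_ex[C h].
by exists `|C| => // v; rewrite (le_trans (h v))// ler_wpM2r// ler_norm.
Qed.

(** Maximal regularity: the energy bound controls z in L^2 with values in U, and the derivative F -
    A0 z is then of the same size in V^*, because [A0] is bounded from U to V^*. *)
Lemma mild_Xt (A0 : {linear spU A sigma -> spV' A sigma}) :
  (forall u k, A0 u (pV k) = eigval A k * ip (val u) (eigvec A k) :> R) ->
  exists2 K, 0 <= K & forall F w0 z, L2 T F -> mild F w0 z ->
   [/\ L2H1 T (@eD _ _ _ _ _ eV' _) eV' z (fun t => pivotV A sigma (val (z t))) (fun t => F t - A0 (z t)),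
     Xt (fun t => iU (z t)) (fun t => pivotV A sigma (val (z t))) (fun t => F t - A0 (z t)) &
     NX (fun t => iU (z t)) (fun t => pivotV A sigma (val (z t))) (fun t => F t - A0 (z t)) <=
     K * (L2norm T F + `|w0|)].
Proof.
move=> A0E; have [ciU _ _ _ eUiU] := ls_U hL1.
have [C C0 hC] := linear_bound ciU; have [P P0 hP] := pivot_val_bound A hsigma (spU_ge0 hsigma).
(* C + P + 1 multiplies the norm of z, on account of [iU z], of z seen in V^* and of [A0 z]; that
   norm is at most |w0| + 2 |F|. *)
exists (2 * (C + P + 2)); first by rewrite mulr_ge0// !addr_ge0.
move=> F w0 z LF mz; have Lz := mz.1.
have h1 := mild_H1 hT A0E LF mz; have [Lb Ldb _] := h1.
have [LiU niU] := L2_linear C0 hC Lz.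
have [_ nb] := L2_le P0 Lb.1 Lz (aeT_all (fun t _ => hP (z t))).
have [LA nA] := L2_Aop A0E Lz; have [_ ndb] := L2B LF LA.
split.
- by split => //; apply: aeT_all.
- by split => //; apply: aeT_all => t _; rewrite eUiU.
have [_ _ nH] := @H1norm_bounds _ T _ (fun t => pivotV A sigma (val (z t))) (fun t => F t - A0 (z t)).
have nz : L2norm T z <= `|w0| + 2 * L2norm T F.
  have nF := L2norm_ge0 T F.
  rewrite -(@ler_pXn2r _ 2)// ?nnegrE ?addr_ge0 ?mulr_ge0 ?L2norm_ge0//.
  apply: (le_trans (mild_bound hT LF mz)); have := normr_ge0 w0.
  move: (L2norm T F) nF `|w0| => x x0 y y0.
  rewrite -subr_ge0 (_ : _ - _ = 4 * (y * x) + 2 * x ^+ 2); last by ring.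
  by rewrite addr_ge0 ?mulr_ge0 ?sqr_ge0.
rewrite /L2H1norm; move: nH niU nb nA ndb nz (normr_ge0 w0) (L2norm_ge0 T F) (L2norm_ge0 T z).
move: (H1norm _ _ _) (L2norm T (fun t => iU _)) (L2norm T (fun t => pivotV _ _ _)) => a1 a2 a3.
move: (L2norm T (fun t => A0 _)) (L2norm T (fun t => _ - _)) (L2norm T z) => a4 a5 a6.
move: `|w0| (L2norm T F) => w f *.
apply: (@le_trans _ _ ((C + P + 1) * a6 + f)).
  by rewrite !mulrDl mul1r; lra.
apply: (@le_trans _ _ ((C + P + 1) * (w + 2 * f) + f)); first by rewrite lerD2r ler_wpM2l// !addr_ge0.
by nra.
Qed.

Lemma weighted_smeas (Z : normedModType R) (kap : R) (F : R -> Z) : smeas F ->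
  smeas (fun t => expR (- kap * t) *: F t).
Proof. by apply: smeasM; exact: measurable_expR_scale. Qed.

(** [skew_estimate] bounds [St (iU z)] by a small multiple of z in U and a large one of z in W. In
    the weighted norm F controls the first at no cost and the second with the factor 1 / (4 kap). *)
Lemma mild_S_contraction : exists2 kap, 0 < kap & forall F z, L2 T F -> mild F 0 z ->
  L2 T (fun t => St (iU (z t))) ->
  wnorm T kap (fun t => St (iU (z t))) <= 4^-1 * wnorm T kap F.
Proof.
have e0 : (0 : R) < 32^-1 by rewrite invr_gt0.
have [C C0 hC] := skew_estimate hsigma hstruct e0.
(* With this choice C / (4 kap) <= 1/32, and 1/32 + 1/32 is the square of 1/4. *)
pose kap := 8 * C + 1; have kap0 : 0 < kap by rewrite ltr_wpDl// mulr_ge0.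
have dle : sigma / 2 <= (1 + sigma) / 2 by rewrite ler_pM2r ?invr_gt0// lerDr.
have [J JE [M M0 hM]] := dom_inclusion A dle.
exists kap => // F z LF mz LS; have Lz := mz.1.
have [Ly _] := L2_linear M0 hM Lz.
have N1 := mild_weighted_U hT (ltW kap0) LF mz.
have N2 := mild_weighted_W hT kap0 LF mz Ly (aeT_all (fun t _ => JE (z t))).
have W (Z : normedModType R) (a : R -> Z) : L2 T a -> L2 T (fun t => expR (- kap * t) *: a t) 
  := fun La => L2_weighted kap hT La.
have N3 := @L2norm_sqr_le _ T _ _ _ _ _ _ 32^-1 C (W _ _ LS) (W _ _ Lz) (W _ _ Ly) (ltW e0) C0.
rewrite -(@ler_pXn2r _ 2)// ?nnegrE ?mulr_ge0 ?invr_ge0 ?L2norm_ge0//.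
apply: (le_trans (N3 _)).
  apply: aeT_all => t _; rewrite !normrZ !exprMn (lo_St_X hL3).
  rewrite (mulrCA _ (_ ^+ 2)) (mulrCA C) -mulrDr; apply: ler_wpM2l; first exact: sqr_ge0.
  exact: hC (JE (z t)).
rewrite -/(wnorm T kap F) in N1 N2; rewrite exprMn.
apply: (@le_trans _ _ (32^-1 * wnorm T kap F ^+ 2 + C * ((4 * kap)^-1 * wnorm T kap F ^+ 2))).
  by apply: lerD; apply: ler_wpM2l => //; exact: ltW.
rewrite (mulrA C) -mulrDl; apply: ler_wpM2r; first exact: sqr_ge0.
have : C * (4 * kap)^-1 <= 32^-1.
  rewrite ler_pdivrMr ?mulr_gt0// /kap (_ : _ * _ = C + 8^-1); last by field.
  by rewrite lerDl invr_ge0.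
move=> h; apply: (le_trans (lerD (lexx _) h)).
by rewrite (_ : 4^-1 ^+ 2 = 32^-1 + 32^-1) ?lexx//; field.
Qed.

Lemma difference_telescope (V : zmodType) (c a b p m q : V) :
  (c - a - p) - (c - b - q) = - ((a - b) + (p - m) + (m - q)).
Proof.
transitivity (b + q - (a + p)).
  by rewrite -(addrA c (- a)) -(addrA c (- b)) -(opprD a) -(opprD b) opprB [LHS]addrC [LHS]addrA subrK.
by rewrite -(addrA (a - b)) (addrA (p - m)) subrK addrACA -(opprD b) opprB.
Qed.

Lemma quadratic_difference (U V : lmodType R) (Q : {bilinear U -> U -> V}) (u v w : U) (c a b : V) :
  u - v = w -> (c - a - Q u u) - (c - b - Q v v) = - ((a - b) + Q w u + Q v w).
Proof. by move=> <-; rewrite (linearBl _ u) linearBr; exact: difference_telescope. Qed.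

Lemma St_bound : exists2 C, 0 <= C & forall u b db, Xt u b db ->
  L2 T (fun t => St (u t)) /\ L2norm T (fun t => St (u t)) <= C * NX u b db.
Proof.
have [C hC] := lo_St_bounded hL3; exists `|C| => // u b db hu.
have [L n] := hC u b db hu; split=> //; apply: (le_trans n).
by apply: ler_wpM2r; [exact: L2H1norm_ge0|exact: ler_norm].
Qed.

Lemma Bt_bound : exists2 C, 0 <= C & forall u b db v c dc, Xt u b db -> Xt v c dc ->
  L2 T (fun t => Bt (u t) (v t)) /\
  L2norm T (fun t => Bt (u t) (v t)) <= C * NX u b db * NX v c dc.
Proof.
have [C hC] := lo_Bt_bounded hL3; exists `|C| => // u b db v c dc hu hv.
have [L n] := hC u b db v c dc hu hv; split=> //; apply: (le_trans n).
apply: ler_wpM2r; first exact: L2H1norm_ge0.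
by apply: ler_wpM2r; [exact: L2H1norm_ge0|exact: ler_norm].
Qed.

(** Of the contraction ratio 1/2, one half is spent on [St] and the other on [Bt], whose share is
    small because u is. Bounding u by an arbitrary d is what later brings it within the reach of
    [lifted_uniqueness]. *)
Lemma lifted_existence (A0 : {linear spU A sigma -> spV' A sigma}) (d : R) :
  (forall u k, A0 u (pV k) = eigval A k * ip (val u) (eigvec A k) :> R) -> 0 < d ->
  exists2 rho, 0 < rho & forall f ht bh dbh w0, L2 T f -> Xt ht bh dbh ->
    L2norm T f + NX ht bh dbh + `|w0| <= rho ->
    exists F z, let u t := ht t + iU (z t) in
      [/\ L2 T F, mild F w0 z,
        NX u (fun t => bh t + pivotV A sigma (val (z t))) (fun t => dbh t + (F t - A0 (z t))) <= d
      & aeT T (fun t => F t = f t - dbh t - St (ht t) - St (iU (z t)) - Bt (u t) (u t))].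
Proof.
move=> A0E d0; have [K K0 hK] := mild_Xt A0E.
have [kap kap0 hS] := mild_S_contraction.
have [CS CS0 hCS] := St_bound; have [CB CB0 hCB] := Bt_bound.
pose Ek := expR (kap * T); have Ek0 : 0 < Ek := expR_gt0 _.
(* If z is mild for F with initial value 0, then [q] times the weighted norm of F times the norm of
   v bounds [Bt (iU z) v]: [K] is from maximal regularity and [Ek] from removing the weight. *)
pose q := CB * K * Ek; have q0 : 0 <= q by rewrite !mulr_ge0// ltW.
have q1 : 0 < 8 * (q + 1) by rewrite mulr_gt0// ltr_wpDl.
(* [e] will bound u; the two terms in the difference of the quadratic parts then cost 2 q e <= 1/4
   together. *)
pose e := Num.min d (8 * (q + 1))^-1.
have e0 : 0 < e by rewrite lt_min d0 invr_gt0.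
have ed : e <= d by rewrite ge_min lexx.
have qe : 2 * q * e <= 4^-1.
  apply: (@le_trans _ _ (2 * q * (8 * (q + 1))^-1)).
    by apply: ler_wpM2l; [exact: mulr_ge0|rewrite ge_min lexx orbT].
  rewrite ler_pdivrMr// (_ : 4^-1 * _ = 2 * q + 2); last by field.
  by rewrite lerDl.
(* For F in the ball of radius r, the part of u due to F is at most e / 2. *)
pose r := e / (4 * (K * Ek + 1)).
have r0 : 0 < r by rewrite divr_gt0// mulr_gt0// ltr_wpDl// mulr_ge0// ltW.
have KE1 : 0 < K * Ek + 1 by rewrite ltr_wpDl// mulr_ge0// ltW.
have re : 2 * (K * (Ek * r)) <= e / 2.
  rewrite (_ : 2 * _ = e / 2 * ((K * Ek) / (K * Ek + 1))); last by rewrite /r; field; exact: lt0r_neq0.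
  by rewrite ler_piMr ?divr_ge0 ?(ltW e0)// ler_pdivrMr// mul1r lerDl.
pose M := 1 + CS + CS * K + 2 * CB * e * (1 + K).
have Q0 : 0 <= 2 * CB * e by rewrite !mulr_ge0// ltW.
have M1 : 1 <= M by rewrite /M -!addrA lerDl !addr_ge0 ?mulr_ge0 ?addr_ge0 ?(ltW e0).
have M0 : 0 < M := lt_le_trans ltr01 M1.
have K1 : 0 < 1 + K by rewrite ltr_wpDr.
(* The first bound puts Phi(0) within r / 2; the second limits the part of u due to the lifting and
   the initial value to e / 2. *)
pose rho := Num.min (r / (2 * M)) (e / (4 * (1 + K))).
have rho0 : 0 < rho by rewrite lt_min !divr_gt0// mulr_gt0.
exists rho => // f ht bh dbh w0 Lf hht small.
(* One mild solution is fixed for every F; the value 0 outside L^2 is a dummy that makes the choice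
   total. *)
have /choice[z hz] : forall F, exists z, L2 T F -> mild F w0 z.
  move=> F; have [LF|nL] := pselect (L2 T F); last by exists (fun=> 0).
  by have [z mz] := mild_exists hT hsigma w0 LF; exists z.
pose u F t := ht t + iU (z F t).
pose b F t := bh t + pivotV A sigma (val (z F t)).
pose db F t := dbh t + (F t - A0 (z F t)).
have hu F : L2 T F -> Xt (u F) (b F) (db F) /\ NX (u F) (b F) (db F) <=
    2 * (NX ht bh dbh + K * (L2norm T F + `|w0|)).
  move=> LF; have [_ h1 h2] := hK F w0 (z F) LF (hz F LF).
  have [h3 h4] := L2H1D hT hht h1; split=> //; apply: (le_trans h4).
  by rewrite ler_wpM2l// lerD2l.
pose Phi F t := f t - dbh t - St (ht t) - St (iU (z F t)) - Bt (u F t) (u F t).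
have [_ [_ Ldb _] _] := hht; have [LSh nSh] := hCS _ _ _ hht.
have LSz F : L2 T F -> L2 T (fun t => St (iU (z F t))).
  by move=> LF; have [_ h1 _] := hK F w0 (z F) LF (hz F LF); exact: (hCS _ _ _ h1).1.
have LP F : L2 T F -> L2 T (Phi F).
  move=> LF; have [hX _] := hu F LF; have [LB _] := hCB _ _ _ _ _ _ hX hX.
  exact: (L2B (L2B (L2B (L2B Lf Ldb).1 LSh).1 (LSz F LF)).1 LB).1.
have nh := L2H1norm_ge0 T ht bh dbh; have nf := L2norm_ge0 T f; have nw := normr_ge0 w0.
have hde F : L2 T F -> wnorm T kap F <= r -> NX (u F) (b F) (db F) <= e.
  move=> LF Fr; apply: (le_trans (hu F LF).2).
  have h1 : K * L2norm T F <= K * (Ek * r).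
    apply: (ler_wpM2l K0); apply: (le_trans (L2norm_wnorm hT (ltW kap0) LF)).
    exact: (ler_wpM2l (ltW Ek0)).
  have h2 : (1 + K) * (NX ht bh dbh + `|w0|) <= e / 4.
    rewrite mulrC -ler_pdivlMr// -mulrA -invfM.
    apply: le_trans (_ : rho <= _); last by rewrite /rho ge_min lexx orbT.
    by apply: le_trans small; rewrite lerD2r lerDr.
  move: h1 h2; move: (NX _ _ _) nh (L2norm _ _) `|_| nw (Ek * r) re => n n0 x w w0' y hy h1 h2.
  rewrite (_ : 2 * _ = 2 * (K * x) + 2 * (n + K * w)); last by ring.
  rewrite (splitr e); apply: lerD; first exact: le_trans (ler_wpM2l _ h1) hy.
  rewrite (_ : e / 2 = 2 * (e / 4)); last by field.
  apply: ler_wpM2l => //; apply: le_trans h2.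
  rewrite (_ : (1 + K) * _ = (n + K * w) + (w + K * n)); last by ring.
  by rewrite lerDl addr_ge0// mulr_ge0.
have wB v c dc v' c' dc' : Xt v c dc -> Xt v' c' dc' ->
    wnorm T kap (fun t => Bt (v t) (v' t)) <= CB * NX v c dc * NX v' c' dc'.
  move=> hv hv'; have [LB nB] := hCB _ _ _ _ _ _ hv hv'.
  exact: le_trans (wnorm_le (ltW kap0) LB) nB.
have L0 : L2 T (fun=> 0 : spV' A sigma) := (L20 T).1.
have [F G LF LG Fr Gr||F [LF Fr FP]] := @weighted_fixed_point _ T _ kap hT
  (@dual_abs_complete _ _) Phi r r0 LP.
(* The two mild solutions share their initial value, so their difference is mild for F - G with
   initial value 0 and the weighted estimates apply. *)
- have mz := mildB LF LG (hz F LF) (hz G LG).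
  have {}mz := @eq_rect _ _ (fun w => mild _ w _) mz _ (subrr w0).
  have [LFG _] := L2B LF LG.
  have [_ Xz nz] := hK _ _ _ LFG mz; rewrite normr0 addr0 in nz.
  have [XF _] := hu F LF; have [XG _] := hu G LG.
  have [LS _] := hCS _ _ _ Xz; have [LB1 _] := hCB _ _ _ _ _ _ Xz XF.
  have [LB2 _] := hCB _ _ _ _ _ _ XG Xz.
  rewrite (@wnorm_ae _ T _ _ _ (fun t => - (St (iU (z F t - z G t)) +
      Bt (iU (z F t - z G t)) (u F t) + Bt (u G t) (iU (z F t - z G t))))); last first.
    apply: aeT_all => t _; rewrite /Phi.
    have -> : St (iU (z F t - z G t)) = St (iU (z F t)) - St (iU (z G t)).
      by rewrite (linearB iU) (linearB St).
    apply: (@quadratic_difference _ _ Bt (u F t) (u G t) (iU (z F t - z G t))).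
    by rewrite /u (linearB iU) opprD addrACA subrr add0r.
  rewrite wnormN; apply: (le_trans (wnormD kap hT (L2D LS LB1).1 LB2)).
  apply: (le_trans (lerD (wnormD kap hT LS LB1) (lexx _))).
  have h1 := hS _ _ LFG mz LS; have h2 := wB _ _ _ _ _ _ Xz XF; have h3 := wB _ _ _ _ _ _ XG Xz.
  have h4 := L2norm_wnorm hT (ltW kap0) LFG; have h5 := hde F LF Fr; have h6 := hde G LG Gr.
  have nX := L2H1norm_ge0 T (fun t => iU (z F t - z G t)) (fun t => pivotV A sigma (val (z F t - z G t)))
    (fun t => F t - G t - A0 (z F t - z G t)).
  have n0 : 0 <= wnorm T kap (fun t => F t - G t) := L2norm_ge0 _ _.
  have h7 : CB * NX (fun t => iU (z F t - z G t)) (fun t => pivotV A sigma (val (z F t - z G t)))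
    (fun t => F t - G t - A0 (z F t - z G t)) <= q * wnorm T kap (fun t => F t - G t).
    rewrite /q -!mulrA ler_wpM2l// (le_trans nz)// ler_wpM2l//.
  have h8 : wnorm T kap (fun t => Bt (iU (z F t - z G t)) (u F t)) <=
      q * wnorm T kap (fun t => F t - G t) * e.
    exact: le_trans h2 (ler_pM (mulr_ge0 CB0 nX) (L2H1norm_ge0 _ _ _ _) h7 h5).
  have h9 : wnorm T kap (fun t => Bt (u G t) (iU (z F t - z G t))) <=
      q * wnorm T kap (fun t => F t - G t) * e.
    apply: (le_trans h3); rewrite mulrAC.
    exact: ler_pM (mulr_ge0 CB0 nX) (L2H1norm_ge0 _ _ _ _) h7 h6.
  have h10 := ler_wpM2r n0 qe.
  apply: (le_trans (lerD (lerD h1 h8) h9)); move: (wnorm _ _ _) h10 => x h10.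
  rewrite (_ : _ + _ = 4^-1 * x + 2 * q * e * x); last by ring.
  by rewrite (_ : x / 2 = 4^-1 * x + 4^-1 * x) ?lerD2l//; field.
- have [X0 n0] := hu _ L0; rewrite (L20 T).2 add0r in n0.
  have W0 : wnorm T kap (fun=> 0 : spV' A sigma) <= r.
    by apply: le_trans (wnorm_le (ltW kap0) L0) _; rewrite (L20 T).2 ltW.
  have ne := hde _ L0 W0; have [LB nB] := hCB _ _ _ _ _ _ X0 X0.
  have [_ Xz nz] := hK _ _ _ L0 (hz _ L0); rewrite (L20 T).2 add0r in nz.
  have [LS nS] := hCS _ _ _ Xz; have LfD := L2B Lf Ldb.
  have LfDS := L2B LfD.1 LSh; have LfDSS := L2B LfDS.1 LS.
  apply: (le_trans (wnorm_le (ltW kap0) (LP _ L0))); apply: (le_trans (L2B LfDSS.1 LB).2).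
  apply: (@le_trans _ _ (L2norm T f + NX ht bh dbh + CS * NX ht bh dbh + CS * (K * `|w0|)
    + CB * (2 * (NX ht bh dbh + K * `|w0|)) * e)).
    apply: lerD; last first.
      have nX := L2H1norm_ge0 T (u (fun=> 0)) (b (fun=> 0)) (db (fun=> 0)).
      exact: le_trans nB (ler_pM (mulr_ge0 CB0 nX) nX (ler_wpM2l CB0 n0) ne).
    apply: (le_trans LfDSS.2); apply: lerD; last exact: le_trans nS (ler_wpM2l CS0 nz).
    apply: (le_trans LfDS.2); apply: lerD; last exact: nSh.
    apply: (le_trans LfD.2); rewrite lerD2l.
    have [_ h _] := @H1norm_bounds _ T _ bh dbh; apply: (le_trans h).
    by rewrite /L2H1norm lerDr L2norm_ge0.
  apply: (@le_trans _ _ (M * rho)); last first.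
    rewrite mulrC -ler_pdivlMr// -mulrA -invfM (_ : r / (2 * M) = r / (2 * M))//.
    by rewrite /rho ge_min lexx.
  apply: le_trans (ler_wpM2l (ltW M0) small).
  move: (L2norm T f) nf (NX ht bh dbh) nh `|w0| nw => p p0 n nn w ww.
  rewrite -subr_ge0 /M (_ : _ - _ = w + CS * (p + w) + CS * K * (p + n) +
    2 * CB * e * (p + w + K * (p + n))); last by ring.
  by rewrite !addr_ge0// !mulr_ge0// ?addr_ge0// ?mulr_ge0// ?addr_ge0// ltW.
exists F, (z F); split => //; first exact: hz.
exact: le_trans (hde F LF Fr) ed.
Qed.

Lemma addr0_opp (V : zmodType) (x y : V) : x + y = 0 -> - x = y.
Proof. by move=> /eqP; rewrite addrC addr_eq0 => /eqP ->. Qed.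

(** Written as a primitive, the squared weighted norm over [0, t1] is continuous in t1 and vanishes
    at 0, as the intermediate value argument for uniqueness requires. *)
Lemma cut_wnorm_sqr (Z : normedModType R) (kap : R) (G : R -> Z) : L2 T G ->
  exists2 g, mu.-integrable `[0, T] (EFin \o g) & forall t1, 0 <= t1 <= T ->
  wnorm T kap (fun t => \1_(`]-oo, t1]) t *: G t) ^+ 2 = \int[mu]_(t in `[0, t1]) g t.
Proof.
move=> /L2_rep[G' [sG LG GG _]].
pose g t := `|expR (- kap * t) *: G' t| ^+ 2.
exists g; first by apply: L2_sqi; [exact: weighted_smeas|exact: L2_weighted].
move=> t1 /andP[t10 t1T]; rewrite /wnorm L2norm_sqr.
transitivity (\int[mu]_(t in `[0, T]) (g \_ `]-oo, t1]) t).
  apply: Rintegral_ae; apply: aeTS GG => t _ ->.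
  rewrite /g patchE indicE; case: ifP => _.
    by rewrite scale1r.
  by rewrite scale0r scaler0 normr0 expr0n.
rewrite -Rintegral_mkcondr; congr Rintegral; apply/seteqP; split => t /=.
  by rewrite !in_itv/= => -[/andP[-> _] ->].
by rewrite !in_itv/= => /andP[-> h]; split => //; exact: le_trans h t1T.
Qed.

(* w is not assumed small: with a t the weighted norm of G on [0, t], the key estimate
   a <= a / 2 + M a^2 leaves a gap above 0 that the continuous function a, which
   vanishes at 0, cannot cross. *)
Lemma lifted_uniqueness (A0 : {linear spU A sigma -> spV' A sigma}) :
  (forall u k, A0 u (pV k) = eigval A k * ip (val u) (eigvec A k) :> R) ->
  exists2 d, 0 < d & forall u b db (w : R -> spU A sigma) bw dbw, Xt u b db -> NX u b db <= d ->
    L2 T w -> H1 T bw dbw -> aeT T (fun t => bw t = pivotV A sigma (val (w t))) ->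
    (forall (P : R -> Prop) e k, aeT T P -> 0 < e -> exists t,
       [/\ 0 <= t <= T, t < e, P t & `|ip (val (w t)) (eigvec A k)| < e]) ->
    aeT T (fun t => dbw t + A0 (w t) + (St (iU (w t)) + Bt (iU (w t)) (u t) +
      Bt (u t) (iU (w t)) + Bt (iU (w t)) (iU (w t))) = 0) ->
    aeT T (fun t => w t = 0).
Proof.
move=> A0E; have [K K0 hK] := mild_Xt A0E.
have [kap kap0 hS] := mild_S_contraction.
have [CS CS0 hCS] := St_bound; have [CB CB0 hCB] := Bt_bound.
pose Ek := expR (kap * T); have Ek0 : 0 < Ek := expR_gt0 _.
pose q := CB * K * Ek; have q0 : 0 <= q by rewrite !mulr_ge0// ltW.
have q1 : 0 < 8 * (q + 1) by rewrite mulr_gt0// ltr_wpDl.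
(* With this d each of the two terms pairing w with u costs at most 1/8; with the 1/4 from [St] they
   make the 1/2 in [key]. *)
exists (8 * (q + 1))^-1; first by rewrite invr_gt0.
move=> u b db w bw dbw hu ud Lw Hw bwE init eqn.
pose G t := dbw t + A0 (w t).
have mG : mild G 0 w := weak_solution_mild hT A0E Lw Hw bwE init.
have LG : L2 T G by have [_ Ldb _] := Hw; exact: (L2D Ldb (L2_Aop A0E Lw).1).1.
pose G1 t1 t := \1_(`]-oo, t1]) t *: G t.
pose a t1 := wnorm T kap (G1 t1).
have a0 t1 : 0 <= a t1 := L2norm_ge0 _ _.
pose M := CB * (K * Ek) ^+ 2 + 1.
have M0 : 0 < M by rewrite ltr_wpDl// mulr_ge0// sqr_ge0.
have key t1 : a t1 <= a t1 / 2 + M * a t1 ^+ 2.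
  have bound (t : R) : 0 <= t <= T -> `|\1_(`]-oo, t1]) t : R| <= 1.
    by move=> _; rewrite indicE; case: (_ \in _); rewrite ?normr1 ?normr0.
  have mind : measurable_fun setT (\1_(`]-oo, t1]) : R -> R) by exact: measurable_indic.
  have [L1 _] := L2M mind bound ler01 LG.
  (* [Bt] is bounded over the whole of [0, T] only, so w is not restricted: z is the mild solution
     for G cut off after t1 and agrees with w before t1 by causality. *)
  have [z mz] := mild_exists hT hsigma 0 L1.
  have zw : aeT T (fun t => t <= t1 -> z t = w t).
    apply: (mild_causal mz mG) => t tt1.
    by rewrite indicE mem_set ?scale1r//= in_itv/=.
  have [_ Xz nz] := hK _ _ _ L1 mz; rewrite normr0 addr0 in nz.
  have [LS _] := hCS _ _ _ Xz.
  have [LB1 nB1] := hCB _ _ _ _ _ _ Xz hu; have [LB2 nB2] := hCB _ _ _ _ _ _ hu Xz.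
  have [LB3 nB3] := hCB _ _ _ _ _ _ Xz Xz.
  pose X t := St (iU (z t)) + Bt (iU (z t)) (u t) + Bt (u t) (iU (z t)) + Bt (iU (z t)) (iU (z t)).
  have L12 := L2D LS LB1; have L123 := L2D L12.1 LB2; have LX : L2 T X := (L2D L123.1 LB3).1.
  (* Up to t1 the equation for w reads G = - X, since z = w there; after t1 the cut-off G
     vanishes. *)
  have aX : a t1 <= wnorm T kap X.
    have [_ h] := L2M mind bound ler01 (L2_weighted kap hT LX).
    rewrite mul1r in h; apply: le_trans h; rewrite /a -wnormN /wnorm.
    rewrite le_eqVlt; apply/orP; left; apply/eqP/L2norm_ae.
    apply: aeT2 zw eqn => t _ h1 h2; rewrite /G1 indicE.
    have [tt|tt] := boolP (t \in `]-oo, t1]%classic); last by rewrite !scale0r oppr0 scaler0.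
    rewrite !scale1r /G; congr (_ *: _); apply: addr0_opp; rewrite /X h1//.
    by move: tt; rewrite inE/= in_itv.
  have nL := L2norm_wnorm hT (ltW kap0) L1; rewrite -/(a t1) -/Ek in nL.
  have N0 := L2H1norm_ge0 T (fun t => iU (z t)) (fun t => pivotV A sigma (val (z t)))
    (fun t => \1_(`]-oo, t1]) t *: G t - A0 (z t)).
  have nz' := le_trans nz (ler_wpM2l K0 nL).
  have nu := L2H1norm_ge0 T u b db.
  have e1 : wnorm T kap (fun t => Bt (iU (z t)) (u t)) <= q * (8 * (q + 1))^-1 * a t1.
    apply: (le_trans (wnorm_le (ltW kap0) LB1)); apply: (le_trans nB1).
    apply: (le_trans (ler_pM (mulr_ge0 CB0 N0) nu (ler_wpM2l CB0 nz') ud)).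
    by rewrite le_eqVlt; apply/orP; left; apply/eqP; rewrite /q; ring.
  have e2 : wnorm T kap (fun t => Bt (u t) (iU (z t))) <= q * (8 * (q + 1))^-1 * a t1.
    apply: (le_trans (wnorm_le (ltW kap0) LB2)); apply: (le_trans nB2).
    apply: (le_trans (ler_pM (mulr_ge0 CB0 nu) N0 (ler_wpM2l CB0 ud) nz')).
    by rewrite le_eqVlt; apply/orP; left; apply/eqP; rewrite /q; ring.
  have e3 : wnorm T kap (fun t => Bt (iU (z t)) (iU (z t))) <= CB * (K * Ek) ^+ 2 * a t1 ^+ 2.
    apply: (le_trans (wnorm_le (ltW kap0) LB3)); apply: (le_trans nB3).
    apply: (le_trans (ler_pM (mulr_ge0 CB0 N0) N0 (ler_wpM2l CB0 nz') nz')).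
    by rewrite le_eqVlt; apply/orP; left; apply/eqP; ring.
  have e0 := hS _ _ L1 mz LS; rewrite -/(a t1) in e0.
  have s1 := wnormD kap hT LS LB1; have s2 := wnormD kap hT L12.1 LB2.
  have s3 := wnormD kap hT L123.1 LB3.
  apply: (le_trans aX); apply: (le_trans s3); apply: lerD; last first.
    by apply: (le_trans e3); rewrite ler_wpM2r ?sqr_ge0// lerDl.
  apply: (le_trans s2); apply: (le_trans (lerD s1 e2)); apply: (le_trans (lerD (lerD e0 e1) (lexx _))).
  rewrite -!mulrDl mulrC; apply: ler_wpM2l => //.
  rewrite (_ : 2^-1 = 4^-1 + 8^-1 + 8^-1); last by field.
  have e4 : q * (8 * (q + 1))^-1 <= 8^-1.
    by rewrite ler_pdivrMr// mulrA mulVf// mul1r lerDl.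
  by rewrite !lerD.
(* a / 2 <= M a^2 forces a = 0 or a >= 1 / (2 M). *)
have gap t1 : a t1 < (2 * M)^-1 -> a t1 = 0.
  move=> h; apply/eqP; rewrite eq_le a0 andbT leNgt; apply/negP => p.
  have := key t1; rewrite -lerBlDl (_ : a t1 - _ = a t1 / 2); last by field.
  rewrite expr2 mulrA mulrC ler_pM2r// leNgt => /negP; apply.
  by rewrite mulrC -ltr_pdivlMr// -invfM.
have [g ig gE] := cut_wnorm_sqr kap LG.
have cg := primitive_continuous hT ig.
have aT : a T = 0.
  apply: contrapT => aT0.
  have M2 : 0 < (2 * M)^-1 by rewrite invr_gt0 mulr_gt0.
  have h1 : (2 * M)^-1 <= a T by rewrite leNgt; apply/negP => /gap.
  (* Half of 1 / (2 M) lies inside the gap; if a(T) lay beyond it, a would take this value. The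
     intermediate value theorem is applied to a^2, which is the primitive. *)
  pose v := ((2 * M)^-1 / 2) ^+ 2.
  have v0 : 0 < v by rewrite exprn_gt0// divr_gt0.
  have gT : \int[mu]_(t in `[0, T]) g t = a T ^+ 2 by rewrite -gE// lexx ltW.
  have g0 : \int[mu]_(t in `[0, 0]) g t = 0 by rewrite set_itv1 Rintegral_set1.
  have [|t tI tE] := @IVT _ _ 0 T v (ltW hT) cg.
    rewrite gT g0 (min_l (sqr_ge0 _)) (max_r (sqr_ge0 _)); apply/andP; split; first exact: ltW.
    rewrite /v ler_pXn2r ?nnegrE ?a0//; last by rewrite divr_ge0// ltW.
    by apply: le_trans h1; rewrite ler_pdivrMr// ler_peMr ?(ltW M2)// ler1n.
  rewrite -gE in tE; last by move: tI; rewrite in_itv.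
  have at_ : a t = (2 * M)^-1 / 2.
    by move/eqP: tE; rewrite eqrXn2 ?a0 ?divr_ge0 ?(ltW M2)// => /eqP.
  have : a t = 0 by apply: gap; rewrite at_ ltr_pdivrMr// ltr_pMr ?ltr1n.
  by rewrite at_; apply/eqP; rewrite gt_eqF// divr_gt0.
have nG : L2norm T G = 0.
  apply/eqP; rewrite eq_le L2norm_ge0 andbT.
  apply: (le_trans (L2norm_wnorm hT (ltW kap0) LG)).
  suff -> : wnorm T kap G = a T by rewrite aT mulr0.
  apply: wnorm_ae; apply: aeT_all => t /andP[_ tT].
  by rewrite /G1 indicE mem_set ?scale1r//= in_itv/=.
have := mild_bound hT LG mG; rewrite nG normr0 !expr0n/= mulr0 addr0 => h.
apply: (L2norm_eq0 Lw); apply/eqP; rewrite -sqrf_eq0 eq_le h sqr_ge0//.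
Qed.

End LiftedProblem.

(** * Assembling the theorem *)

Lemma equation_of_fixed_point (V : zmodType) (f d a s s' q : V) :
  d + ((f - d - s - s' - q) - a) + (a + (s + s')) + q = f.
Proof.
rewrite [LHS](AC (((1*6)*(1*2))*1) (2*(1*3)*(8*7)*(9*4)*(10*5)*(11*6)))/=.
by rewrite !subrr !addr0.
Qed.

Lemma equation_difference (R : realType) (U V : lmodType R) (L S : {linear U -> V})
    (Q : {bilinear U -> U -> V}) (u u' v : U) (d d' f : V) : u' - u = v ->
  d + (L u + S u) + Q u u = f -> d' + (L u' + S u') + Q u' u' = f ->
  d' - d + L v + (S v + Q v u + Q u v + Q v v) = 0.
Proof.
move=> uv E1 E2; have u'E : u' = u + v by rewrite -uv addrC subrK.
have QE : Q u' u' = Q u u + Q v u + (Q u v + Q v v).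
  by rewrite u'E (linearDl _ (u + v)) !linearDr addrACA.
move: E2; rewrite QE u'E !linearD -E1.
move: (L u) (L v) (S u) (S v) (Q u u) (Q v u) (Q u v) (Q v v) => p x s y q q1 q2 q3 E2.
apply: (@addIr _ (d + (p + s) + q)); rewrite add0r -[in RHS]E2.
rewrite [LHS](AC ((3*4)*((1*2)*1)) (((1*((9*3)*(10*4)))*((11*5)*(6*7)))*(8*2)))/=.
by rewrite subrr addr0.
Qed.

Theorem theorem2p3 (R : realType) (T : R) (hT : 0 < T)
    (sigma : R) (hsigma : 0 <= sigma <= 1)
    (H : hilbertType R) (A : eigensystem H)
    (D : set H) (cA cS : H -> H)
    (B : {bilinear spU A sigma -> spW A sigma -> spV' A sigma})
    (hstruct : structural D cA cS B)
    (E : lmodType R) (eV' : {linear spV' A sigma -> E})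
    (Ut Vt Wt : completeNormedModType R)
    (eU : {linear Ut -> E}) (eV : {linear Vt -> E}) (eW : {linear Wt -> E})
    (iU : {linear spU A sigma -> Ut}) (iV : {linear spV A sigma -> Vt})
    (iW : {linear spW A sigma -> Wt})
    (hL1 : lifting_spaces T eV' eU eV eW iU iV iW)
    (Z : lmodType R) (TT : (R -> Ut) -> Z)
    (hL2 : boundary_operator T eV' eU iU TT)
    (Dt : set H) (cAt cSt : H -> H)
    (At St : {linear Ut -> spV' A sigma})
    (Bt : {bilinear Ut -> Ut -> spV' A sigma})
    (hL3 : lifted_operators T eV' eU iU D cA cS B Dt cAt cSt At St Bt)
    (XT : completeNormedModType R) (eX : {linear XT -> Z})
    (hL4 : lifting_property T eV' eU TT eX At) :
  exists2 r : R, 0 < r &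
    forall (f : R -> spV' A sigma) (g : Wt) (h : XT) (ht : R -> Ut) (g0 : Wt),
      L2 T f ->
      is_lifting T eV' eU TT eX At h ht ->
      initial_value T eU eW ht g0 ->
      (exists w : spW A sigma, g0 - g = iW w) ->
      L2norm T f + `|g| + `|h| < r ->
      exists2 u, is_solution T eV' eU eW TT eX At St Bt f g h u &
        forall u', is_solution T eV' eU eW TT eX At St Bt f g h u' ->
          aeT T (fun t => u' t = u t).

Proof.
have [A0 A0At A0E] := lifted_A_exists hsigma hL3.
have [d d0 huniq] := lifted_uniqueness hT hstruct hL1 hL3 A0E.
have [rho rho0 hex] := lifted_existence hT hstruct hL1 hL3 A0E d0.
have [K _ hK] := mild_Xt hT hL1 A0E.
have [ciW injW cloW injeW eWiW] := ls_W hL1.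
have [CW CW0 hCW] := bounded_inverse (dom_abs_complete (spW_ge0 hsigma)) ciW injW cloW.
have [ch ch0 hch] := lp_bound hL4; have [Cc hCc] := ls_cont hL1.
(* M times the data bounds the input of [lifted_existence]: [ch] comes from the lifting, [CW] from
   the inverse of [iW], and |Cc| ch from the trace of the lifting at time 0. *)
pose M := 1 + ch + CW + CW * (`|Cc| * ch).
have M1 : 1 <= M.
  by rewrite /M -!addrA lerDl !addr_ge0 ?mulr_ge0// ltW.
have M0 : 0 < M := lt_le_trans ltr01 M1.
exists (rho / M); first exact: divr_gt0.
move=> f g h ht g0 Lf hl [cg [ccg rg] cg0] [w gw] small.
have [[bh [dbh hht]] hA0 hTT] := hl.
have nht := hch h ht bh dbh hl hht.
(* [ls_cont] bounds some representative c, whereas g0 is the value at 0 of [cg]. Both agree almost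
   everywhere because [eW] is injective, so the bound is read off at times close to 0. *)
have ng0 : `|g0| <= `|Cc| * ch * `|h|.
  have [c [_ rc] nc] := hCc ht bh dbh hht.
  rewrite -cg0; apply/ler_addgt0Pr => e e0.
  have [t [tI _ tE te]] := continuous_itv_near0 hT ccg (aeT2 (fun t _ h1 h2 =>
    injeW _ _ (etrans (esym h2) h1)) rg rc) e0.
  rewrite -[cg 0](subrK (cg t)) addrC (le_trans (ler_normD _ _))// lerD//; last exact: ltW.
  have nX := L2H1norm_ge0 T ht bh dbh.
  have tI' : t \in `[0, T] by rewrite in_itv.
  rewrite -tE -mulrA; apply: (le_trans (nc t tI')).
  exact: le_trans (ler_wpM2r nX (ler_norm Cc)) (ler_wpM2l (normr_ge0 _) nht).
have nw : `|- w| <= CW * (`|Cc| * ch * `|h| + `|g|).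
  rewrite normrN; apply: (le_trans (hCW w)); rewrite -gw; apply: (ler_wpM2l CW0).
  by apply: (le_trans (ler_normB _ _)); rewrite lerD2r.
(* The correction [iU z] has to start from g - g0 = - iW w. *)
have [|F [z]] := hex f ht bh dbh (- w) Lf hht.
  apply: (@le_trans _ _ (M * (L2norm T f + `|g| + `|h|))); last first.
    by rewrite mulrC -ler_pdivlMr// ltW.
  apply: (le_trans (lerD (lerD (lexx _) nht) nw)).
  rewrite -subr_ge0 (_ : _ - _ = (ch + CW + CW * (`|Cc| * ch)) * L2norm T f +
    (1 + ch + CW * (`|Cc| * ch)) * `|g| + (1 + CW) * `|h|); last by rewrite /M; ring.
  by rewrite !addr_ge0// mulr_ge0 ?L2norm_ge0// !addr_ge0 ?mulr_ge0// ltW.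
move=> /= [LF mz nu eqF].
have [Xz Xiz _] := hK F (- w) z LF mz.
set u := fun t => ht t + iU (z t).
have [Xu _] := L2H1D hT hht Xiz.
have [cz [ccz cz0 rz]] := mild_cont hT LF mz.
pose cu t := cg t + iW (cz t).
have hcu : cont_rep T eU eW u cu.
  apply: cont_repD; first by split.
  split; first by move=> x; apply: continuous_comp; [exact: ccz|exact: ciW].
  apply: aeTS rz => t _ E1; have [_ _ _ _ eUiU] := ls_U hL1.
  exact: etrans (eUiU _) (etrans (congr1 (eH eV') (esym E1)) (esym (eWiW _))).
have cu0 : cu 0 = g by rewrite /cu cz0 cg0 linearN -gw opprB addrC subrK.
have eq_u : aeT T (fun t => dbh t + (F t - A0 (z t)) + (At (u t) + St (u t)) + Bt (u t) (u t) = f t).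
  apply: aeT2 hA0 eqF => t _ h1 h2.
  have -> : At (u t) = A0 (z t) by rewrite /u (linearD At) h1 add0r A0At.
  have -> : St (u t) = St (ht t) + St (iU (z t)) by rewrite /u (linearD St).
  rewrite h2; exact: equation_of_fixed_point.
have inht : inXt T eV' eU ht by exists bh, dbh.
have iniz : inXt T eV' eU (fun t => iU (z t)) by do 2 eexists; exact: Xiz.
have inu : inXt T eV' eU u by do 2 eexists; exact: Xu.
have TTu : TT u = eX h.
  have TTz : TT (fun t => iU (z t)) = 0.
    apply/(bo_ker hL2 iniz); exists z; last exact: aeT_all.
    by do 2 eexists; exact: Xz.
  have := bo_linear hL2 1 iniz inht; rewrite TTz scaler0 add0r hTT => <-; congr TT.
  by apply/funext => t; rewrite scale1r addrC.
exists u.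
  exists (fun t => bh t + pivotV A sigma (val (z t))), (fun t => dbh t + (F t - A0 (z t))).
  by split => //; exists cu.
move=> u' [b' [db' [Xu' equ' [cu' hcu' cu'0] TTu']]].
have Xd := L2H1B hT Xu' Xu.
have inu' : inXt T eV' eU u' by exists b', db'.
have ind : inXt T eV' eU (fun t => u' t - u t) by do 2 eexists; exact: Xd.
have [w1 [b1 [db1 [Lw1 _ _]]] wE] : exists2 w1, inX T eV' w1 & aeT T (fun t => u' t - u t = iU (w1 t)).
  apply/(bo_ker hL2 ind); have := bo_linear hL2 (-1) inu inu'.
  rewrite TTu TTu' scaleN1r addNr => <-; congr TT.
  by apply/funext => t; rewrite scaleN1r addrC.
have [_ Hd dE] := Xd.
suff w10 : aeT T (fun t => w1 t = 0).
  apply: aeT2 wE w10 => t _ h1 h2; move: h1; rewrite h2 linear0 => /eqP.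
  by rewrite subr_eq0 => /eqP.
have [_ _ _ _ eUiU] := ls_U hL1; have injE := ls_ambient hL1.
(* The equation is expanded around the small solution u, which leaves a term quadratic in the
   difference instead of one involving the arbitrary u'. *)
apply: (huniq _ _ _ w1 _ _ Xu nu Lw1 Hd).
- by apply: aeT2 dE wE => t _ h1 h2; apply: injE; rewrite -h1 h2 eUiU.
- have dle : sigma / 2 <= (1 + sigma) / 2 by rewrite ler_pM2r ?invr_gt0// lerDr.
  have [J JE _] := dom_inclusion A dle.
  (* The difference has a continuous representative in [Wt] that vanishes at 0; the inverse bound
     for [iW] carries its smallness over to W, hence to each coefficient. *)
  have [ccd rcd] := cont_repB hcu' hcu; pose cd t := cu' t - cu t.
  have Jcd : aeT T (fun t => iW (J (w1 t)) = cd t).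
    apply: aeT2 wE rcd => t _ h1 h2; apply: injeW; rewrite -h2 h1.
    exact: etrans (eWiW _) (etrans (congr1 (eH eV') (JE _)) (esym (eUiU _))).
  move=> P e k aeP e0; pose q := (eigval A k `^ (sigma / 2))^-1 * CW.
  have q0 : 0 <= q by rewrite mulr_ge0// invr_ge0 powR_ge0.
  have q1 : 0 < q + 1 by rewrite ltr_wpDl.
  have e1 : 0 < Num.min e (e / (q + 1)) by rewrite lt_min e0 divr_gt0.
  have [t [tI te [Pt Jt]]] := continuous_itv_near0 hT ccd (aeTI aeP Jcd) e1.
  rewrite cu'0 cu0 subrr sub0r normrN -/(cd t) -Jt => hJ.
  exists t; split => //; first by apply: (lt_le_trans te); rewrite ge_min lexx.
  have hJ' : `|iW (J (w1 t))| * (q + 1) < e.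
    by rewrite -ltr_pdivlMr//; apply: (lt_le_trans hJ); rewrite ge_min lexx orbT.
  apply: le_lt_trans hJ'; rewrite -(JE (w1 t)).
  apply: (le_trans (dom_coef_le (J (w1 t)) k)).
  apply: (@le_trans _ _ (q * `|iW (J (w1 t))|)).
    by rewrite /q -mulrA ler_wpM2l ?invr_ge0 ?powR_ge0.
  by rewrite mulrC ler_wpM2l// lerDl.
apply: aeT2 wE (aeTI eq_u equ') => t _ h1 [h2 h3]; rewrite (A0At (w1 t)).
exact: equation_difference h1 h2 h3.
Qed.
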